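(* Let $\sigma_1,\sigma_2\in L_{2,loc}(\mathbb{R})$ and $\tau_1,\tau_2\in L_{1,loc}(\mathbb{R})$ be real-valued $1$-periodic functions, let $\alpha,\theta\in[0,1)$, and put $$q(t)=\sigma_1'(t)+\sigma_2'(\alpha t+\theta)+\tau_1(t)+\tau_2(\alpha t+\theta).$$ If $\alpha$ is a Liouville number and $\sigma_2\in W^s_{2,loc}(\mathbb{R})$ for some $s>0$, then $q$ is a singular Gordon potential.
   Context: Derivatives are understood in the sense of distributions; $\sigma_2'(\alpha t+\theta)$ is the distribution $\sigma_2'$ composed with the affine map $t\mapsto\alpha t+\theta$. $W^s_2(\mathbb{R})$ is the $L_2$-based Sobolev space of order $s$ and $W^s_{2,loc}(\mathbb{R})$ its local version. Liouville number: an irrational number $\alpha$ is a Liouville number if there exist a sequence of rationals $\alpha_m=R_m/T_m$ (with $R_m\in\mathbb{Z}$, $T_m\in\mathbb{N}$) and a constant $C$ such that $|\alpha-\alpha_m|\le C\,m^{-T_m}$ for all $m$. $L_{2,unif}(\mathbb{R})$ is the space of measurable functions $\sigma$ with $\sup_{t\in\mathbb{R}}\int_t^{t+1}|\sigma(s)|^2\,ds<\infty$; $L_{1,unif}(\mathbb{R})$ is the space of measurable functions $\tau$ with $\sup_{t\in\mathbb{R}}\int_t^{t+1}|\tau(s)|\,ds<\infty$. Singular Gordon potential: a real-valued distribution $q$ of the form $q=\sigma'+\tau$ with real-valued $\sigma\in L_{2,unif}(\mathbb{R})$ and $\tau\in L_{1,unif}(\mathbb{R})$ (such distributions are exactly the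 real-valued elements of the space $W^{-1}_{2,unif}(\mathbb{R})$) is called a singular Gordon potential if, for such $\sigma,\tau$, there exist numbers $T_m>0$ with $T_m\to\infty$ and $T_m$-periodic functions $\sigma_m\in L_{2,unif}(\mathbb{R})$, $\tau_m\in L_{1,unif}(\mathbb{R})$ such that for every $C<\infty$ $$\lim_{m\to\infty}\exp(CT_m)\Bigl\{\|\sigma-\sigma_m\|_{L_2[-T_m,2T_m]}+\|\tau-\tau_m\|_{L_1[-T_m,2T_m]}\Bigr\}=0.$$ *)

(* Defs.v *)
From HB Require Import structures.
From mathcomp Require Import all_boot all_order all_algebra.
From mathcomp Require Import all_classical all_reals all_analysis.
Set Implicit Arguments.
Unset Strict Implicit.
Unset Printing Implicit Defensive.
Import Order.TTheory GRing.Theory Num.Theory.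
Import numFieldNormedType.Exports.
Local Open Scope classical_set_scope.
Local Open Scope ring_scope.

(* Elements of the L_p-type spaces are represented by Borel functions R -> R. *)

Section function_spaces.
Context {R : realType}.
Notation mu := (@lebesgue_measure R).
Implicit Types (f : R -> R) (p : nat).

Definition Lp_loc p f : Prop :=
  measurable_fun setT f /\
  forall K : set R, compact K ->
    (\int[mu]_(x in K) (`|f x| ^+ p)%:E < +oo)%E.

Definition Lp_unif p f : Prop :=
  measurable_fun setT f /\
  (ereal_sup [set \int[mu]_(s in `[t, (t + 1)%R]) (`|f s| ^+ p)%:E | t in [set: R]]
    < +oo)%E.

Definition Lp_norm_itv p (a b : R) f : \bar R :=
  'N[mu]_(p%:R%:E)[EFin \o (f \_ `[a, b])]%E.

End function_spaces.

(* Real-valued distributions are given by their action on real test functions;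
   the value of a functional outside the test functions is irrelevant, and
   equality of distributions is [distr_eq]. *)

Section distributions.
Context {R : realType}.
Notation mu := (@lebesgue_measure R).
Implicit Types (f phi : R -> R) (u v : (R -> R) -> R).

Definition smooth f : Prop := forall n x, derivable (derive1n n f) x 1.

Definition test_function phi : Prop :=
  smooth phi /\ exists K : R, forall x, K < `|x| -> phi x = 0.

Definition distr_eq u v : Prop :=
  forall phi, test_function phi -> u phi = v phi.

Definition distr_of f : (R -> R) -> R :=
  fun phi => (\int[mu]_x (f x * phi x))%R.

Definition distr_derive u : (R -> R) -> R := fun phi => - u phi^`()%classic.

Definition distr_add u v : (R -> R) -> R := fun phi => u phi + v phi.

(* u (a t + b), by the change of variables x = a t + b; only meaningful
   for a != 0. *)
Definition distr_affine (a b : R) u : (R -> R) -> R :=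
  fun phi => `|a|^-1 * u (fun x => phi ((x - b) / a)).

End distributions.

Section sobolev.
Context {R : realType}.
Notation mu := (@lebesgue_measure R).
Implicit Types (f : R -> R) (s : R).

(* fourier_cos_trunc f n xi - i fourier_sin_trunc f n xi is the integral of
   f x exp (- i x xi) over [-n, n]. *)
Definition fourier_cos_trunc f (n : nat) (xi : R) : R :=
  \int[mu]_(x in `[- n%:R, n%:R]) (f x * cos (x * xi)).

Definition fourier_sin_trunc f (n : nat) (xi : R) : R :=
  \int[mu]_(x in `[- n%:R, n%:R]) (f x * sin (x * xi)).

(* gc - i gs is the (unnormalized) Fourier transform of the real function f in
   L_2: the limit in L_2 of the transforms of the truncations of f. *)
Definition fourier_L2 f (gc gs : R -> R) : Prop :=
  [/\ measurable_fun setT gc, measurable_fun setT gs &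
   (fun n : nat => \int[mu]_xi
        ((fourier_cos_trunc f n xi - gc xi) ^+ 2
       + (fourier_sin_trunc f n xi - gs xi) ^+ 2)%:E)%E @ \oo --> 0%E].

Definition W2 s f : Prop :=
  [/\ measurable_fun setT f,
      (\int[mu]_x (`|f x| ^+ 2)%:E < +oo)%E &
      exists gc gs : R -> R, fourier_L2 f gc gs /\
       (\int[mu]_xi
          (((1 + xi ^+ 2) `^ s) * (gc xi ^+ 2 + gs xi ^+ 2))%:E < +oo)%E].

Definition W2_loc s f : Prop :=
  forall phi : R -> R, test_function phi -> W2 s (fun x => phi x * f x).

End sobolev.

(* m starts at 1 because of the factor m ^ (- T_m). *)
Definition liouville {R : realType} (alpha : R) : Prop :=
  irrational alpha /\
  exists (Rm : nat -> int) (Tm : nat -> nat) (C : R),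
    forall m : nat, (0 < m)%N ->
      (0 < Tm m)%N /\
      `|alpha - (Rm m)%:~R / (Tm m)%:R| <= C * m%:R ^- Tm m.

(* The representation q = sigma' + tau is not unique: being a singular Gordon
   potential asks for one representation with periodic approximations. *)
Definition singular_Gordon {R : realType} (q : (R -> R) -> R) : Prop :=
  exists sigma tau : R -> R,
  [/\ Lp_unif 2 sigma, Lp_unif 1 tau,
      distr_eq q (distr_add (distr_derive (distr_of sigma)) (distr_of tau)) &
  exists (T : nat -> R) (sigma_ tau_ : nat -> R -> R),
  [/\ forall m, 0 < T m,
      T @ \oo --> +oo,
      forall m, Lp_unif 2 (sigma_ m) /\ periodic (sigma_ m) (T m),
      forall m, Lp_unif 1 (tau_ m) /\ periodic (tau_ m) (T m) &
      forall C : R,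
        (fun m => (expR (C * T m))%:E *
           (Lp_norm_itv 2 (- T m)%R (2 * T m)%R (sigma \- sigma_ m)%R
            + Lp_norm_itv 1 (- T m)%R (2 * T m)%R (tau \- tau_ m)%R))%E
          @ \oo --> 0%E]].

(* Main.v *)
Require Import Defs.
From mathcomp Require Import all_boot all_order all_algebra.
From mathcomp Require Import all_classical all_reals all_analysis.
From mathcomp Require Import ring lra measurable_realfun.

(** Let c be the mean of tau2, P a primitive of tau2 - c (again 1-periodic) and
    G = sigma2 + P.  Then q = sigma' + tau with
    sigma(t) = sigma1(t) + G(alpha t + theta) / alpha and tau = tau1 + c.
    Replacing alpha by alpha_m = R_m / T_m inside G makes sigma periodic with
    period T_m, and tau needs no approximation at all.

    To estimate D_m(t) = G(alpha t + theta) - G(alpha_m t + theta) on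
    [-T_m, 2 T_m], let r = min(1, s).  The regularity of sigma2 gives
    int_0^1 int_{|z| <= e} |G(x + z) - G(x)|^2 dz dx <= C e^(1 + r).
    Comparing both values of G in D_m(t) with the values at intermediate points
    and averaging over these points bounds the square of the norm of D_m by
    C T_m (4 T_m |alpha - alpha_m|)^r, which is superexponentially small.

    For compactly supported f in W^s_2 the modulus is read off from the Fourier
    transform by averaging |f(x + z) - f(x)|^2 with the weights
    2 e / (e^2 + z^2), the Fourier transform of exp(- e |xi|).  Continuity of
    translations in L_2 makes this average vanish as e tends to 0, so the
    Plancherel inequality needed here comes out of the same computation. *)

Set Implicit Arguments.
Unset Strict Implicit.
Unset Printing Implicit Defensive.
Import Order.TTheory GRing.Theory Num.Theory.
Import numFieldNormedType.Exports.
Local Open Scope classical_set_scope.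
Local Open Scope ring_scope.

(** * Affine substitutions and periodic integrands *)

(** The shift between alpha t + theta and alpha_m t + theta is (alpha - alpha_m) t. It depends on t,
    so a bound for translations by one fixed z cannot be integrated over t. Integrating over all |z|
    <= e removes this dependence: a whole interval of intermediate points lies within 2 e of both
    arguments, and each argument is compared with these points on its own, after an affine change of
    variable. The factor e gained by integrating in z is lost when the average is normalised, which
    leaves e^r.

    As tau2 is merely integrable, its translates have no rate of convergence; its primitive has one,
    and removing the mean makes that primitive periodic.

    The Liouville bound C m^(- T_m) survives multiplication by exp(B T_m) because constants, powers
    of T_m and this exponential can all be absorbed into the base of a T_m-th power, and that base
    tends to 0. That T_m tends to infinity is not in the definition of a Liouville number; it
    follows from irrationality, as rationals with bounded denominators stay away from alpha. *)

Section affine.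
Context {R : realType}.
Notation mu := (@lebesgue_measure R).
Lemma measurable_affine (a b : R) : measurable_fun [set: R] (fun x : R => a * x + b).
Proof. by apply: measurable_funD => //; apply: measurable_funM. Qed.

Lemma preimage_affine_itv (a b : R) (x y : R) (bx by_ : bool) : 0 < a ->
  (fun z => a * z + b) @^-1` [set` Interval (BSide bx x) (BSide by_ y)] =
  [set` Interval (BSide bx ((x - b) / a)) (BSide by_ ((y - b) / a))].
Proof.
move=> a0; apply/seteqP; split => z /=; rewrite !in_itv/=.
  move=> /andP[h1 h2]; apply/andP; split; move: h1 h2.
    by case: bx => /= ? _; rewrite ?ler_pdivrMr ?ltr_pdivrMr //; lra.
  by case: by_ => /= _ ?; rewrite ?ler_pdivlMr ?ltr_pdivlMr //; lra.
move=> /andP[h1 h2]; apply/andP; split; move: h1 h2.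
  by case: bx => /= + _; rewrite ?ler_pdivrMr ?ltr_pdivrMr //; lra.
by case: by_ => /= _ +; rewrite ?ler_pdivlMr ?ltr_pdivlMr //; lra.
Qed.

(** Uniqueness of Lebesgue measure: a times the pushforward of [mu] along x |-> a x + b gives every
    interval []x, y]] its length. *)
Lemma lebesgue_measure_affine (a b : R) (a0 : 0 < a) (A : set R) : measurable A ->
  mu ((fun x => a * x + b) @^-1` A) = ((a^-1)%:E * mu A)%E.
Proof.
move=> mA.
have ai0 : 0 <= a by exact: ltW.
pose phi : R -> measurableTypeR R := fun x => a * x + b.
have mphi : measurable_fun [set: measurableTypeR R] phi by exact: measurable_affine.
have H : mu A = mscale (NngNum ai0) (pushforward mu phi) A.
  move=> m; apply: lebesgue_measure_unique => // _ [[x y]] _ <-.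
  rewrite [RHS](_ : _ = a%:E * mu ((fun z => (a * z + b)%R) @^-1` `]x, y]%classic))%E//=.
  rewrite preimage_affine_itv// !lebesgue_measure_itv/= !lte_fin.
  rewrite ltr_pM2r ?invr_gt0// ltrD2r.
  case: ifPn => xy; last by rewrite mule0.
  by rewrite -!EFinB -EFinM; congr EFin; field; rewrite gt_eqF.
rewrite (H mphi) /mscale /= muleA -EFinM mulVf ?gt_eqF// mul1e//.
Qed.

Lemma ge0_integral_affine (a b : R) (a0 : 0 < a) (D : set R) (f : R -> \bar R) :
  measurable D -> measurable_fun D f -> (forall x, D x -> 0 <= f x)%E ->
  (\int[mu]_(x in (fun x => a * x + b)%R @^-1` D) f (a * x + b)%R = (a^-1)%:E * \int[mu]_(x in D) f x)%E.
Proof.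
move=> mD mf f0.
have ai0 : 0 <= a^-1 by rewrite invr_ge0 ltW.
pose phi : R -> measurableTypeR R := fun x => a * x + b.
have mphi : measurable_fun [set: measurableTypeR R] phi by exact: measurable_affine.
rewrite -(@ge0_integral_mscale _ _ _ mu D mD (NngNum ai0) f mf f0).
rewrite -[LHS](ge0_integral_pushforward mphi _ mD mf); last first.
  by move=> y; rewrite inE; exact: f0.
apply: eq_measure_integral => A mA _.
exact: lebesgue_measure_affine.
Qed.

(** No integrability is assumed: positive and negative parts are substituted separately, and a
    positive factor fixes both infinities, so the convention for an infinite difference has the same
    effect on both sides. *)
Lemma integral_affine (a b : R) (a0 : 0 < a) (f : R -> \bar R) :
  measurable_fun setT f -> 
  (\int[mu]_x f (a * x + b)%R = (a^-1)%:E * \int[mu]_x f x)%E.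
Proof.
move=> mf.
rewrite [LHS]integralE [in RHS]integralE.
have a'0 : 0 < a^-1 by rewrite invr_gt0.
have := @ge0_integral_affine a b a0 setT (f^\+)%E measurableT (measurable_funepos mf) (fun x _ => funepos_ge0 f x).
have := @ge0_integral_affine a b a0 setT (f^\-)%E measurableT (measurable_funeneg mf) (fun x _ => funeneg_ge0 f x).
rewrite !preimage_setT => En Ep.
rewrite [X in (X - _)%E](_ : _ = \int[mu]_x f^\+ (a * x + b)%R)%E; last by apply: eq_integral => x _; rewrite !funeposE.
rewrite [X in (_ - X)%E](_ : _ = \int[mu]_x f^\- (a * x + b)%R)%E; last by apply: eq_integral => x _; rewrite !funenegE.
rewrite Ep En.
have := @integral_ge0 _ _ _ mu setT (f^\+)%E (fun x _ => funepos_ge0 f x).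
have := @integral_ge0 _ _ _ mu setT (f^\-)%E (fun x _ => funeneg_ge0 f x).
case: (integral mu setT (f^\-)%E) => [x| |]//; case: (integral mu setT (f^\+)%E) => [y| |]// _ _.
  by rewrite -!EFinM -!EFinB mulrBr.
all: rewrite ?(gt0_muley, gt0_muleNy, lte_fin)//=.
all: by rewrite ?(gt0_muley, gt0_muleNy, lte_fin).
Qed.

Lemma ge0_integral_shift (b : R) (D : set R) (f : R -> \bar R) :
  measurable D -> measurable_fun D f -> (forall x, D x -> 0 <= f x)%E ->
  (\int[mu]_(x in (fun x => x + b)%R @^-1` D) f (x + b)%R = \int[mu]_(x in D) f x)%E.
Proof.
move=> mD mf f0.
have := @ge0_integral_affine 1 b ltr01 D f mD mf f0.
by rewrite invr1 mul1e => <-; congr integral; apply/funext => z /=; rewrite mul1r.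
Qed.

Lemma integral_shift (b : R) (f : R -> \bar R) : measurable_fun setT f ->
  (\int[mu]_x f (x + b)%R = \int[mu]_x f x)%E.
Proof.
move=> mf; have := integral_affine b ltr01 mf.
by rewrite invr1 mul1e => <-; apply: eq_integral => x _; rewrite mul1r.
Qed.

Lemma ge0_integral_itv_shift (b x y : R) (bx by_ : bool) (f : R -> \bar R) :
  measurable_fun setT f -> (forall x, 0 <= f x)%E ->
  (\int[mu]_(z in [set` Interval (BSide bx x) (BSide by_ y)]) f (z + b)%R =
   \int[mu]_(z in [set` Interval (BSide bx (x + b)%R) (BSide by_ (y + b)%R)]) f z)%E.
Proof.
move=> mf f0; rewrite -(@ge0_integral_shift b _ f)//; last exact: measurable_funTS.
congr integral; apply/seteqP; split => z /=; rewrite !in_itv/= => /andP[];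
by case: bx => /=; case: by_ => /=; rewrite ?lerD2r ?ltrD2r => -> ->.
Qed.

Lemma ge0_integral_itv_affine (a b x y : R) (f : R -> \bar R) : 0 < a ->
  measurable_fun setT f -> (forall x, 0 <= f x)%E ->
  (\int[mu]_(z in `[x, y]) f (a * z + b)%R =
   (a^-1)%:E * \int[mu]_(z in `[(a * x + b)%R, (a * y + b)%R]) f z)%E.
Proof.
move=> a0 mf f0; rewrite -(ge0_integral_affine b)//; last exact: measurable_funTS.
congr integral; apply/seteqP; split => z /=; rewrite !in_itv/= !lerD2r !ler_pM2l//.
Qed.
End affine.

Section periodic.
Context {R : realType}.
Notation mu := (@lebesgue_measure R).
Lemma periodicz (U V : zmodType) (f : U -> V) (T : U) : periodic f T ->
  forall (k : int) a, f (a + T *~ k) = f a.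
Proof.
move=> pf [n|n] a; first exact: (periodicn pf).
by rewrite NegzE mulrNz -[in RHS](subrK (T *+ n.+1) a) (periodicn pf).
Qed.
Variable g : R -> \bar R.
Hypothesis g1 : forall x, g (x + 1) = g x.
Hypothesis mg : measurable_fun setT g.
Hypothesis g0 : forall x, (0 <= g x)%E.
Lemma periodice_int (k : int) x : g (x + k%:~R) = g x.
Proof.
suff H (n : nat) y : g (y + n%:R) = g y.
  by case: k => n; [exact: H|rewrite NegzE mulrNz -[in RHS](subrK (n.+1%:R) x) H].
by elim: n y => [|n IH] y; [rewrite addr0|rewrite -natr1 addrA g1].
Qed.

(** With r the fractional part of x, the window [r, r + 1[ is cut at 1, and its right piece, moved
    back by 1, fills [0, r[. *)
Lemma ge0_integral_period (x : R) :
  (\int[mu]_(z in `[x, (x + 1)%R[) g z = \int[mu]_(z in `[0%R, 1%R[) g z)%E.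
Proof.
pose n := Num.floor x; pose r := x - n%:~R.
have /andP[r0 r1] : 0 <= r < 1.
  by have /andP[] := floor_itv x; rewrite -/n intrD rmorph1 subr_ge0 ltrBlDr addrC => -> ->.
have -> : x = r + n%:~R by rewrite subrK.
rewrite (addrAC r) -(ge0_integral_itv_shift n%:~R r (r + 1) true true)//.
under eq_integral do rewrite periodice_int.
rewrite (@itv_bndbnd_setU _ _ _ (BLeft 1)) ?bnd_simp; [|lra|lra].
rewrite [in RHS](@itv_bndbnd_setU _ _ _ (BLeft r)) ?bnd_simp; [|lra|lra].
rewrite !ge0_integral_setU//=; try exact: measurable_funTS.
- rewrite addeC; congr (_ + _)%E.
  have := @ge0_integral_itv_shift _ 1 0 r true true g mg g0; rewrite add0r => <-.
  by apply: eq_integral => z _; rewrite g1.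
- apply/disj_setPS => z /=; rewrite !in_itv/=; lra.
- apply/disj_setPS => z /=; rewrite !in_itv/=; lra.
Qed.

Lemma ge0_integral_periodic_le (k : int) (n : nat) :
  (\int[mu]_(z in `[k%:~R, (k%:~R + n%:R)%R]) g z <= n%:R%:E * \int[mu]_(z in `[0%R, 1%R]) g z)%E.
Proof.
elim: n => [|n IH].
  by rewrite addr0 set_itv1 integral_set1 mul0e.
have -> : [set` `[k%:~R : R, k%:~R + n.+1%:R]] = `[k%:~R : R, k%:~R + n%:R]%classic `|` `](k%:~R : R) + n%:R, k%:~R + n.+1%:R]%classic.
  by rewrite -itv_bndbnd_setU// bnd_simp ?lerDl// lerD2l ler_nat.
rewrite ge0_integral_setU//=; first last.
- apply/disj_setPS => z /=; rewrite !in_itv/=; lra.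
- exact: measurable_funTS.
have -> : (n.+1%:R%:E * \int[mu]_(z in `[0%R, 1%R]) g z = n%:R%:E * \int[mu]_(z in `[0%R, 1%R]) g z + \int[mu]_(z in `[0%R, 1%R]) g z)%E.
  by rewrite -natr1 EFinD ge0_muleDl// mul1e.
rewrite leeD//.
rewrite integral_itv_obnd_cbnd; last exact: measurable_funTS.
rewrite -addn1 natrD addrA -[in X in (X <= _)%E]integral_itv_bndo_bndc; last exact: measurable_funTS.
rewrite ge0_integral_period integral_itv_bndo_bndc//; exact: measurable_funTS.
Qed.
End periodic.

(** * Sobolev regularity and the modulus of continuity in mean *)

Section poisson.
Context {R : realType}.
Notation mu := (@lebesgue_measure R).
Implicit Types e z x : R.

(** For e > 0, this is 2 pi times the Poisson kernel of the half-plane at height e; its total mass 2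
    pi does not depend on e. *)
Definition poisson e z : R := 2 * e / (e ^+ 2 + z ^+ 2).

Lemma is_derive_scale z x : is_derive x 1 (fun t : R => z * t) z.
Proof.
have h := is_deriveZ z (is_derive_id x (1 : R)).
by apply: is_derive_eq h _; rewrite /GRing.scale/= mulr1.
Qed.

Lemma is_derive_expR_scale z x : is_derive x 1 (fun t : R => expR (z * t)) (z * expR (z * x)).
Proof.
have h := is_derive1_comp (is_derive_expR (z * x)) (is_derive_scale z x).
by apply: is_derive_eq h _; rewrite mulrC.
Qed.

Lemma is_derive_cos_scale z x : is_derive x 1 (fun t : R => cos (z * t)) (- z * sin (z * x)).
Proof.
have h := is_derive1_comp (is_derive_cos (z * x)) (is_derive_scale z x).
by apply: is_derive_eq h _; rewrite mulrC mulNr mulrN.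
Qed.

Lemma is_derive_sin_scale z x : is_derive x 1 (fun t : R => sin (z * t)) (z * cos (z * x)).
Proof.
have h := is_derive1_comp (is_derive_sin (z * x)) (is_derive_scale z x).
by apply: is_derive_eq h _; rewrite mulrC.
Qed.

(** An antiderivative of exp(- e t) (1 + cos (z t)): the first term is the real part of exp((i z -
    e) t) / (i z - e). It vanishes at +oo, so only its value at 0 contributes. *)
Let F e z (t : R) := (expR (- e * t) * (z * sin (z * t) + - e * cos (z * t))) * (e ^+ 2 + z ^+ 2)^-1
   + (- e^-1) * expR (- e * t).

Let is_derive_F e z x : 0 < e -> is_derive x 1 (F e z) (expR (- e * x) * (1 + cos (z * x))).
Proof.
move=> e0.
have h1 := is_deriveM (is_derive_expR_scale (- e) x)
   (is_deriveD (is_deriveZ z (is_derive_sin_scale z x)) (is_deriveZ (- e) (is_derive_cos_scale z x))).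
have h2 := is_deriveZ (- e^-1) (is_derive_expR_scale (- e) x).
have h := is_deriveD (is_deriveM h1 (is_derive_cst ((e ^+ 2 + z ^+ 2)^-1) x 1)) h2.
apply: is_derive_eq h _.
rewrite /GRing.scale/= /cst /= mulr0 add0r.
have e2 : e ^+ 2 + z ^+ 2 != 0 by rewrite gt_eqF// ltr_pwDl ?exprn_gt0 ?sqr_ge0.
have e3 : e != 0 by rewrite gt_eqF.
rewrite [X in _ * (_ + X * _)](_ : _ = z * sin (z * x) + - e * cos (z * x))//.
by field; rewrite e2 e3.
Qed.

Lemma cvg_expRN_scale e : 0 < e -> expR (- e * x) @[x --> +oo] --> 0.
Proof.
move=> e0.
have h := cvg_comp _ _ (gt0_cvgMry e0 cvg_id) (@cvgr_expR R).
have -> : (fun x => expR (- e * x)) = (fun x : R => expR (- x)) \o ( *%R e).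
  by apply/funext => x /=; rewrite mulNr.
by apply: h.
Qed.

Let cvg_F e z : 0 < e -> F e z x @[x --> +oo] --> 0.
Proof.
move=> e0.
pose C := (`|z| + e) / (e ^+ 2 + z ^+ 2) + e^-1.
have e2 : 0 < e ^+ 2 + z ^+ 2 by rewrite ltr_pwDl ?exprn_gt0 ?sqr_ge0.
have bound t : `|F e z t| <= C * expR (- e * t).
  rewrite /F; apply: (le_trans (ler_normD _ _)).
  rewrite [X in _ + X]normrM normrN (ger0_norm (expR_ge0 _)) (@gtr0_norm _ e^-1) ?invr_gt0// /C [X in _ <= X]mulrDl lerD2r.
  rewrite normrM (@gtr0_norm _ (_^-1)) ?invr_gt0// mulrAC ler_pM2r ?invr_gt0//.
  rewrite normrM (ger0_norm (expR_ge0 _)) mulrC ler_wpM2r ?expR_ge0//.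
  apply: (le_trans (ler_normD _ _)); rewrite !normrM normrN (gtr0_norm e0) lerD//.
    by rewrite ler_piMr// ler_norml sin_geN1 sin_le1.
  by rewrite ler_piMr ?(ltW e0)// ler_norml cos_geN1 cos_le1.
apply/norm_cvg0P.
apply: (@squeeze_cvgr _ _ _ _ (cst 0) (fun t => C * expR (- e * t))).
- by apply: nearW => t; rewrite normr_ge0 bound.
- exact: cvg_cst.
- rewrite -[X in _ --> X](mulr0 C); apply: cvgMl_tmp; exact: cvg_expRN_scale.
Qed.

Definition laplace e (x : R) : R := expR (- e * `|x|).

Lemma continuous_laplace e : continuous (laplace e).
Proof.
move=> x; apply: continuous_comp; last exact: continuous_expR.
by apply: cvgMl_tmp; exact: norm_continuous.
Qed.

Lemma measurable_laplace e : measurable_fun setT (laplace e).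
Proof. by apply: continuous_measurable_fun; exact: continuous_laplace. Qed.

Lemma laplace_ge0 e x : 0 <= laplace e x. Proof. exact: expR_ge0. Qed.

Lemma laplace_le1 e x : 0 <= e -> laplace e x <= 1.
Proof. by move=> e0; rewrite /laplace -expR0 ler_expR mulNr oppr_le0 mulr_ge0. Qed.

Lemma continuous_cos_scale z : continuous (fun x => cos (z * x)).
Proof.
by move=> x; apply: continuous_comp; [exact: cvgMl_tmp|exact: continuous_cos].
Qed.

(** Adding 1 to the cosine makes the integrand nonnegative, which lets the fundamental theorem on
    [0, +oo[ apply without prior integrability; the term 2 / e is the share of that 1. *)
Lemma integral_laplace_onecos e z : 0 < e ->
  (\int[mu]_x (laplace e x * (1 + cos (z * x)))%:E = (poisson e z + 2 / e)%:E)%E.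
Proof.
move=> e0.
pose f x := laplace e x * (1 + cos (z * x)).
have f0 x : 0 <= f x.
  by rewrite mulr_ge0 ?laplace_ge0// -lerBlDl sub0r cos_geN1.
have cf : continuous f.
  move=> x; apply: cvgM; first exact: continuous_laplace.
  by apply: cvgD; [exact: cvg_cst|exact: continuous_cos_scale].
rewrite (ge0_symfun_integralT f0 cf); last first.
  move=> x; rewrite /f /laplace /= normrN; congr (_ * (_ + _)).
  by rewrite mulrN cosN.
rewrite -set_itvcy (ge0_continuous_FTC2y _ _ (cvg_F z e0)).
- rewrite -EFinB -EFinM; congr EFin.
  rewrite /F /poisson !mulr0 expR0 sin0 cos0.
  have e2 : e ^+ 2 + z ^+ 2 != 0 by rewrite gt_eqF// ltr_pwDl ?exprn_gt0 ?sqr_ge0.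
  have e3 : e != 0 by rewrite gt_eqF.
  by field; rewrite e2 e3.
- by move=> x _; exact: f0.
- exact: continuous_subspaceT.
- by move=> x _; have [] := is_derive_F z x e0.
- apply: cvg_at_right_filter.
  apply: differentiable_continuous; apply/derivable1_diffP.
  by have [] := is_derive_F z 0 e0.
- move=> x; rewrite in_itv/= andbT => x0.
  rewrite derive1E; have [_ ->] := is_derive_F z x e0.
  by rewrite /f /laplace gtr0_norm.
Qed.

Lemma integrable_laplace e : 0 < e -> mu.-integrable setT (EFin \o laplace e).
Proof.
move=> e0; apply/integrableP; split; first by apply/measurable_EFinP; exact: measurable_laplace.
apply: (@le_lt_trans _ _ (\int[mu]_x (laplace e x * (1 + cos (0 * x)))%:E)%E); last first.
  by rewrite integral_laplace_onecos// ltry.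
apply: ge0_le_integral => //.
- by apply: measurableT_comp => //; apply/measurable_EFinP; exact: measurable_laplace.
- apply/measurable_EFinP; apply: measurable_funM; first exact: measurable_laplace.
  apply: measurable_funD => //; by apply: continuous_measurable_fun; exact: continuous_cos_scale.
- move=> x _; rewrite mul0r cos0 /= lee_fin ger0_norm ?laplace_ge0//.
  by rewrite ler_peMr ?laplace_ge0//; lra.
Qed.

Lemma Rintegral_laplace_cos e z : 0 < e ->
  \int[mu]_x (laplace e x * cos (z * x)) = poisson e z.
Proof.
move=> e0.
have mc : measurable_fun setT (fun x => cos (z * x)).
  by apply: continuous_measurable_fun; exact: continuous_cos_scale.
have i1 : mu.-integrable setT (EFin \o (fun x => laplace e x * (1 + cos (z * x)))).
  apply/integrableP; split.
    apply/measurable_EFinP; apply: measurable_funM; first exact: measurable_laplace.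
    exact: measurable_funD.
  under eq_integral do rewrite gee0_abs ?lee_fin ?mulr_ge0 ?laplace_ge0// -?lerBlDl ?sub0r ?cos_geN1//.
  by rewrite integral_laplace_onecos// ltry.
have -> : (fun x => laplace e x * cos (z * x)) = (fun x => laplace e x * (1 + cos (z * x)) - laplace e x).
  by apply/funext => x; ring.
rewrite RintegralB//; last exact: integrable_laplace.
(* At z = 0 the cosine is 1, so the integral just computed is twice that of [laplace e], while
   [poisson e 0] = 2 / e. *)
have E0 : \int[mu]_x laplace e x = 2 / e.
  have := integral_laplace_onecos 0 e0.
  under eq_integral do rewrite mul0r cos0 mulrC EFinM.
  rewrite integralZl//; last exact: integrable_laplace.
  move=> H; have : (1 + 1) * \int[mu]_x laplace e x = poisson e 0 + 2 / e.
    by rewrite /Rintegral -[RHS]/(fine (_)%:E) -H fineM//; exact/integrable_fin_num/integrable_laplace.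
  rewrite /poisson expr0n addr0 => H2.
  have e3 : e != 0 by rewrite gt_eqF.
  apply: (mulfI (_ : (1 + 1 : R) != 0)); first by rewrite gt_eqF.
  by rewrite H2; field.
by rewrite E0 /Rintegral integral_laplace_onecos//= addrK.
Qed.

Lemma poisson_ge0 e z : 0 <= e -> 0 <= poisson e z.
Proof. by move=> e0; rewrite divr_ge0 ?mulr_ge0// addr_ge0 ?sqr_ge0. Qed.

Lemma poissonN e z : poisson e (- z) = poisson e z.
Proof. by rewrite /poisson sqrrN. Qed.

Lemma poisson_scale e z : 0 < e -> poisson e (e * z) = e^-1 * poisson 1 z.
Proof.
move=> e0; rewrite /poisson; have e3 : e != 0 by rewrite gt_eqF.
have z2 : 1 + z ^+ 2 != 0 by rewrite gt_eqF// ltr_pwDl ?sqr_ge0.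
by field; repeat (apply/andP; split) => //; rewrite ?expr1n// gt_eqF// ltr_pwDl ?exprn_gt0 ?sqr_ge0.
Qed.

Lemma poisson_ge e z : 0 < e -> `|z| <= e -> e^-1 <= poisson e z.
Proof.
move=> e0 ze; rewrite /poisson ler_pdivlMr ?ltr_pwDl ?exprn_gt0 ?sqr_ge0//.
have : z ^+ 2 <= e ^+ 2 by rewrite -[z ^+ 2]real_normK ?num_real// lerXn2r// nnegrE ltW.
move=> h; rewrite mulrC ler_pdivrMr//.
lra.
Qed.

Lemma continuous_poisson e : 0 < e -> continuous (poisson e).
Proof.
move=> e0 x; apply: cvgM; first exact: cvg_cst.
apply: cvgV; first by rewrite gt_eqF// ltr_pwDl ?exprn_gt0 ?sqr_ge0.
by apply: cvgD; [exact: cvg_cst|exact: exprn_continuous].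
Qed.

Lemma measurable_poisson e : 0 < e -> measurable_fun setT (poisson e).
Proof. by move=> e0; apply: continuous_measurable_fun; exact: continuous_poisson. Qed.

Lemma integral_poisson1 : (\int[mu]_x (poisson 1 x)%:E = (2 * pi)%:E)%E.
Proof.
rewrite ge0_symfun_integralT//; last 3 first.
- by move=> x; rewrite poisson_ge0.
- exact: continuous_poisson.
- by move=> x /=; rewrite poissonN.
have E : poisson 1 = (fun x => 2 * (oneDsqr x)^-1).
  by apply/funext => x; rewrite /poisson /oneDsqr mulr1 expr1n.
rewrite -set_itvcy E.
under eq_integral do rewrite EFinM.
rewrite ge0_integralZl//; last first.
  by apply: measurable_funTS; apply/measurable_EFinP; apply: continuous_measurable_fun; exact: continuous_oneDsqrV.
by rewrite integral0y_oneDsqr -!EFinM; congr EFin; field.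
Qed.

Lemma integrable_poisson1 : mu.-integrable setT (EFin \o poisson 1).
Proof.
apply/integrableP; split; first by apply/measurable_EFinP; exact: measurable_poisson.
under eq_integral do rewrite gee0_abs ?lee_fin ?poisson_ge0//.
by rewrite integral_poisson1 ltry.
Qed.
End poisson.

(** * Exchange of integrals: nonnegative integrands and bounded kernels *)

Section fubini_bounded.
Context {R : realType}.
Notation mu := (@lebesgue_measure R).

Lemma ge0_le_intR (D : set R) (f g : R -> \bar R) : measurable D ->
  measurable_fun [set: R] f -> measurable_fun [set: R] g ->
  (forall x, D x -> 0 <= f x)%E -> (forall x, D x -> f x <= g x)%E ->
  (\int[mu]_(x in D) f x <= \int[mu]_(x in D) g x)%E.
Proof.
by move=> mD mf mg f0 fg; apply: ge0_le_integral => //; exact: measurable_funTS.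
Qed.

Lemma ge0_intRZl (D : set R) (k : \bar R) (f : R -> \bar R) : measurable D ->
  measurable_fun [set: R] f -> (forall x, D x -> 0 <= f x)%E -> (0 <= k)%E ->
  (\int[mu]_(x in D) (k * f x) = k * \int[mu]_(x in D) f x)%E.
Proof. by move=> mD mf f0 k0; rewrite ge0_integralZl//; exact: measurable_funTS. Qed.

Lemma ge0_intRZr (D : set R) (k : \bar R) (f : R -> \bar R) : measurable D ->
  measurable_fun [set: R] f -> (forall x, D x -> 0 <= f x)%E -> (0 <= k)%E ->
  (\int[mu]_(x in D) (f x * k) = (\int[mu]_(x in D) f x) * k)%E.
Proof. by move=> mD mf f0 k0; rewrite ge0_integralZr//; exact: measurable_funTS. Qed.

Lemma ge0_intRD (D : set R) (f g : R -> \bar R) : measurable D ->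
  measurable_fun [set: R] f -> measurable_fun [set: R] g ->
  (forall x, D x -> 0 <= f x)%E -> (forall x, D x -> 0 <= g x)%E ->
  (\int[mu]_(x in D) (f x + g x) = \int[mu]_(x in D) f x + \int[mu]_(x in D) g x)%E.
Proof. by move=> mD mf mg f0 g0; rewrite ge0_integralD//; exact: measurable_funTS. Qed.

Lemma measurable_integral2 (F : R * R -> \bar R) :
  measurable_fun [set: R * R] F -> (forall p, 0 <= F p)%E ->
  measurable_fun [set: R] (fun x => \int[mu]_y F (x, y))%E.
Proof. by move=> mF F0; have := @measurable_fun_fubini_tonelli_F _ _ _ _ R mu F mF F0. Qed.

Lemma integral_indic_mul (D : set R) (f : R -> \bar R) :
  (\int[mu]_(x in D) f x = \int[mu]_x (f x * (\1_D x)%:E))%E.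
Proof.
rewrite integral_mkcond; apply: eq_integral => x _.
by rewrite patchE indicE; case: (x \in D); rewrite ?mule1 ?mule0.
Qed.

Lemma measurable_integral2_in (D : set R) (F : R * R -> \bar R) : measurable D ->
  measurable_fun [set: R * R] F -> (forall p, 0 <= F p)%E ->
  measurable_fun [set: R] (fun x => \int[mu]_(y in D) F (x, y))%E.
Proof.
move=> mD mF F0.
under eq_fun do rewrite integral_indic_mul.
apply: (@measurable_integral2 (fun p => F p * (\1_D p.2)%:E)%E).
  apply: emeasurable_funM => //; apply/measurable_EFinP.
  by apply: (measurableT_comp (measurable_indic mD)).
by move=> p; rewrite mule_ge0 ?lee_fin.
Qed.

Lemma tonelli_in (D E : set R) (F : R * R -> \bar R) : measurable D -> measurable E ->
  measurable_fun [set: R * R] F -> (forall p, 0 <= F p)%E ->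
  (\int[mu]_(x in D) \int[mu]_(y in E) F (x, y) =
   \int[mu]_(y in E) \int[mu]_(x in D) F (x, y))%E.
Proof.
move=> mD mE mF F0.
pose G p := (F p * (\1_D p.1)%:E * (\1_E p.2)%:E)%E.
have mG : measurable_fun [set: R * R] G.
  apply: emeasurable_funM; [apply: emeasurable_funM => //|]; apply/measurable_EFinP.
    by apply: (measurableT_comp (measurable_indic mD)).
  by apply: (measurableT_comp (measurable_indic mE)).
have G0 p : (0 <= G p)%E by rewrite !mule_ge0 ?lee_fin.
have mFx x : measurable_fun [set: R] (fun y => F (x, y)).
  by apply: measurableT_comp.
have mFy y : measurable_fun [set: R] (fun x => F (x, y)).
  by apply: measurableT_comp.
have mi1 (A : set R) : measurable A -> measurable_fun [set: R] (fun x => (\1_A x)%:E : \bar R).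
  by move=> mA; apply/measurable_EFinP; exact: measurable_indic.
transitivity (\int[mu]_x \int[mu]_y G (x, y))%E.
  rewrite integral_indic_mul; apply: eq_integral => x _.
  rewrite integral_indic_mul -ge0_intRZr//; last 2 first.
  - by apply: emeasurable_funM => //; exact: mi1.
  - by move=> y _; rewrite mule_ge0 ?lee_fin.
  by apply: eq_integral => y _; rewrite /G/= muleAC.
have -> := @fubini_tonelli _ _ _ _ R mu mu G mG G0.
rewrite [RHS]integral_indic_mul; apply: eq_integral => y _.
rewrite integral_indic_mul -ge0_intRZr//; last 2 first.
- by apply: emeasurable_funM => //; exact: mi1.
- by move=> x _; rewrite mule_ge0 ?lee_fin.
Qed.

Lemma integrable_mul_bounded (b : R -> R) (k : R -> R) (M : R) :
  mu.-integrable setT (EFin \o b) -> measurable_fun setT k ->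
  (forall x, `|k x| <= M) -> mu.-integrable setT (EFin \o (fun x => b x * k x)).
Proof.
move=> ib mk kM.
have -> : EFin \o (fun x => b x * k x) = ((EFin \o k) \* (EFin \o b))%E.
  by apply/funext => x /=; rewrite mulrC EFinM.
apply: integrableMr => //.
by exists M; split; [exact: num_real|move=> z Mz x _; apply: (le_trans (kM x)); exact: ltW].
Qed.

(** Fubini applies since a(x) b(y) k(x, y) is dominated by M |a(x)| |b(y)|, integrable on the
    product. The kernels to come are trigonometric ones and the signed indicator that defines
    primitives. *)
Lemma Rintegral_swap_bounded (a b : R -> R) (k : R * R -> R) (M : R) :
  mu.-integrable setT (EFin \o a) -> mu.-integrable setT (EFin \o b) ->
  measurable_fun setT k -> (forall p, `|k p| <= M) ->
  \int[mu]_x (a x * \int[mu]_y (b y * k (x, y))) =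
  \int[mu]_y (b y * \int[mu]_x (a x * k (x, y))).
Proof.
move=> ia ib mk kM.
have ma : measurable_fun setT a by apply/measurable_EFinP; exact: measurable_int ia.
have mb : measurable_fun setT b by apply/measurable_EFinP; exact: measurable_int ib.
pose F (p : R * R) := (a p.1 * b p.2 * k p)%:E.
have mF : measurable_fun setT F.
  apply/measurable_EFinP; apply: measurable_funM => //; apply: measurable_funM.
    by apply: measurableT_comp.
  by apply: measurableT_comp.
have mk1 x : measurable_fun setT (fun y => k (x, y)) by apply: measurableT_comp.
have mk2 y : measurable_fun setT (fun x => k (x, y)) by apply: measurableT_comp.
have mabk x : measurable_fun [set: R] (fun y => a x * b y * k (x, y)).
  by apply: measurable_funM => //; apply: measurable_funM.
have M0 : 0 <= M by rewrite (le_trans _ (kM (0, 0))).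
have iF : (mu \x mu)%E.-integrable setT F.
  apply/integrable12ltyP => //.
  have H x : (\int[mu]_y `|F (x, y)| <= `|(a x)%:E| * (M%:E * \int[mu]_y `|(EFin \o b) y|))%E.
    have mab : measurable_fun setT (fun y => `|(EFin \o b) y|)%E.
      by apply: measurableT_comp => //; apply/measurable_EFinP.
    rewrite -ge0_integralZl ?lee_fin// -ge0_integralZl//=; last 2 first.
    - by apply: measurable_funeM.
    - by move=> y _; rewrite mule_ge0 ?lee_fin.
    apply: ge0_le_integral => //.
    - apply/measurable_EFinP; apply: measurableT_comp => //.
      exact: mabk.
    - by apply: measurable_funeM; apply: measurable_funeM.
    move=> y _; rewrite /F/= -!EFinM lee_fin !normrM -mulrA ler_wpM2l// mulrC ler_wpM2r//.
  have [_ iboo] := integrableP _ _ _ ib.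
  have [_ iaoo] := integrableP _ _ _ ia.
  set B := (\int[mu]_y `|(EFin \o b) y|)%E in H iboo.
  have B0 : (0 <= B)%E by apply: integral_ge0.
  apply: (@le_lt_trans _ _ (\int[mu]_x (`|(a x)%:E| * (M%:E * B)))%E).
    apply: ge0_le_intR => //.
    - apply: (@measurable_integral2 (abse \o F)); last by move=> p; exact: abse_ge0.
      by apply: measurableT_comp.
    - apply: emeasurable_funM => //; apply: measurableT_comp => //; exact/measurable_EFinP.
    - by move=> x _; apply: integral_ge0.
  rewrite ge0_intRZr//; last 2 first.
  - by apply: measurableT_comp => //; exact/measurable_EFinP.
  - by rewrite mule_ge0.
  by rewrite lte_mul_pinfty ?integral_ge0// ?ge0_fin_numE ?integral_ge0// lte_mul_pinfty.
have iby x : mu.-integrable setT (EFin \o (fun y => b y * k (x, y))).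
  exact: (@integrable_mul_bounded _ _ M).
have iax y : mu.-integrable setT (EFin \o (fun x => a x * k (x, y))).
  exact: (@integrable_mul_bounded _ _ M).
rewrite /Rintegral; congr fine.
rewrite -[LHS]/(\int[mu]_x (a x * \int[mu]_y (b y * k (x, y)))%:E)%E.
rewrite -[RHS]/(\int[mu]_y (b y * \int[mu]_x (a x * k (x, y)))%:E)%E.
transitivity (\int[mu]_x \int[mu]_y F (x, y))%E.
  apply: eq_integral => x _.
  rewrite EFinM /Rintegral.
  rewrite fineK; last by exact: integrable_fin_num (iby x).
  rewrite -(integralZl measurableT (iby x)).
  by apply: eq_integral => y _; rewrite /F /= -EFinM mulrA.
rewrite Fubini//.
apply: eq_integral => y _.
rewrite EFinM /Rintegral.
rewrite fineK; last by exact: integrable_fin_num (iax y).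
rewrite -(integralZl measurableT (iax y)).
by apply: eq_integral => x _; rewrite /F /= -EFinM mulrA (mulrC (a x)).
Qed.
End fubini_bounded.

(** * The Poisson-weighted oscillation of a function *)

Section translation_modulus.
Context {R : realType}.
Notation mu := (@lebesgue_measure R).
Implicit Types f g h : R -> R.

(** Holds without integrability: the integrals of the positive and negative parts are measurable by
    Tonelli, and [fine] merely sends infinite values to 0. *)
Lemma measurable_Rintegral2 (F : R * R -> R) : measurable_fun [set: R * R] F ->
  measurable_fun [set: R] (fun x => \int[mu]_y F (x, y)).
Proof.
move=> mF.
have mE : measurable_fun [set: R * R] (EFin \o F) by apply/measurable_EFinP.
apply: (measurableT_comp (fine_measurable measurableT)).
have -> : (fun x => \int[mu]_y (F (x, y))%:E)%E =
  (fun x => (\int[mu]_y (EFin \o F)^\+ (x, y)) - (\int[mu]_y (EFin \o F)^\- (x, y)))%E.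
  apply/funext => x; rewrite integralE; congr (_ - _)%E; apply: eq_integral => y _.
    by rewrite !funeposE.
  by rewrite !funenegE.
apply: emeasurable_funB.
  apply: measurable_integral2; first exact: measurable_funepos.
  by move=> p; exact: funepos_ge0.
apply: measurable_integral2; first exact: measurable_funeneg.
by move=> p; exact: funeneg_ge0.
Qed.

Lemma measurable_pair1r d (T : measurableType d) (F : R * R -> T) : measurable_fun [set: R * R] F ->
  forall x, measurable_fun [set: R] (fun y => F (x, y)).
Proof. by move=> mF x; apply: (measurableT_comp mF). Qed.

(* With z = e u, this is the integral of (f (x + z) - f x) ^ 2 against the weight
   [poisson e z]; the rescaling leaves a fixed integrable weight as e tends to 0. *)
Definition oscillation (e : R) f : \bar R :=
  (\int[mu]_x \int[mu]_u ((f (x + e * u) - f x) ^+ 2 * poisson 1 u)%:E)%E.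

Definition sqnorm f : \bar R := (\int[mu]_x (f x ^+ 2)%:E)%E.

Lemma measurable_comp_addM e f : measurable_fun [set: R] f ->
  measurable_fun [set: R * R] (fun p => f (p.1 + e * p.2)).
Proof.
move=> mf; apply: (measurableT_comp mf).
by apply: measurable_funD => //; apply: measurable_funM.
Qed.

Lemma measurable_comp_fst f : measurable_fun [set: R] f ->
  measurable_fun [set: R * R] (fun p => f p.1).
Proof. by move=> mf; apply: (measurableT_comp mf). Qed.

Lemma measurable_comp_snd f : measurable_fun [set: R] f ->
  measurable_fun [set: R * R] (fun p => f p.2).
Proof. by move=> mf; apply: (measurableT_comp mf). Qed.

Lemma measurable_osc e f : measurable_fun [set: R] f ->
  measurable_fun [set: R * R] (fun p => (f (p.1 + e * p.2) - f p.1) ^+ 2).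
Proof.
move=> mf; apply: measurable_funX; apply: measurable_funB.
  exact: measurable_comp_addM.
exact: measurable_comp_fst.
Qed.

Lemma measurable_osc_poisson e f : measurable_fun [set: R] f ->
  measurable_fun [set: R * R] (fun p => ((f (p.1 + e * p.2) - f p.1) ^+ 2 * poisson 1 p.2)%:E).
Proof.
move=> mf; apply/measurable_EFinP; apply: measurable_funM; first exact: measurable_osc.
by apply: measurable_comp_snd; exact: measurable_poisson.
Qed.

Lemma sqnorm_shift f (z : R) : measurable_fun [set: R] f ->
  (\int[mu]_x (f (x + z) ^+ 2)%:E = sqnorm f)%E.
Proof.
move=> mf; apply: (integral_shift z (f := fun x => (f x ^+ 2)%:E)).
by apply/measurable_EFinP; exact: measurable_funX.
Qed.

(** For fixed u both squares integrate in x to [sqnorm f], by translation invariance, and the weight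
    has mass 2 pi. *)
Lemma integral_double_poisson e f : measurable_fun [set: R] f ->
  (\int[mu]_x \int[mu]_u ((f (x + e * u) ^+ 2 + f x ^+ 2) * poisson 1 u)%:E =
   (4 * pi)%:E * sqnorm f)%E.
Proof.
move=> mf.
have mp := measurable_poisson (ltr01 : 0 < 1 :> R).
have mF : measurable_fun [set: R * R] (fun p => ((f (p.1 + e * p.2) ^+ 2 + f p.1 ^+ 2) * poisson 1 p.2)%:E).
  apply/measurable_EFinP; apply: measurable_funM; last exact: measurable_comp_snd.
  apply: measurable_funD; apply: measurable_funX.
    exact: measurable_comp_addM.
  exact: measurable_comp_fst.
have F0 p : (0 <= ((f (p.1 + e * p.2) ^+ 2 + f p.1 ^+ 2) * poisson 1 p.2)%:E)%E.
  by rewrite lee_fin mulr_ge0 ?poisson_ge0// addr_ge0 ?sqr_ge0.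
rewrite (tonelli_in measurableT measurableT mF F0)/=.
have mz z : measurable_fun [set: R] (fun x => (f (x + z) ^+ 2)%:E).
  apply/measurable_EFinP; apply: measurable_funX; apply: (measurableT_comp mf).
  exact: measurable_funD.
have sq0 : (0 <= sqnorm f)%E by apply: integral_ge0 => x _; rewrite lee_fin sqr_ge0.
transitivity (\int[mu]_u ((poisson 1 u)%:E * (2%:E * sqnorm f)))%E.
  apply: eq_integral => u _.
  transitivity (\int[mu]_x ((poisson 1 u)%:E * ((f (x + e * u) ^+ 2)%:E + (f x ^+ 2)%:E)))%E.
    by apply: eq_integral => x _; rewrite -EFinD -EFinM mulrC.
  rewrite ge0_intRZl ?lee_fin ?poisson_ge0//; last 2 first.
  - apply: emeasurable_funD; first exact: mz.
    by apply/measurable_EFinP; exact: measurable_funX.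
  - by move=> x _; rewrite adde_ge0// lee_fin sqr_ge0.
  rewrite ge0_intRD//; last 3 first.
  - by apply/measurable_EFinP; exact: measurable_funX.
  - by move=> x _; rewrite lee_fin sqr_ge0.
  - by move=> x _; rewrite lee_fin sqr_ge0.
  by rewrite sqnorm_shift// mule_natl mule2n.
rewrite ge0_intRZr//; last 3 first.
- exact/measurable_EFinP.
- by move=> x _; rewrite lee_fin poisson_ge0.
- by rewrite mule_ge0.
rewrite integral_poisson1 muleA -EFinM; congr (_%:E * _)%E; ring.
Qed.

(** From (a - b)^2 <= 2 (a^2 + b^2). The bound is uniform in e, which is what allows f to be
    replaced by a nearby continuous function before e tends to 0. *)
Lemma oscillation_le_sqnorm e f : measurable_fun [set: R] f ->
  (oscillation e f <= (8 * pi)%:E * sqnorm f)%E.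
Proof.
move=> mf.
have mp := measurable_poisson (ltr01 : 0 < 1 :> R).
have -> : ((8 * pi)%:E * sqnorm f = 2%:E * ((4 * pi)%:E * sqnorm f))%E.
  by rewrite muleA -EFinM; congr (_%:E * _)%E; ring.
rewrite -(integral_double_poisson e mf).
have mF : measurable_fun [set: R * R] (fun p => ((f (p.1 + e * p.2) ^+ 2 + f p.1 ^+ 2) * poisson 1 p.2)%:E).
  apply/measurable_EFinP; apply: measurable_funM; last exact: measurable_comp_snd.
  apply: measurable_funD; apply: measurable_funX.
    exact: measurable_comp_addM.
  exact: measurable_comp_fst.
have F0 p : (0 <= ((f (p.1 + e * p.2) ^+ 2 + f p.1 ^+ 2) * poisson 1 p.2)%:E)%E.
  by rewrite lee_fin mulr_ge0 ?poisson_ge0// addr_ge0 ?sqr_ge0.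
have mFx x : measurable_fun [set: R] (fun u => ((f (x + e * u) ^+ 2 + f x ^+ 2) * poisson 1 u)%:E).
  exact: (measurable_pair1r mF x).
have mOx x : measurable_fun [set: R] (fun u => ((f (x + e * u) - f x) ^+ 2 * poisson 1 u)%:E).
  exact: (measurable_pair1r (measurable_osc_poisson e mf) x).
rewrite -ge0_intRZl//; last 2 first.
- exact: (measurable_integral2 mF F0).
- by move=> x _; apply: integral_ge0 => u _; exact: (F0 (x, u)).
apply: ge0_le_intR => //.
- apply: (measurable_integral2 (measurable_osc_poisson e mf)) => p.
  by rewrite lee_fin mulr_ge0 ?poisson_ge0 ?sqr_ge0.
- by apply: measurable_funeM; exact: (measurable_integral2 mF F0).
- by move=> x _; apply: integral_ge0 => u _; rewrite lee_fin mulr_ge0 ?poisson_ge0 ?sqr_ge0.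
move=> x _; rewrite -ge0_intRZl//; last by move=> u _; exact: (F0 (x, u)).
apply: ge0_le_intR => //.
- by apply: measurable_funeM.
- by move=> u _; rewrite lee_fin mulr_ge0 ?poisson_ge0 ?sqr_ge0.
move=> u _; rewrite -EFinM lee_fin [X in _ <= X]mulrA ler_wpM2r ?poisson_ge0//.
by have := sqr_ge0 (f (x + e * u) + f x); lra.
Qed.

Lemma oscillation_split e f g : measurable_fun [set: R] f -> measurable_fun [set: R] g ->
  (oscillation e f <= 2%:E * oscillation e g + 2%:E * oscillation e (f \- g)%R)%E.
Proof.
move=> mf mg.
have mfg : measurable_fun [set: R] (fun x => f x - g x) by exact: measurable_funB.
have ge0 k (p : R * R) : (0 <= ((k (p.1 + e * p.2) - k p.1) ^+ 2 * poisson 1 p.2)%:E)%E.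
  by rewrite lee_fin mulr_ge0 ?poisson_ge0 ?sqr_ge0.
have ge0x k x : (0 <= \int[mu]_u ((k (x + e * u) - k x) ^+ 2 * poisson 1 u)%:E)%E.
  by apply: integral_ge0 => u _; exact: (ge0 k (x, u)).
have mO (k : R -> R) : measurable_fun [set: R] k -> forall x,
    measurable_fun [set: R] (fun u => ((k (x + e * u) - k x) ^+ 2 * poisson 1 u)%:E).
  by move=> mk x; exact: (measurable_pair1r (measurable_osc_poisson e mk) x).
have mI (k : R -> R) : measurable_fun [set: R] k ->
    measurable_fun [set: R] (fun x => \int[mu]_u ((k (x + e * u) - k x) ^+ 2 * poisson 1 u)%:E)%E.
  by move=> mk; exact: (measurable_integral2 (measurable_osc_poisson e mk) (ge0 k)).
rewrite /oscillation -!ge0_intRZl//; [|exact: mI|exact: mI].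
rewrite -ge0_intRD//; last 4 first.
- by apply: measurable_funeM; exact: mI.
- by apply: measurable_funeM; exact: mI.
- by move=> x _; rewrite mule_ge0.
- by move=> x _; rewrite mule_ge0.
apply: ge0_le_intR => //.
- exact: mI.
- by apply: emeasurable_funD; apply: measurable_funeM; exact: mI.
move=> x _; rewrite -!ge0_intRZl//; last 4 first.
- exact: mO.
- by move=> u _; exact: (ge0 _ (x, u)).
- exact: mO.
- by move=> u _; exact: (ge0 _ (x, u)).
rewrite -ge0_intRD//; last 4 first.
- by apply: measurable_funeM; exact: mO.
- by apply: measurable_funeM; exact: mO.
- by move=> u _; rewrite mule_ge0//; exact: (ge0 _ (x, u)).
- by move=> u _; rewrite mule_ge0//; exact: (ge0 _ (x, u)).
apply: ge0_le_intR => //.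
- exact: mO.
- by apply: emeasurable_funD; apply: measurable_funeM; exact: mO.
- by move=> u _; exact: (ge0 _ (x, u)).
move=> u _; rewrite -!EFinM -EFinD lee_fin [X in _ <= X + _]mulrA [X in _ <= _ + X]mulrA -mulrDl /= ler_wpM2r ?poisson_ge0//.
set a := f _; set b := f _; set c := g _; set d := g _.
by have := sqr_ge0 ((c - d) - ((a - c) - (b - d))); lra.
Qed.
End translation_modulus.

(** * Truncations and cutoffs *)

Section clip.
Context {R : realType}.
Implicit Types N x y : R.
(** For N >= 0 this is the projection of the line onto [- N, N], in a closed form whose continuity
    needs no case distinction. *)
Definition clip N x : R := (`|x + N| - `|x - N|) / 2.
Lemma continuous_clip N : continuous (clip N).
Proof.
move=> x; apply: cvgMr_tmp; apply: cvgB; apply: cvg_norm.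
  by apply: cvgD; [exact: cvg_id|exact: cvg_cst].
by apply: cvgB; [exact: cvg_id|exact: cvg_cst].
Qed.

Lemma measurable_clip N : measurable_fun [set: R] (clip N).
Proof. by apply: continuous_measurable_fun; exact: continuous_clip. Qed.

Lemma clip_le N x : 0 <= N -> `|clip N x| <= N.
Proof.
move=> N0; rewrite /clip ler_norml; apply/andP; split.
  by case: (ler0P (x + N)); case: (ler0P (x - N)); lra.
by case: (ler0P (x + N)); case: (ler0P (x - N)); lra.
Qed.

Lemma clip_id N x : `|x| <= N -> clip N x = x.
Proof.
rewrite ler_norml => /andP[h1 h2]; rewrite /clip ger0_norm; last by lra.
by rewrite ler0_norm; [field|lra].
Qed.

Lemma clip_lip N x y : 0 <= N -> `|clip N x - clip N y| <= `|x - y|.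
Proof.
move=> N0; rewrite /clip.
case: (ler0P (x + N)); case: (ler0P (x - N)); case: (ler0P (y + N)); case: (ler0P (y - N));
  move=> h1 h2 h3 h4; rewrite ler_norml; case: (ler0P (x - y)) => h5; apply/andP; split; lra.
Qed.

Definition cutoff N x : R := (1 + clip 1 (2 * N + 1 - 2 * `|x|)) / 2.
Lemma continuous_cutoff N : continuous (cutoff N).
Proof.
move=> x; apply: cvgMr_tmp; apply: cvgD; first exact: cvg_cst.
apply: (@continuous_comp _ _ _ (fun x : R => 2 * N + 1 - 2 * `|x|) (clip 1)); last exact: continuous_clip.
apply: cvgB; first exact: cvg_cst.
by apply: cvgMl_tmp; exact: norm_continuous.
Qed.

Lemma cutoff_id N x : `|x| <= N -> cutoff N x = 1.
Proof.
move=> h; have h0 := normr_ge0 x; rewrite /cutoff /clip; move: (`|x|) h h0 => t h h0.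
rewrite ger0_norm; last by lra.
by rewrite ger0_norm; [field|lra].
Qed.

Lemma cutoff_out N x : N + 1 <= `|x| -> cutoff N x = 0.
Proof.
rewrite /cutoff /clip; move: (`|x|) => t h; rewrite ler0_norm; last by lra.
by rewrite ler0_norm; [field|lra].
Qed.

Lemma cutoff_le1 N x : `|cutoff N x| <= 1.
Proof.
have := @clip_le 1 (2 * N + 1 - 2 * `|x|) ler01.
by rewrite /cutoff !ler_norml => /andP[h1 h2]; apply/andP; split; lra.
Qed.
End clip.

(** * Density of continuous functions and continuity of translations in L_2 *)

Section density.
Context {R : realType}.
Notation mu := (@lebesgue_measure R).

Lemma cvg0_lt (u : nat -> \bar R) (d : R) : 0 < d -> u @ \oo --> 0%E ->
  \forall n \near \oo, (u n < d%:E)%E.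
Proof.
move=> d0 u0; apply: (u0 [set x | x < d%:E]%E).
apply: open_nbhs_nbhs; split; first exact: open_ereal_lt_ereal.
by rewrite /= lte_fin.
Qed.

Lemma L2_clip (f : R -> R) (d : R) : measurable_fun [set: R] f ->
  (sqnorm f < +oo)%E -> 0 < d ->
  exists2 N : R, 0 <= N & (sqnorm (f \- (clip N \o f))%R < d%:E)%E.
Proof.
move=> mf f2 d0.
have mc N : measurable_fun [set: R] (fun x => ((f x - clip N (f x)) ^+ 2)%:E).
  apply/measurable_EFinP; apply: measurable_funX; apply: measurable_funB => //.
  exact: (measurableT_comp (measurable_clip N)).
have [] := @dominated_convergence _ _ _ mu setT measurableT
  (fun n x => ((f x - clip n%:R (f x)) ^+ 2)%:E) (cst 0%E) (fun x => (f x ^+ 2)%:E).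
- by move=> n; exact: mc.
- exact: measurable_cst.
- apply: aeW => x _; apply: cvg_near_cst.
  near=> n; rewrite clip_id ?subrr ?expr0n//.
  by near: n; exact: nbhs_infty_ger.
- apply/integrableP; split; first by apply/measurable_EFinP; exact: measurable_funX.
  by under eq_integral do rewrite gee0_abs ?lee_fin ?sqr_ge0//.
- apply: aeW => x n _; rewrite gee0_abs ?lee_fin ?sqr_ge0//.
  have [h|h] := leP (`|f x|) n%:R; first by rewrite clip_id// subrr expr0n sqr_ge0.
  rewrite -[_ ^+ 2]real_normK ?num_real// -[f x ^+ 2]real_normK ?num_real// lerXn2r ?nnegrE//.
  have := @clip_lip R n%:R (f x) 0 (ler0n _ _).
  have -> : clip n%:R (0 : R) = 0 by rewrite clip_id// normr0.
  rewrite /clip !subr0; move: h; have := ler0n R n.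
  case: (ler0P (f x + n%:R)); case: (ler0P (f x - n%:R)); case: (ler0P (f x)) => *; rewrite ler_norml; apply/andP; split; lra.
move=> _ _; rewrite integral_cst// mul0e => /(cvg0_lt d0)[n _ /(_ n (leqnn n)) H].
by exists n%:R.
Unshelve. all: by end_near. Qed.

(** Approximation by continuous functions in L_1 is turned into approximation in L_2: once f and the
    approximation are clipped at N, the squared error is at most 2 N times the absolute error. The
    cutoff restores compact support and leaves f unchanged, as f vanishes beyond K. *)
Lemma L2_density (f : R -> R) (K d : R) : measurable_fun [set: R] f ->
  (sqnorm f < +oo)%E -> (forall x, K < `|x| -> f x = 0) -> 0 < d ->
  exists h : R -> R, exists M : R, [/\ continuous h, forall x, `|h x| <= M,
    forall x, K + 1 < `|x| -> h x = 0 & (sqnorm (f \- h)%R < d%:E)%E].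
Proof.
move=> mf f2 fK d0.
have [N N0 HN] := L2_clip mf f2 (divr_gt0 d0 (ltr0n R 4)).
pose fN := clip N \o f.
have mfN : measurable_fun [set: R] fN by exact: (measurableT_comp (measurable_clip N)).
pose E : set R := `[- (K + 1), K + 1]%classic.
have mE : measurable E by exact: measurable_itv.
have muE : (mu E < +oo)%E by rewrite lebesgue_measure_itv/=; case: ifP => // _; rewrite -EFinB ltry.
have bN : [bounded fN x | x in E].
  exists N; split; first exact: num_real.
  by move=> z Nz x _; apply: (le_trans (clip_le _ N0)); exact: ltW.
have iN : mu.-integrable E (EFin \o fN).
  by apply: measurable_bounded_integrable => //; exact: measurable_funTS.
have [g_ [cg ig /cvg0_lt H]] := approximation_continuous_integrable mE muE iN.
(* The tolerance in L_1: multiplied by 2 N it stays below d / 4, and the added 1 covers N = 0. *)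
have e0 : 0 < d / 4 / (2 * N + 1) by rewrite divr_gt0//; lra.
have [n _ /(_ n (leqnn n))/= Hn] := H _ e0.
pose g := g_ n.
pose h x := cutoff K x * clip N (g x).
have ch : continuous h.
  move=> x; apply: cvgM; first exact: continuous_cutoff.
  by apply: continuous_comp; [exact: cg|exact: continuous_clip].
exists h, N; split => //.
- move=> x; rewrite normrM -[leRHS]mul1r ler_pM//; first exact: cutoff_le1.
  exact: clip_le.
- by move=> x Kx; rewrite /h cutoff_out ?mul0r// ltW.
have mh : measurable_fun [set: R] h by exact: continuous_measurable_fun.
have mg : measurable_fun [set: R] g by apply: continuous_measurable_fun; exact: cg.
have fNh : (sqnorm (fN \- h)%R < (d / 4)%:E)%E.
  apply: (@le_lt_trans _ _ (\int[mu]_(x in E) ((2 * N)%:E * `|(fN x - g x)%:E|))%E).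
    have m1 : measurable_fun [set: R] (fun x => ((2 * N)%:E * `|(fN x - g x)%:E|)%E).
      apply: measurable_funeM; apply: measurableT_comp => //.
      by apply/measurable_EFinP; exact: measurable_funB.
    rewrite [X in (_ <= X)%E]integral_indic_mul; apply: ge0_le_intR => //.
    - by apply/measurable_EFinP; apply: measurable_funX; exact: measurable_funB.
    - by apply: emeasurable_funM => //; apply/measurable_EFinP; exact: measurable_indic.
    - by move=> x _; rewrite lee_fin sqr_ge0.
    move=> x _; rewrite indicE.
    have [xK|xK] := leP (`|x|) (K + 1).
      rewrite mem_set; last by rewrite /E/= in_itv/= -ler_norml.
      rewrite mule1 -EFinM lee_fin -real_normK ?num_real// expr2.
      have cfN : cutoff K x * fN x = fN x.
        have [xK'|xK'] := leP (`|x|) K; first by rewrite cutoff_id// mul1r.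
        by rewrite /fN/= fK// clip_id ?normr0// mulr0.
      have b1 : `|fN x - h x| <= `|fN x - g x|.
        rewrite -cfN /h -mulrBr normrM -[leRHS]mul1r ler_pM ?cutoff_le1// cfN.
        rewrite -[X in `|X - _|](@clip_id _ N); last exact: clip_le.
        exact: clip_lip.
      have b2 : `|fN x - h x| <= 2 * N.
        rewrite -cfN /h -mulrBr normrM -[leRHS]mul1r ler_pM ?cutoff_le1//.
        apply: (le_trans (ler_normB _ _)).
        by have := clip_le (f x) N0; have := clip_le (g x) N0; rewrite /fN/=; lra.
      by rewrite ler_pM.
    rewrite /= /fN /h /= fK; last by lra.
    by rewrite clip_id ?normr0// cutoff_out ?mul0r ?subrr ?expr0n ?mule_ge0 ?lee_fin// ?mulr_ge0// ltW.
  rewrite ge0_integralZl//; last 2 first.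
  - apply: measurable_funTS; apply: measurableT_comp => //.
    by apply/measurable_EFinP; exact: measurable_funB.
  - by rewrite lee_fin mulr_ge0.
  apply: (@le_lt_trans _ _ ((2 * N)%:E * (d / 4 / (2 * N + 1))%:E)%E).
    by rewrite lee_wpmul2l ?lee_fin ?mulr_ge0// ltW.
  rewrite -EFinM lte_fin mulrA ltr_pdivrMr; last by lra.
  by rewrite mulrC ltr_pM2l//; lra.
apply: (@le_lt_trans _ _ (2%:E * sqnorm (f \- fN)%R + 2%:E * sqnorm (fN \- h)%R)%E).
  have m1 (k : R -> R) : measurable_fun [set: R] k -> measurable_fun [set: R] (fun x => (k x ^+ 2)%:E).
    by move=> mk; apply/measurable_EFinP; exact: measurable_funX.
  have mA : measurable_fun [set: R] (f \- fN)%R by exact: measurable_funB.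
  have mB : measurable_fun [set: R] (fN \- h)%R by exact: measurable_funB.
  rewrite /sqnorm -!ge0_intRZl//; [|exact: m1|by move=> x _; rewrite lee_fin sqr_ge0|exact: m1|by move=> x _; rewrite lee_fin sqr_ge0].
  rewrite -ge0_intRD//; first last.
  - by move=> x _; rewrite mule_ge0// lee_fin sqr_ge0.
  - by move=> x _; rewrite mule_ge0// lee_fin sqr_ge0.
  - by apply: measurable_funeM; exact: m1.
  - by apply: measurable_funeM; exact: m1.
  apply: ge0_le_intR => //.
  - by apply: m1; exact: measurable_funB.
  - by apply: emeasurable_funD; apply: measurable_funeM; exact: m1.
  - by move=> x _; rewrite lee_fin sqr_ge0.
  move=> x _; rewrite -!EFinM -EFinD lee_fin /=.
  by have := sqr_ge0 ((f x - fN x) - (fN x - h x)); lra.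
have -> : d%:E = (2%:E * (d / 4)%:E + 2%:E * (d / 4)%:E)%E.
  by rewrite -!EFinM -EFinD; congr EFin; field.
by rewrite lteD// lte_pmul2l// lte_fin.
Qed.

Let omega (h : R -> R) (z : R) : \bar R := (\int[mu]_x ((h (x + z) - h x) ^+ 2)%:E)%E.

Let measurable_omega_int (h : R -> R) (z : R) : measurable_fun [set: R] h ->
  measurable_fun [set: R] (fun x => ((h (x + z) - h x) ^+ 2)%:E).
Proof.
move=> mh; apply/measurable_EFinP; apply: measurable_funX; apply: measurable_funB => //.
by apply: (measurableT_comp mh); exact: measurable_funD.
Qed.

Let measurable_omega (h : R -> R) (e : R) : measurable_fun [set: R] h ->
  measurable_fun [set: R] (fun u => omega h (e * u)).
Proof.
move=> mh; rewrite /omega.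
apply: (@measurable_integral2 _ (fun p => ((h (p.2 + e * p.1) - h p.2) ^+ 2)%:E)).
  apply/measurable_EFinP; apply: measurable_funX; apply: measurable_funB => //.
    apply: (measurableT_comp mh); apply: measurable_funD => //.
    exact: measurable_funM.
  exact: (measurableT_comp mh).
by move=> p; rewrite lee_fin sqr_ge0.
Qed.

Let omega_le (h : R -> R) (z : R) : measurable_fun [set: R] h ->
  (omega h z <= 4%:E * sqnorm h)%E.
Proof.
move=> mh.
have m1 : measurable_fun [set: R] (fun x => (h (x + z) ^+ 2)%:E).
  apply/measurable_EFinP; apply: measurable_funX.
  by apply: (measurableT_comp mh); exact: measurable_funD.
have m2 : measurable_fun [set: R] (fun x => (h x ^+ 2)%:E).
  by apply/measurable_EFinP; exact: measurable_funX.
have -> : (4%:E * sqnorm h = 2%:E * (\int[mu]_x (h (x + z) ^+ 2)%:E + sqnorm h))%E.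
  by rewrite sqnorm_shift// -mule2n -[(_ *+ 2)%E]mule_natl muleA -EFinM; congr (_%:E * _)%E; ring.
rewrite -ge0_intRD//; [|by move=> x _; rewrite lee_fin sqr_ge0|by move=> x _; rewrite lee_fin sqr_ge0].
rewrite -ge0_intRZl//; last 2 first.
- exact: emeasurable_funD.
- by move=> x _; rewrite adde_ge0// lee_fin sqr_ge0.
apply: ge0_le_intR => //.
- exact: measurable_omega_int.
- by apply: measurable_funeM; exact: emeasurable_funD.
- by move=> x _; rewrite lee_fin sqr_ge0.
move=> x _; rewrite -EFinD -EFinM lee_fin.
by have := sqr_ge0 (h (x + z) + h x); lra.
Qed.

(** All shifts occurring here have size at most |u|, so every difference is supported in the fixed
    interval [- (K + |u|), K + |u|] and bounded there by 2 M: dominated convergence. *)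
Let omega_cvg (h : R -> R) (M K u : R) : continuous h -> (forall x, `|h x| <= M) ->
  (forall x, K < `|x| -> h x = 0) -> omega h (n.+1%:R^-1 * u) @[n --> \oo] --> 0%E.
Proof.
move=> ch hM hK.
have mh : measurable_fun [set: R] h by exact: continuous_measurable_fun.
pose E : set R := `[- (K + `|u|), K + `|u|]%classic.
have mE : measurable E by exact: measurable_itv.
have [] := @dominated_convergence _ _ _ mu setT measurableT
  (fun n x => ((h (x + n.+1%:R^-1 * u) - h x) ^+ 2)%:E) (cst 0%E)
  (fun x => (4 * M ^+ 2)%:E * (\1_E x)%:E)%E.
- by move=> n; exact: measurable_omega_int.
- exact: measurable_cst.
- apply: aeW => x _; apply: cvg_EFin; first by exact: nearW.
  have c1 : h (x + n.+1%:R^-1 * u) - h x @[n --> \oo] --> h (x + 0) - h x.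
    apply: cvgB; last exact: cvg_cst.
    apply: (@cvg_comp _ _ _ (fun n => x + n.+1%:R^-1 * u) h); last exact: ch.
    apply: cvgD; first exact: cvg_cst.
    rewrite -[X in _ --> X](mul0r u); apply: cvgMr_tmp; exact: cvg_harmonic.
  have := cvg_comp _ _ c1 (@exprn_continuous _ 2 _).
  by rewrite addr0 subrr expr0n; exact.
- apply: integrableZl => //; apply: integrable_indic_itv.
- apply: aeW => x n _; rewrite gee0_abs; last by rewrite lee_fin sqr_ge0.
  rewrite -EFinM lee_fin indicE.
  have un : `|n.+1%:R^-1 * u| <= `|u|.
    by rewrite normrM ler_piMl// ger0_norm// invf_le1// ler1n.
  have [xK|xK] := leP (`|x|) (K + `|u|).
    rewrite mem_set; last by rewrite /E/= in_itv/= -ler_norml.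
    rewrite mulr1.
    have -> : 4 * M ^+ 2 = (2 * M) ^+ 2 by ring.
    rewrite -[_ ^+ 2]real_normK ?num_real// lerXn2r ?nnegrE//.
      by rewrite mulr_ge0// (le_trans _ (hM 0)).
    apply: (le_trans (ler_normB _ _)).
    by have := hM (x + n.+1%:R^-1 * u); have := hM x; lra.
  have u0 := normr_ge0 u.
  rewrite (hK x); last by lra.
  rewrite (hK (x + _)); last first.
    have := lerB_dist x (- (n.+1%:R^-1 * u)).
    by rewrite normrN opprK; lra.
  by rewrite subrr expr0n mulr_ge0// mulr_ge0// sqr_ge0.
by move=> _ _; rewrite integral_cst// mul0e.
Qed.

(** Tonelli moves the x-integral inside; it tends to 0 for each u by [omega_cvg]. The outer integral
    is dominated by 4 [sqnorm h] times [poisson 1], a majorant free of e thanks to the rescaling z =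
    e u. *)
Lemma oscillation_continuous_cvg (h : R -> R) (M K : R) : continuous h ->
  (forall x, `|h x| <= M) -> (forall x, K < `|x| -> h x = 0) ->
  oscillation n.+1%:R^-1 h @[n --> \oo] --> 0%E.
Proof.
move=> ch hM hK.
have mh : measurable_fun [set: R] h by exact: continuous_measurable_fun.
have mp := measurable_poisson (ltr01 : 0 < 1 :> R).
have E e : oscillation e h = (\int[mu]_u ((poisson 1 u)%:E * omega h (e * u)))%E.
  rewrite /oscillation (tonelli_in measurableT measurableT (measurable_osc_poisson e mh))/=; last first.
    by move=> p; rewrite lee_fin mulr_ge0 ?poisson_ge0 ?sqr_ge0.
  apply: eq_integral => u _; rewrite /omega -ge0_intRZl ?lee_fin ?poisson_ge0//; last 2 first.
  - exact: measurable_omega_int.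
  - by move=> x _; rewrite lee_fin sqr_ge0.
  by apply: eq_integral => x _; rewrite -EFinM mulrC.
have sqfin : (sqnorm h < +oo)%E.
  apply: (@le_lt_trans _ _ (\int[mu]_x ((M ^+ 2)%:E * (\1_(`[- K, K]%classic : set R) x)%:E))%E).
    apply: ge0_le_intR => //.
    - by apply/measurable_EFinP; exact: measurable_funX.
    - by apply: measurable_funeM; apply/measurable_EFinP; exact: measurable_indic.
    - by move=> x _; rewrite lee_fin sqr_ge0.
    move=> x _; rewrite -EFinM lee_fin indicE.
    have [xK|xK] := leP (`|x|) K; last by rewrite hK// expr0n mulr_ge0 ?sqr_ge0.
    rewrite mem_set; last by rewrite /= in_itv/= -ler_norml.
    rewrite mulr1 -[_ ^+ 2]real_normK ?num_real// lerXn2r ?nnegrE//.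
    by rewrite (le_trans _ (hM 0)).
  apply: integrable_lty => //; apply: integrableZl => //; apply: integrable_indic_itv.
under eq_cvg do rewrite E.
have sq0 : (0 <= sqnorm h)%E by apply: integral_ge0 => x _; rewrite lee_fin sqr_ge0.
have W : (sqnorm h = (fine (sqnorm h))%:E)%E by rewrite fineK// ge0_fin_numE.
have [] := @dominated_convergence _ _ _ mu setT measurableT
  (fun n u => (poisson 1 u)%:E * omega h (n.+1%:R^-1 * u))%E (cst 0%E)
  (fun u => (4 * fine (sqnorm h))%:E * (poisson 1 u)%:E)%E.
- by move=> n; apply: emeasurable_funM; [exact/measurable_EFinP|exact: measurable_omega].
- exact: measurable_cst.
- apply: aeW => u _; rewrite -[X in _ --> X](mule0 (poisson 1 u)%:E).
  by apply: cvgeZl => //; exact: (omega_cvg _ ch hM hK).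
- by apply: integrableZl => //; exact: integrable_poisson1.
- apply: aeW => u n _; rewrite gee0_abs; last first.
    by rewrite mule_ge0 ?lee_fin ?poisson_ge0//; apply: integral_ge0 => x _; rewrite lee_fin sqr_ge0.
  rewrite muleC lee_wpmul2r ?lee_fin ?poisson_ge0//.
  by rewrite EFinM -W; exact: omega_le.
by move=> _ _; rewrite integral_cst// mul0e.
Qed.

Lemma oscillation_small (f : R -> R) (K d : R) : measurable_fun [set: R] f ->
  (sqnorm f < +oo)%E -> (forall x, K < `|x| -> f x = 0) -> 0 < d ->
  exists2 e : R, 0 < e & (oscillation e f < d%:E)%E.
Proof.
move=> mf f2 fK d0.
have pi0 := pi_gt0 R.
(* Chosen so that 2 (8 pi) d / (32 pi) = d / 2; the oscillation of h supplies the other half. *)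
have d1 : 0 < d / (32 * pi) by rewrite divr_gt0// mulr_gt0.
have [h [M [ch hM hK fh]]] := L2_density mf f2 fK d1.
have mh : measurable_fun [set: R] h by exact: continuous_measurable_fun.
have d4 : 0 < d / 4 by rewrite divr_gt0.
have [n _ /(_ n (leqnn n))/= Hn] := cvg0_lt d4 (oscillation_continuous_cvg ch hM hK).
exists n.+1%:R^-1; first by rewrite invr_gt0.
apply: (le_lt_trans (oscillation_split _ mf mh)).
have mfh : measurable_fun [set: R] (f \- h)%R by exact: measurable_funB.
have -> : d%:E = (2%:E * (d / 4)%:E + 2%:E * ((8 * pi)%:E * (d / (32 * pi))%:E))%E.
  rewrite -!EFinM -EFinD; congr EFin; move: (pi) pi0 => p p0; field.
  by rewrite gt_eqF.
rewrite lteD// lte_pmul2l ?lte_fin//.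
apply: (le_lt_trans (oscillation_le_sqnorm _ mfh)).
by rewrite lte_pmul2l// lte_fin mulr_gt0.
Qed.
End density.

(** * The oscillation in terms of the Fourier transform *)

Section fourier.
Context {R : realType}.
Notation mu := (@lebesgue_measure R).
Implicit Types (f : R -> R) (e s x : R).

Definition fcos f xi : R := \int[mu]_x (f x * cos (x * xi)).
Definition fsin f xi : R := \int[mu]_x (f x * sin (x * xi)).
(** The Fourier transform of an integrable f is [fcos f] - i [fsin f]; this is its squared
    modulus. *)
Definition fpower f xi : R := fcos f xi ^+ 2 + fsin f xi ^+ 2.

Lemma fpower_ge0 f xi : 0 <= fpower f xi.
Proof. by rewrite addr_ge0 ?sqr_ge0. Qed.

Let mcos2 : measurable_fun [set: R * R] (fun p : R * R => cos (p.2 * p.1)).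
Proof.
apply: (measurableT_comp (continuous_measurable_fun (@continuous_cos R))).
exact: measurable_funM.
Qed.

Let msin2 : measurable_fun [set: R * R] (fun p : R * R => sin (p.2 * p.1)).
Proof.
apply: (measurableT_comp (continuous_measurable_fun (@continuous_sin R))).
exact: measurable_funM.
Qed.

Let normcos x : `|cos x| <= 1.
Proof. by rewrite ler_norml cos_geN1 cos_le1. Qed.

Let normsin x : `|sin x| <= 1.
Proof. by rewrite ler_norml sin_geN1 sin_le1. Qed.

Lemma measurable_fcos f : measurable_fun [set: R] f -> measurable_fun [set: R] (fcos f).
Proof.
move=> mf; apply: (measurable_Rintegral2 (F := fun p => f p.2 * cos (p.2 * p.1))).
by apply: measurable_funM => //; exact: measurable_comp_snd.
Qed.

Lemma measurable_fsin f : measurable_fun [set: R] f -> measurable_fun [set: R] (fsin f).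
Proof.
move=> mf; apply: (measurable_Rintegral2 (F := fun p => f p.2 * sin (p.2 * p.1))).
by apply: measurable_funM => //; exact: measurable_comp_snd.
Qed.

Lemma measurable_fpower f : measurable_fun [set: R] f -> measurable_fun [set: R] (fpower f).
Proof.
move=> mf; apply: measurable_funD; apply: measurable_funX.
  exact: measurable_fcos.
exact: measurable_fsin.
Qed.

Lemma le_normr_Rintegral_bounded f (k : R -> R) (M : R) :
  mu.-integrable setT (EFin \o f) -> measurable_fun [set: R] k ->
  (forall x, `|k x| <= M) ->
  `|\int[mu]_x (f x * k x)| <= M * \int[mu]_x `|f x|.
Proof.
move=> intf mk kM.
have ifk := integrable_mul_bounded intf mk kM.
apply: (le_trans (le_normr_Rintegral _ ifk)) => //.
rewrite -RintegralZl//; last exact: integrable_norm.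
apply: le_Rintegral => //.
- exact: integrable_norm.
- by have := integrableZl measurableT M (integrable_norm intf).
by move=> x _; rewrite normrM mulrC ler_wpM2r.
Qed.

(** The squared modulus is the double integral of f(x) f(y) cos((y - x) xi); integrating in xi
    against exp(- e |xi|) turns the cosine into the Poisson kernel. *)
Lemma fpower_laplace f e : 0 < e -> mu.-integrable setT (EFin \o f) ->
  \int[mu]_xi (laplace e xi * fpower f xi) =
  \int[mu]_x (f x * \int[mu]_y (f y * poisson e (y - x))).
Proof.
move=> e0 intf.
have mf : measurable_fun [set: R] f by apply/measurable_EFinP; exact: measurable_int intf.
(* The real part of exp(i x xi) times the transform of f at xi. Being bounded, it allows the double
   integral to be handled by two successive exchanges, first of xi with x, then of xi with y. *)
pose k (p : R * R) := cos (p.2 * p.1) * fcos f p.1 + sin (p.2 * p.1) * fsin f p.1.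
have mk : measurable_fun [set: R * R] k.
  apply: measurable_funD; apply: measurable_funM => //.
    by apply: measurable_comp_fst; exact: measurable_fcos.
  by apply: measurable_comp_fst; exact: measurable_fsin.
have mc xi : measurable_fun [set: R] (fun x => cos (x * xi)).
  exact: (measurable_pair1r mcos2 xi).
have ms xi : measurable_fun [set: R] (fun x => sin (x * xi)).
  exact: (measurable_pair1r msin2 xi).
have ic xi : mu.-integrable setT (EFin \o (fun x => f x * cos (x * xi))).
  exact: (@integrable_mul_bounded _ _ _ 1).
have is_ xi : mu.-integrable setT (EFin \o (fun x => f x * sin (x * xi))).
  exact: (@integrable_mul_bounded _ _ _ 1).
pose M := \int[mu]_x `|f x|.
have bc xi : `|fcos f xi| <= M.
  by rewrite -[M]mul1r; exact: le_normr_Rintegral_bounded.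
have bs xi : `|fsin f xi| <= M.
  by rewrite -[M]mul1r; exact: le_normr_Rintegral_bounded.
have bk p : `|k p| <= M + M.
  apply: (le_trans (ler_normD _ _)); rewrite !normrM lerD//.
    by rewrite -[M]mul1r ler_pM.
  by rewrite -[M]mul1r ler_pM.
have E1 xi : fpower f xi = \int[mu]_x (f x * k (xi, x)).
  have -> : fpower f xi = \int[mu]_x (f x * cos (x * xi)) * fcos f xi + \int[mu]_x (f x * sin (x * xi)) * fsin f xi.
    by rewrite /fpower !expr2.
  rewrite -!RintegralZr// -RintegralD//; first last.
  - by have := integrableZr measurableT (fsin f xi) (is_ xi).
  - by have := integrableZr measurableT (fcos f xi) (ic xi).
  by apply: eq_Rintegral => x _; rewrite /k/=; ring.
under eq_Rintegral do rewrite E1.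
rewrite (Rintegral_swap_bounded (integrable_laplace e0) intf mk bk).
apply: eq_Rintegral => x _; congr (_ * _).
have E2 xi : k (xi, x) = \int[mu]_y (f y * cos ((y - x) * xi)).
  rewrite /k /= /fcos /fsin mulrC [X in _ + X]mulrC -!RintegralZr// -RintegralD//; first last.
  - by have := integrableZr measurableT (sin (x * xi)) (is_ xi).
  - by have := integrableZr measurableT (cos (x * xi)) (ic xi).
  by apply: eq_Rintegral => y _; rewrite mulrBl cosB; ring.
under eq_Rintegral do rewrite E2.
have mk2 : measurable_fun [set: R * R] (fun p : R * R => cos ((p.2 - x) * p.1)).
  apply: (measurableT_comp (continuous_measurable_fun (@continuous_cos R))).
  by apply: measurable_funM => //; exact: measurable_funB.
rewrite (@Rintegral_swap_bounded _ _ _ (fun p : R * R => cos ((p.2 - x) * p.1)) 1 (integrable_laplace e0) intf mk2)//.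
by apply: eq_Rintegral => y _; rewrite -(Rintegral_laplace_cos _ e0).
Qed.

Lemma poisson_le e x : 0 < e -> poisson e x <= 2 / e.
Proof.
move=> e0; rewrite /poisson ler_pdivrMr ?ltr_pwDl ?exprn_gt0 ?sqr_ge0//.
rewrite mulrDr -[leLHS]addr0 lerD//; last by rewrite mulr_ge0 ?sqr_ge0 ?divr_ge0 ?ltW.
by rewrite expr2 mulrA divfK// gt_eqF.
Qed.

(** Expanding the square, the square terms give 4 pi [sqnorm f]. In the cross term the substitution
    y = x + e u turns [poisson 1 u] du into [poisson e (y - x)] dy, which is the right-hand side of
    [fpower_laplace]. *)
Lemma oscillation_fpower f e : 0 < e -> mu.-integrable setT (EFin \o f) ->
  (sqnorm f < +oo)%E ->
  oscillation e f =
  (4 * pi * fine (sqnorm f) - 2 * \int[mu]_xi (laplace e xi * fpower f xi))%:E.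
Proof.
move=> e0 intf f2.
have mf : measurable_fun [set: R] f by apply/measurable_EFinP; exact: measurable_int intf.
have p1 := measurable_comp_snd (measurable_poisson (ltr01 : 0 < 1 :> R)).
have mfa := measurable_comp_addM e mf.
have mff := measurable_comp_fst mf.
pose G1 (p : R * R) := (f (p.1 + e * p.2) ^+ 2 + f p.1 ^+ 2) * poisson 1 p.2.
pose G2 (p : R * R) := 2 * (f p.1 * f (p.1 + e * p.2)) * poisson 1 p.2.
have mG1 : measurable_fun [set: R * R] (EFin \o G1).
  apply/measurable_EFinP; apply: measurable_funM => //.
  by apply: measurable_funD; apply: measurable_funX.
have mG2 : measurable_fun [set: R * R] (EFin \o G2).
  apply/measurable_EFinP; apply: measurable_funM => //.
  by apply: measurable_funM => //; apply: measurable_funM.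
have G10 p : (0 <= (G1 p)%:E)%E.
  by rewrite lee_fin mulr_ge0 ?poisson_ge0// addr_ge0 ?sqr_ge0.
have N2 : (sqnorm f = (fine (sqnorm f))%:E)%E.
  by rewrite fineK// ge0_fin_numE//; apply: integral_ge0 => x _; rewrite lee_fin sqr_ge0.
have IG1 := integral_double_poisson e mf.
have iG1 : (mu \x mu)%E.-integrable setT (EFin \o G1).
  apply/integrable12ltyP => //.
  rewrite [X in (X < _)%E](_ : _ = (\int[mu]_x \int[mu]_u (G1 (x, u))%:E)%E); last first.
    by apply: eq_integral => x _; apply: eq_integral => u _; rewrite gee0_abs//; exact: (G10 (x, u)).
  by rewrite IG1 N2 -EFinM ltry.
(* The cross term is integrable on the product because 2 |a b| <= a^2 + b^2; the expanded square may
   therefore be integrated term by term. *)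
have iG2 : (mu \x mu)%E.-integrable setT (EFin \o G2).
  apply: (le_integrable _ _ _ iG1) => // p _.
  rewrite /= lee_fin [X in _ <= X]ger0_norm; last by have := G10 p; rewrite lee_fin.
  rewrite normrM [X in _ * X]ger0_norm ?poisson_ge0// ler_wpM2r ?poisson_ge0//.
  rewrite ler_norml; have := sqr_ge0 (f p.1 + f (p.1 + e * p.2)); have := sqr_ge0 (f p.1 - f (p.1 + e * p.2)).
  by move=> *; apply/andP; split; lra.
transitivity (\int[(mu \x mu)%E]_p ((G1 p)%:E - (G2 p)%:E))%E.
  pose G3 (p : R * R) := ((f (p.1 + e * p.2) - f p.1) ^+ 2 * poisson 1 p.2)%:E.
  have G30 p : (0 <= G3 p)%E by rewrite lee_fin mulr_ge0 ?poisson_ge0 ?sqr_ge0.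
  have mG3 : measurable_fun [set: R * R] G3 by exact: (measurable_osc_poisson e mf).
  transitivity (\int[(mu \x mu)%E]_p G3 p)%E.
    by apply/esym; exact: (@fubini_tonelli1 _ _ _ _ R mu mu G3 mG3 G30).
  by apply: eq_integral => p _; rewrite -EFinB /G1 /G2 /G3; congr EFin; ring.
rewrite integralB_EFin//.
have -> : (\int[(mu \x mu)%E]_p (G1 p)%:E = (4 * pi)%:E * sqnorm f)%E.
  by rewrite -IG1; exact: (@fubini_tonelli1 _ _ _ _ R mu mu (EFin \o G1) mG1 G10).
have -> : (\int[(mu \x mu)%E]_p (G2 p)%:E = \int[mu]_x \int[mu]_u (G2 (x, u))%:E)%E.
  by apply/esym; exact: (integral12_prod_meas1 iG2).
rewrite {1}N2 -EFinM EFinB; congr (_ - _)%E.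
pose I x := \int[mu]_y (f y * poisson e (y - x)).
have me := measurable_poisson e0.
have mpx x : measurable_fun [set: R] (fun y => poisson e (y - x)).
  by apply: (measurableT_comp me); exact: measurable_funB.
have bp x : `|poisson e x| <= 2 / e.
  by rewrite ger0_norm ?poisson_le// poisson_ge0// ltW.
have ifp x : mu.-integrable setT (EFin \o (fun y => f y * poisson e (y - x))).
  exact: (@integrable_mul_bounded _ _ _ (2 / e)).
have mI : measurable_fun [set: R] I.
  apply: (measurable_Rintegral2 (F := fun p => f p.2 * poisson e (p.2 - p.1))).
  apply: measurable_funM; first exact: measurable_comp_snd.
  by apply: (measurableT_comp me); exact: measurable_funB.
have bI x : `|I x| <= 2 / e * \int[mu]_x `|f x|.
  exact: le_normr_Rintegral_bounded.
have ifI := integrable_mul_bounded intf mI bI.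
rewrite fpower_laplace// -/I.
rewrite EFinM /Rintegral fineK; last exact: (integrable_fin_num measurableT ifI).
rewrite -(integralZl measurableT ifI).
apply: eq_integral => x _.
pose g y := ((2 * f x * e) * (f y * poisson e (y - x)))%:E.
transitivity (\int[mu]_u g (e * u + x)%R)%E.
  apply: eq_integral => u _; rewrite /g /G2/= [e * u + x]addrC [x + e * u - x]addrC addKr.
  rewrite poisson_scale//; congr EFin.
  by rewrite -[RHS]mulrA [RHS]mulrC; field; rewrite gt_eqF.
rewrite integral_affine//; last first.
  by apply/measurable_EFinP; apply: measurable_funM => //; apply: measurable_funM.
under eq_integral do rewrite /g EFinM.
rewrite (integralZl measurableT (ifp x)).
have -> : (\int[mu]_y (EFin \o (fun y => (f y * poisson e (y - x))%R)) y = (I x)%:E)%E.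
  by rewrite /I /Rintegral fineK//; exact: (integrable_fin_num measurableT (ifp x)).
by rewrite -!EFinM; congr EFin; field; rewrite gt_eqF.
Qed.
End fourier.

(** * From Sobolev energy to the modulus of continuity *)

Section sobolev.
Context {R : realType}.
Notation mu := (@lebesgue_measure R).
Implicit Types (f : R -> R) (e s r x : R).

(** Interpolation between the bounds 1 and x. For r > 1 it would fail near 0, whence the cap at 1 on
    the exponent. *)
Lemma onem_expRN_le r x : 0 < r <= 1 -> 0 <= x -> 1 - expR (- x) <= x `^ r.
Proof.
move=> /andP[r0 r1] x0.
have [x1|x1] := leP 1 x.
  apply: (@le_trans _ _ 1); first by have := expR_ge0 (- x); lra.
  by rewrite -(powRr0 x) ler_powR// ltW.
have [->|xn0] := eqVneq x 0; first by rewrite oppr0 expR0 subrr powR_ge0.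
have x0' : 0 < x by rewrite lt_neqAle eq_sym xn0.
apply: (@le_trans _ _ x); first by have := expR_ge1Dx (- x); lra.
rewrite -[leLHS]powRr1//.
rewrite /powR (negbTE xn0) ler_expR ler_wnM2r//.
by rewrite ln_le0// ltW.
Qed.

Lemma norm_powR_le r s x : 0 < r -> r <= s -> `|x| `^ r <= (1 + x ^+ 2) `^ s.
Proof.
move=> r0 rs.
have h : `|x| <= 1 + x ^+ 2.
  rewrite -[x ^+ 2]real_normK ?num_real//; have := sqr_ge0 (`|x| - 1).
  by have := normr_ge0 x; have := sqr_ge0 (`|x|); nra.
apply: (@le_trans _ _ ((1 + x ^+ 2) `^ r)).
  by apply: ge0_ler_powR => //; rewrite ?nnegrE ?addr_ge0 ?sqr_ge0// ltW.
by rewrite ler_powR// lerDl sqr_ge0.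
Qed.

Lemma onem_laplace_le e r s x : 0 < e -> 0 < r <= 1 -> r <= s ->
  1 - laplace e x <= e `^ r * (1 + x ^+ 2) `^ s.
Proof.
move=> e0 /[dup] r01 /andP[r0 r1] rs; rewrite /laplace mulNr.
apply: (le_trans (onem_expRN_le r01 _)); first by rewrite mulr_ge0// ltW.
rewrite powRM ?(ltW e0)// ler_wpM2l ?powR_ge0//.
exact: norm_powR_le.
Qed.

Definition sobolev_energy s f : \bar R :=
  (\int[mu]_xi ((1 + xi ^+ 2) `^ s * fpower f xi)%:E)%E.

Lemma measurable_bessel s : measurable_fun [set: R] (fun xi : R => (1 + xi ^+ 2) `^ s).
Proof.
apply: (measurableT_comp (measurable_powR _)).
by apply: measurable_funD => //; exact: measurable_funX.
Qed.

(** Replacing 4 pi [sqnorm f] by twice the total power in [oscillation_fpower] leaves 2 (1 - exp(- e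
    |xi|)) as a multiplier of the power, and this is at most 2 e^r times the Sobolev weight. *)
Lemma oscillation_le_sobolev f (K r s e : R) : mu.-integrable setT (EFin \o f) ->
  (sqnorm f < +oo)%E -> (forall x, K < `|x| -> f x = 0) ->
  (sobolev_energy s f < +oo)%E -> 0 < r <= 1 -> r <= s -> 0 < e ->
  (oscillation e f <= (2 * e `^ r)%:E * sobolev_energy s f)%E.
Proof.
move=> intf f2 fK fs /[dup] r01 /andP[r0 r1] rs e0.
have mf : measurable_fun [set: R] f by apply/measurable_EFinP; exact: measurable_int intf.
have mw := measurable_fpower mf.
have mb := measurable_bessel s.
have bessel1 x : 1 <= (1 + x ^+ 2) `^ s.
  rewrite -{1}(powRr0 (1 + x ^+ 2)) ler_powR ?lerDl ?sqr_ge0//.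
  by apply: (le_trans (ltW r0)).
have ibw : mu.-integrable setT (EFin \o (fun xi => (1 + xi ^+ 2) `^ s * fpower f xi)).
  apply/integrableP; split; first by apply/measurable_EFinP; exact: measurable_funM.
  by under eq_integral do rewrite gee0_abs ?lee_fin ?mulr_ge0 ?powR_ge0 ?fpower_ge0//.
have iw : mu.-integrable setT (EFin \o fpower f).
  apply: (le_integrable _ _ _ ibw) => //; first exact/measurable_EFinP.
  move=> x _; rewrite /= lee_fin !ger0_norm ?mulr_ge0 ?powR_ge0 ?fpower_ge0//.
  by rewrite ler_peMl// fpower_ge0.
have mlw e' : measurable_fun [set: R] (fun xi => laplace e' xi * fpower f xi).
  by apply: measurable_funM => //; exact: measurable_laplace.
have ilw e' : 0 < e' -> mu.-integrable setT (EFin \o (fun xi => laplace e' xi * fpower f xi)).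
  move=> e'0; apply: (le_integrable _ _ _ iw) => //.
    by apply/measurable_EFinP; exact: mlw.
  move=> x _; rewrite /= lee_fin !ger0_norm ?mulr_ge0 ?laplace_ge0 ?fpower_ge0//.
  by rewrite ler_piMl ?fpower_ge0// laplace_le1// ltW.
pose B := \int[mu]_xi fpower f xi.
(* The inequality half of Plancherel. As [laplace e'] <= 1, the identity for the oscillation gives 4
   pi [sqnorm f] <= 2 B + [oscillation e' f], and some e' makes the last term smaller than any given
   d. *)
have planch : 4 * pi * fine (sqnorm f) <= 2 * B.
  apply/ler_addgt0Pl => d d0.
  have [e' e'0] := oscillation_small mf f2 fK d0.
  rewrite (oscillation_fpower e'0 intf f2) lte_fin => osc.
  have : \int[mu]_xi (laplace e' xi * fpower f xi) <= B.
    apply: le_Rintegral => //; first exact: ilw.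
    by move=> x _; rewrite ler_piMl ?fpower_ge0// laplace_le1// ltW.
  move: osc; move: (Rintegral _ _ _) (4 * pi * _) (B) => A Q B' osc AB.
  by clear -osc AB; lra.
rewrite (oscillation_fpower e0 intf f2).
apply: (@le_trans _ _ (2 * (B - \int[mu]_xi (laplace e xi * fpower f xi)))%:E).
  rewrite lee_fin; move: planch; move: (Rintegral _ _ _) (4 * pi * _) (B) => A Q B' QB.
  by clear -QB; lra.
rewrite -RintegralB//; last exact: ilw.
rewrite EFinM [X in (_ <= X * _)%E]EFinM -muleA lee_wpmul2l ?lee_fin//.
have idw : mu.-integrable setT (EFin \o (fun xi => fpower f xi - laplace e xi * fpower f xi)).
  have -> : EFin \o (fun xi => fpower f xi - laplace e xi * fpower f xi) =
     ((EFin \o fpower f) \- (EFin \o (fun xi => (laplace e xi * fpower f xi)%R)))%E by [].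
  by apply: integrableB => //; exact: ilw.
rewrite /Rintegral fineK; last exact: (integrable_fin_num measurableT idw).
rewrite /sobolev_energy -ge0_intRZl ?lee_fin ?powR_ge0//; last 2 first.
- by apply/measurable_EFinP; exact: measurable_funM.
- by move=> x _; rewrite lee_fin mulr_ge0 ?powR_ge0 ?fpower_ge0.
apply: ge0_le_intR => //.
- by apply/measurable_EFinP; exact: measurable_funB.
- by apply: measurable_funeM; apply/measurable_EFinP; exact: measurable_funM.
- move=> x _; rewrite lee_fin subr_ge0 ler_piMl ?fpower_ge0//.
  by rewrite laplace_le1// ltW.
move=> x _; rewrite -EFinM lee_fin mulrA.
rewrite -{1}[fpower f x]mul1r -mulrBl ler_wpM2r ?fpower_ge0//.
exact: onem_laplace_le.
Qed.

(** The z-integral is not divided by its length 2 e; regularity of order r thus shows as e * e^r. *)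
Definition sqmodulus (D : set R) f e : \bar R :=
  (\int[mu]_(x in D) \int[mu]_(z in `[(- e)%R, e]) ((f (x + z) - f x) ^+ 2)%:E)%E.

(** After z = e u the window is [- 1, 1], where [poisson 1] is at least 1; the factor e is the
    Jacobian. *)
Lemma sqmodulus_le_oscillation f e : measurable_fun [set: R] f -> 0 < e ->
  (sqmodulus setT f e <= e%:E * oscillation e f)%E.
Proof.
move=> mf e0.
have mO := measurable_osc_poisson e mf.
have O0 (p : R * R) : (0 <= ((f (p.1 + e * p.2) - f p.1) ^+ 2 * poisson 1 p.2)%:E)%E.
  by rewrite lee_fin mulr_ge0 ?poisson_ge0 ?sqr_ge0.
have mD : measurable_fun [set: R * R] (fun p => ((f (p.1 + p.2) - f p.1) ^+ 2)%:E).
  apply/measurable_EFinP; have := measurable_osc 1 mf.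
  by under eq_fun do rewrite mul1r.
have D0 (p : R * R) : (0 <= ((f (p.1 + p.2) - f p.1) ^+ 2)%:E)%E by rewrite lee_fin sqr_ge0.
rewrite /oscillation -ge0_intRZl ?lee_fin ?(ltW e0)//; last 2 first.
- exact: (measurable_integral2 mO O0).
- by move=> x _; apply: integral_ge0 => u _; exact: (O0 (x, u)).
apply: ge0_le_intR => //.
- exact: (measurable_integral2_in (measurable_itv _) mD D0).
- by apply: measurable_funeM; exact: (measurable_integral2 mO O0).
- by move=> x _; apply: integral_ge0 => u _; exact: (D0 (x, u)).
move=> x _.
have mDx := measurable_pair1r mD x.
have -> : (\int[mu]_(z in `[(- e)%R, e]) ((f (x + z) - f x) ^+ 2)%:E =
   e%:E * \int[mu]_(u in `[(- 1)%R, 1%R]) ((f (x + e * u) - f x) ^+ 2)%:E)%E.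
  have := @ge0_integral_itv_affine _ e 0 (- 1) 1 _ e0 mDx (fun z => D0 (x, z)).
  rewrite /= mulrN mulr1 !addr0 => H.
  under [X in (_ = _ * X)%E]eq_integral do rewrite -[X in f (x + X)]addr0.
  by rewrite H muleA -EFinM divff ?gt_eqF// mul1e.
rewrite lee_wpmul2l ?lee_fin ?(ltW e0)//.
rewrite integral_indic_mul.
have mex : measurable_fun [set: R] (fun u => ((f (x + e * u) - f x) ^+ 2)%:E).
  by apply/measurable_EFinP; exact: (measurable_pair1r (measurable_osc e mf) x).
apply: ge0_le_intR => //.
- by apply: emeasurable_funM => //; apply/measurable_EFinP; exact: measurable_indic.
- exact: (measurable_pair1r mO x).
- by move=> u _; rewrite mule_ge0 ?lee_fin ?sqr_ge0.
move=> u _; rewrite -EFinM lee_fin ler_wpM2l ?sqr_ge0// indicE.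
case: (boolP (u \in _)) => [|_]; last by rewrite poisson_ge0.
rewrite inE/= in_itv/= -ler_norml => u1.
by have := poisson_ge (ltr01 : 0 < 1 :> R) u1; rewrite invr1.
Qed.

(** Membership in [W2] only provides gc and gs as L_2 limits of truncated transforms. For f
    supported in [- K, K] the truncations with n >= K are exact, so gc and gs agree almost
    everywhere with [fcos f] and [fsin f], and the weighted bound becomes finiteness of
    [sobolev_energy]. Integrability of f comes from |f| <= 1 + f^2 on the support. *)
Lemma W2_modulus (f : R -> R) (s K : R) : W2 s f -> (forall x, K < `|x| -> f x = 0) -> 0 < s ->
  exists2 C : R, 0 <= C & forall e, 0 < e ->
  (sqmodulus setT f e <= (C * (e * e `^ Num.min 1 s))%:E)%E.
Proof.
move=> [mf f2 [gc [gs [[mgc mgs gcv] fin]]]] fK s0.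
have f2' : (sqnorm f < +oo)%E.
  by move: f2; under eq_integral do rewrite real_normK ?num_real//.
have intf : mu.-integrable setT (EFin \o f).
  pose E : set R := `[- K, K]%classic.
  have i1 : mu.-integrable setT (EFin \o (fun x => \1_E x + f x ^+ 2)).
    have -> : EFin \o (fun x => \1_E x + f x ^+ 2) =
      ((EFin \o \1_E) \+ (fun x => (f x ^+ 2)%:E))%E by [].
    apply: integrableD => //; first exact: integrable_indic_itv.
    apply/integrableP; split; first by apply/measurable_EFinP; exact: measurable_funX.
    by under eq_integral do rewrite gee0_abs ?lee_fin ?sqr_ge0//.
  apply: (le_integrable _ _ _ i1) => //; first exact/measurable_EFinP.
  move=> x _; rewrite /= lee_fin [X in _ <= X]ger0_norm ?addr_ge0 ?sqr_ge0//.
  have [xK|xK] := leP (`|x|) K; last first.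
    by rewrite fK// normr0 expr0n addr_ge0.
  rewrite indicE mem_set; last by rewrite /E /= in_itv/= -ler_norml.
  rewrite -[f x ^+ 2]real_normK ?num_real//=.
  by have := sqr_ge0 (`|f x| - 1); have := normr_ge0 (f x); nra.
have mc := measurable_fcos mf; have ms := measurable_fsin mf.
have trunc n : K <= n%:R -> forall xi,
    fourier_cos_trunc f n xi = fcos f xi /\ fourier_sin_trunc f n xi = fsin f xi.
  move=> Kn xi; rewrite /fourier_cos_trunc /fourier_sin_trunc !(Rintegral_mkcond mu `[- n%:R, n%:R]%classic).
  split; apply: eq_Rintegral => x _; rewrite patchE; case: ifPn => //;
    rewrite notin_setE /= in_itv/= => /negP; rewrite -ler_norml -ltNge => xn;
    by rewrite fK ?mul0r//; apply: (le_lt_trans Kn).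
pose D xi := ((fcos f xi - gc xi) ^+ 2 + (fsin f xi - gs xi) ^+ 2)%:E.
have mD : measurable_fun [set: R] D.
  by apply/measurable_EFinP; apply: measurable_funD; apply: measurable_funX; apply: measurable_funB.
have D0 xi : (0 <= D xi)%E by rewrite lee_fin addr_ge0 ?sqr_ge0.
have ID0 : (\int[mu]_xi `|D xi| = 0)%E.
  under eq_integral do rewrite gee0_abs//.
  apply/eqP; rewrite eq_le integral_ge0 ?andbT//; apply/lee_addgt0Pr => d d0; rewrite add0e.
  near \oo => n.
  have Kn : K <= n%:R by near: n; exact: nbhs_infty_ger.
  have un : (\int[mu]_xi ((fourier_cos_trunc f n xi - gc xi) ^+ 2 +
      (fourier_sin_trunc f n xi - gs xi) ^+ 2)%:E < d%:E)%E.
    by near: n; exact: (cvg0_lt d0 gcv).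
  apply: (le_trans _ (ltW un)); rewrite le_eqVlt; apply/orP; left; apply/eqP.
  by apply: eq_integral => xi _; have [-> ->] := trunc n Kn xi.
have aeD := (ae_eq_integral_abs mu measurableT mD).1 ID0.
have Eeq : (sobolev_energy s f = \int[mu]_xi ((1 + xi ^+ 2) `^ s * (gc xi ^+ 2 + gs xi ^+ 2))%:E)%E.
  apply: ge0_ae_eq_integral => //.
  - apply/measurable_EFinP; apply: measurable_funM; first exact: measurable_bessel.
    exact: measurable_fpower.
  - apply/measurable_EFinP; apply: measurable_funM; first exact: measurable_bessel.
    by apply: measurable_funD; apply: measurable_funX.
  - by move=> x _; rewrite lee_fin mulr_ge0 ?powR_ge0 ?fpower_ge0.
  - by move=> x _; rewrite lee_fin mulr_ge0 ?powR_ge0 ?addr_ge0 ?sqr_ge0.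
  apply: filterS aeD => xi /= /(_ I) [] /eqP; rewrite paddr_eq0 ?sqr_ge0// !sqrf_eq0 !subr_eq0.
  by move=> /andP[/eqP Ec /eqP Es] _; rewrite /fpower Ec Es.
have fs : (sobolev_energy s f < +oo)%E by rewrite Eeq.
have fs0 : (0 <= sobolev_energy s f)%E.
  by apply: integral_ge0 => x _; rewrite lee_fin mulr_ge0 ?powR_ge0 ?fpower_ge0.
exists (2 * fine (sobolev_energy s f)); first by rewrite mulr_ge0// fine_ge0.
move=> e e0.
apply: (le_trans (sqmodulus_le_oscillation mf e0)).
have r01 : 0 < Num.min 1 s <= 1 by rewrite lt_min ltr01 s0 ge_min lexx.
have rs : Num.min 1 s <= s by rewrite ge_min lexx orbT.
apply: (@le_trans _ _ (e%:E * ((2 * e `^ Num.min 1 s)%:E * sobolev_energy s f))%E).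
  by rewrite lee_wpmul2l ?lee_fin ?(ltW e0)//; exact: (oscillation_le_sobolev intf f2' fK).
rewrite -[sobolev_energy s f]fineK ?ge0_fin_numE// -!EFinM lee_fin le_eqVlt; apply/orP; left; apply/eqP.
by rewrite /=; move: (fine (sobolev_energy s f)) (e `^ _) => a b; ring.
Unshelve. all: by end_near. Qed.
End sobolev.

(** * A smooth bump function *)

Section bump.
Context {R : realType}.
Implicit Types (p : {poly R}) (k : nat) (x y : R).

(* The derivatives of the bump function [expR (- 1 / (16 - x ^ 2))] all have this form. *)
Definition bumpgen k p x : R :=
  if `|x| < 4 then p.[x] * (16 - x ^+ 2)^-1 ^+ k * expR (- (16 - x ^+ 2)^-1) else 0.

Definition bump : R -> R := bumpgen 0 1.

Lemma horner_bounded p (B : R) : exists2 M : R, 0 <= M & forall y, `|y| <= B -> `|p.[y]| <= M.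
Proof.
elim/poly_ind: p => [|p c [M M0 IH]].
  by exists 0 => // y _; rewrite horner0 normr0.
exists (M * `|B| + `|c|); first by rewrite addr_ge0// mulr_ge0.
move=> y yB; rewrite !hornerE; apply: (le_trans (ler_normD _ _)); rewrite lerD2r normrM.
rewrite ler_pM//; first exact: IH.
by apply: (le_trans yB); exact: ler_norm.
Qed.

(** With v = 1 / u, from v^(k + 2) / (k + 2)! <= exp v. The exponential beats a pole of any order
    and leaves u^2 to spare, enough for a zero derivative at the edge of the support. *)
Lemma expRNV_le k (u : R) : 0 < u -> u^-1 ^+ k * expR (- u^-1) <= (k.+2)`!%:R * u ^+ 2.
Proof.
move=> u0; have v0 : 0 < u^-1 by rewrite invr_gt0.
have h := @expR_ge1Dxn R u^-1 k.+1 (ltW v0).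
rewrite expRN ler_pdivrMr ?expR_gt0//.
have f0 : 0 < (k.+2)`!%:R :> R by rewrite ltr0n fact_gt0.
have h2 : u^-1 ^+ k.+2 <= (k.+2)`!%:R * expR u^-1.
  by rewrite -ler_pdivrMl// mulrC; apply: le_trans h; rewrite lerDr.
have -> : u^-1 ^+ k = u ^+ 2 * u^-1 ^+ k.+2.
  by rewrite !exprS; move: (u^-1 ^+ k) => w; field; rewrite gt_eqF.
by rewrite [X in _ <= X]mulrAC [X in _ <= X]mulrC ler_wpM2l ?sqr_ge0.
Qed.

Lemma bumpgen_le k p : exists2 C : R, 0 <= C &
  forall y, `|bumpgen k p y| <= C * (Num.max 0 (16 - y ^+ 2)) ^+ 2.
Proof.
have [M M0 HM] := horner_bounded p 4.
exists (M * (k.+2)`!%:R); first by rewrite mulr_ge0.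
move=> y; rewrite /bumpgen; case: ifPn => [y4|_]; last first.
  by rewrite normr0 mulr_ge0 ?sqr_ge0// mulr_ge0.
have u0 : 0 < 16 - y ^+ 2.
  rewrite subr_gt0 -[y ^+ 2]real_normK ?num_real//.
  by have := normr_ge0 y; nra.
rewrite max_r ?(ltW u0)// -!mulrA normrM ler_pM//; first by apply: HM; exact: ltW.
rewrite ger0_norm; first exact: expRNV_le.
by rewrite mulr_ge0 ?expR_ge0// exprn_ge0// invr_ge0 ltW.
Qed.

(** Meant for the points with |x| >= 4, above all the two edges, where the bump is glued to 0 and no
    formula can be differentiated. *)
Lemma is_derive_sq_bound (F : R -> R) (C x : R) : F x = 0 ->
  (forall y, `|F y| <= C * (y - x) ^+ 2) -> is_derive x 1 F 0.
Proof.
move=> Fx FC.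
have cv : h^-1 *: (F (h *: 1 + x) - F x) @[h --> 0^'] --> (0 : R).
  apply/norm_cvg0P.
  apply: (@squeeze_cvgr _ _ _ _ (cst 0) (fun h : R => C * `|h|)).
  - near=> h; have h0 : h != 0 by near: h; exact: nbhs_dnbhs_neq.
    rewrite normr_ge0/= Fx subr0 /GRing.scale/= mulr1 normrM normfV.
    rewrite ler_pdivrMl ?normr_gt0//; apply: (le_trans (FC _)).
    rewrite addrK -[h ^+ 2]real_normK ?num_real// le_eqVlt; apply/orP; left; apply/eqP; ring.
  - exact: cvg_cst.
  - rewrite -[X in _ --> X](mulr0 C); apply: cvgMl_tmp.
    rewrite -[X in _ --> X](normr0 R); apply: cvg_norm; apply: cvg_within.
apply: DeriveDef; first by apply/cvg_ex; exists 0.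
exact/cvg_lim.
Unshelve. all: by end_near. Qed.

(** With u = 16 - x^2, the numerator of the derivative of p u^(- k) exp(- 1 / u) over the
    denominator u^(k + 2). *)
Let poly_step k p : {poly R} := p^`() * (16%:P - 'X ^+ 2) ^+ 2
  + (2 * k%:R)%:P * 'X * p * (16%:P - 'X ^+ 2) - 2%:P * 'X * p.

Let poly_stepE k p x : (poly_step k p).[x] = p^`().[x] * (16 - x ^+ 2) ^+ 2
  + 2 * k%:R * x * p.[x] * (16 - x ^+ 2) - 2 * x * p.[x].
Proof. by rewrite /poly_step !(hornerD, hornerN, hornerM, horner_exp, hornerC, hornerX). Qed.

Lemma is_derive_bumpgen k p x : is_derive x 1 (bumpgen k p) (bumpgen k.+2 (poly_step k p) x).
Proof.
have [x4|x4] := ltP (`|x|) 4; last first.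
  have E0 j q : bumpgen j q x = 0 by rewrite /bumpgen ltNge x4.
  rewrite E0; have [C C0 HC] := bumpgen_le k p.
  (* The factor 64 is 8^2: if |y| < 4 <= |x|, then 16 - y^2 = (4 - |y|) (4 + |y|) <= 8 |x - y|. *)
  apply: (@is_derive_sq_bound _ (C * 64)); first exact: E0.
  move=> y; apply: (le_trans (HC y)); rewrite -mulrA ler_wpM2l//.
  have -> : 64 * (y - x) ^+ 2 = (8 * `|x - y|) ^+ 2.
    by rewrite exprMn real_normK ?num_real// -sqrrN opprB; congr (_ * _); ring.
  rewrite lerXn2r ?nnegrE ?le_max ?lexx ?mulr_ge0//.
  rewrite ge_max mulr_ge0//=.
  have h1 := lerB_dist x y; have h2 := normr_ge0 y.
  rewrite -[y ^+ 2]real_normK ?num_real//.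
  have [y4|y4] := leP 4 (`|y|); first by have := normr_ge0 (x - y); nra.
  nra.
have u0 : 16 - x ^+ 2 != 0.
  rewrite gt_eqF// subr_gt0 -[x ^+ 2]real_normK ?num_real//.
  by have := normr_ge0 x; nra.
pose h y := p.[y] * (16 - y ^+ 2)^-1 ^+ k * expR (- (16 - y ^+ 2)^-1).
have hE : {near x, h =1 bumpgen k p}.
  near=> y; rewrite /bumpgen ifT//.
  near: y; apply: (cvgr_lt (`|x|)) => //; exact: norm_continuous.
apply: (near_eq_is_derive hE).
rewrite /bumpgen x4.
have du : is_derive x 1 (fun y : R => 16 - y ^+ 2) (- (2 * x)).
  have := is_deriveB (is_derive_cst (16 : R) x 1) (is_deriveX 2 (is_derive_id x (1:R))).
  by move=> h0; apply: is_derive_eq h0 _; rewrite /GRing.scale/= expr1; ring.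
have dv : is_derive x 1 (fun y : R => (16 - y ^+ 2)^-1) (2 * x * (16 - x ^+ 2)^-1 ^+ 2).
  have [dd Dd] := du.
  apply: DeriveDef; first exact: derivableV.
  by rewrite deriveV// Dd /GRing.scale/= exprVn; ring.
have dvk : is_derive x 1 (fun y : R => (16 - y ^+ 2)^-1 ^+ k)
    (k%:R * (16 - x ^+ 2)^-1 ^+ k.-1 * (2 * x * (16 - x ^+ 2)^-1 ^+ 2)).
  by have := is_deriveX k dv; rewrite exprfctE; exact.
have de : is_derive x 1 (fun y : R => expR (- (16 - y ^+ 2)^-1))
    (expR (- (16 - x ^+ 2)^-1) * - (2 * x * (16 - x ^+ 2)^-1 ^+ 2)).
  exact: (is_derive1_comp (is_derive_expR _) (is_deriveN dv)).
have dp := is_derive_poly p x.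
have h0 := is_deriveM (is_deriveM dp dvk) de.
apply: is_derive_eq h0 _.
rewrite poly_stepE /GRing.scale/=.
rewrite [X in X * (_ * - _)](_ : _ = p.[x] * (16 - x ^+ 2)^-1 ^+ k)//.
move: (expR _) (p.[x]) (p^`().[x]) u0 => E a b; move: (16 - x ^+ 2) => u u0.
case: k {dvk h hE} => [|k]; first by rewrite !expr0 mulr0n; field.
rewrite !exprS expr0 mulr1 /=; move: (u^-1 ^+ k) => w.
field; exact: u0.
Unshelve. all: by end_near. Qed.

Lemma smooth_bumpgen k p : smooth (bumpgen k p).
Proof.
move=> n x.
have [j [q ->]] : exists j q, derive1n n (bumpgen k p) = bumpgen j q.
  elim: n => [|n [j [q IH]]]; first by exists k, p.
  exists j.+2, (poly_step j q); apply/funext => y.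
  by rewrite derive1nS IH derive1E; have [] := is_derive_bumpgen j q y.
by have [] := is_derive_bumpgen j q x.
Qed.

Lemma test_function_bump : test_function bump.
Proof.
split; first exact: smooth_bumpgen.
by exists 4 => x x4; rewrite /bump /bumpgen ltNge (ltW x4).
Qed.

Lemma bump_out x : 4 < `|x| -> bump x = 0.
Proof. by move=> x4; rewrite /bump /bumpgen ltNge (ltW x4). Qed.

Lemma bump_ge x : `|x| <= 3 -> expR (-1) <= bump x.
Proof.
move=> x3; rewrite /bump /bumpgen ifT; last by lra.
rewrite hornerC expr0 !mul1r ler_expR lerN2.
have u1 : 1 <= 16 - x ^+ 2.
  by rewrite -[x ^+ 2]real_normK ?num_real//; have := normr_ge0 x; nra.
by rewrite invf_le1// (lt_le_trans _ u1).
Qed.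

Lemma bump_lipschitz : exists2 L : R, 0 <= L & forall x y, `|bump x - bump y| <= L * `|x - y|.
Proof.
have [C C0 HC] := bumpgen_le 2 (poly_step 0 1).
(* The derivative is [bumpgen 2 (poly_step 0 1)], bounded by C max(0, 16 - z^2)^2, and 256 = 16^2;
   the mean value theorem concludes. *)
exists (C * 256); first by rewrite mulr_ge0.
have bnd z : `|bumpgen 2 (poly_step 0 1) z| <= C * 256.
  apply: (le_trans (HC z)); rewrite ler_wpM2l//.
  rewrite (_ : 256 = 16 ^+ 2); last by ring.
  by rewrite lerXn2r ?nnegrE ?le_max ?lexx// ge_max ler0n/=; have := sqr_ge0 z; lra.
have cb : continuous bump.
  move=> z; apply: differentiable_continuous; apply/derivable1_diffP.
  by have [] := is_derive_bumpgen 0 1 z.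
suff H x y : x <= y -> `|bump y - bump x| <= C * 256 * `|y - x|.
  move=> x y; have [xy|/ltW yx] := leP x y; last exact: H.
  by rewrite distrC [X in _ * X]distrC; exact: H.
move=> xy.
have [c _ ->] := @MVT_segment R bump (bumpgen 2 (poly_step 0 1)) x y xy
  (fun z _ => is_derive_bumpgen 0 1 z) (continuous_subspaceT cb).
by rewrite normrM ler_wpM2r.
Qed.
End bump.

(** * The modulus of a locally Sobolev function on a unit interval *)

Section local_modulus.
Context {R : realType}.
Notation mu := (@lebesgue_measure R).
Implicit Types (f sigma : R -> R) (e s x : R).

Lemma Lp_loc_itv n f (a b : R) : Lp_loc n f ->
  (\int[mu]_(x in `[a, b]) (`|f x| ^+ n)%:E < +oo)%E.
Proof. by move=> [_]; apply; exact: segment_compact. Qed.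

Lemma integral_itv_cst (a b M : R) : a <= b ->
  (\int[mu]_(x in `[a, b]) M%:E = (M * (b - a))%:E)%E.
Proof.
move=> ab; rewrite [LHS](_ : _ = M%:E * mu `[a, b]%classic)%E; last first.
  exact: (integral_cst mu (measurable_itv _)).
rewrite lebesgue_measure_itv/= lte_fin.
have [_|ba] := ltP a b; first by rewrite -EFinB -EFinM.
by rewrite (_ : b = a) ?subrr ?mulr0 ?mule0//; apply/eqP; rewrite eq_le ba ab.
Qed.

Lemma measurable_shift2 f : measurable_fun [set: R] f ->
  measurable_fun [set: R * R] (fun p => f (p.1 + p.2)).
Proof. by move=> mf; apply: (measurableT_comp mf); exact: measurable_funD. Qed.

Lemma measurable_sqdiff f : measurable_fun [set: R] f ->
  measurable_fun [set: R * R] (fun p => ((f (p.1 + p.2) - f p.1) ^+ 2)%:E).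
Proof.
move=> mf; apply/measurable_EFinP; apply: measurable_funX; apply: measurable_funB.
  exact: measurable_shift2.
exact: measurable_comp_fst.
Qed.

Lemma sqdiff_ge0 f (p : R * R) : (0 <= ((f (p.1 + p.2) - f p.1) ^+ 2)%:E)%E.
Proof. by rewrite lee_fin sqr_ge0. Qed.

(** With f = [bump] sigma, the product [bump (x + z)] (sigma(x + z) - sigma(x)) equals f(x + z) -
    f(x) minus ([bump (x + z)] - [bump x]) sigma(x). For x in [0, 1] and |z| <= 1 the first factor
    is at least c = exp(- 1), and the last term is of order e |sigma(x)| by the Lipschitz bound. The
    constant 2 / c^2 comes from squaring a difference and dividing by this lower bound. *)
Lemma W2_loc_modulus sigma s : Lp_loc 2 sigma -> W2_loc s sigma -> 0 < s ->
  exists2 C : R, 0 <= C & forall e, 0 < e <= 1 ->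
    (sqmodulus `[0%R, 1%R]%classic sigma e <= (C * (e * e `^ Num.min 1 s))%:E)%E.
Proof.
move=> [ms Ls] Ws s0.
pose f x := bump x * sigma x.
have Wf : W2 s f by exact: Ws test_function_bump.
have mf : measurable_fun [set: R] f by case: Wf.
have fK x : 4 < `|x| -> f x = 0 by move=> x4; rewrite /f bump_out// mul0r.
have [C1 C10 HC1] := W2_modulus Wf fK s0.
have [L L0 HL] := @bump_lipschitz R.
pose c : R := expR (-1); have c0 : 0 < c by exact: expR_gt0.
have Sfin := Lp_loc_itv 0 1 (conj ms Ls : Lp_loc 2 sigma).
pose S := (\int[mu]_(x in `[0%R, 1%R]) (`|sigma x| ^+ 2)%:E)%E.
have S0 : (0 <= S)%E by apply: integral_ge0 => x _; rewrite lee_fin exprn_ge0.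
have SE : S = (fine S)%:E by rewrite fineK// ge0_fin_numE.
pose D := 2 / c ^+ 2.
have D0 : 0 <= D by rewrite divr_ge0// sqr_ge0.
exists (D * C1 + 2 * D * L ^+ 2 * fine S).
  apply: addr_ge0; first exact: mulr_ge0.
  by apply: mulr_ge0; [apply: mulr_ge0; [exact: mulr_ge0|exact: sqr_ge0]|exact: fine_ge0].
move=> e /andP[e0 e1].
have key x z : 0 <= x <= 1 -> - e <= z <= e ->
    (sigma (x + z) - sigma x) ^+ 2 <= D * (f (x + z) - f x) ^+ 2 + D * (L ^+ 2 * e ^+ 2) * `|sigma x| ^+ 2.
  move=> /andP[x0 x1] /andP[z0 z1].
  have bz : c <= bump (x + z) by apply: bump_ge; rewrite ler_norml; apply/andP; split; lra.
  have dz : (bump (x + z) - bump x) ^+ 2 <= L ^+ 2 * e ^+ 2.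
    rewrite -exprMn -[_ ^+ 2]real_normK ?num_real// lerXn2r ?nnegrE ?mulr_ge0 ?(ltW e0)//.
    apply: (le_trans (HL _ _)); rewrite ler_wpM2l// addrAC subrr add0r ler_norml z1 andbT; lra.
  have E : bump (x + z) * (sigma (x + z) - sigma x) =
     (f (x + z) - f x) - (bump (x + z) - bump x) * sigma x by rewrite /f; ring.
  have h1 : c ^+ 2 * (sigma (x + z) - sigma x) ^+ 2 <= (bump (x + z) * (sigma (x + z) - sigma x)) ^+ 2.
    rewrite exprMn ler_wpM2r ?sqr_ge0// lerXn2r ?nnegrE ?(ltW c0)//.
    by rewrite (le_trans (ltW c0)).
  have h2 : (bump (x + z) * (sigma (x + z) - sigma x)) ^+ 2 <=
     2 * (f (x + z) - f x) ^+ 2 + 2 * ((bump (x + z) - bump x) ^+ 2 * sigma x ^+ 2).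
    rewrite E; move: (f _ - f _) => a; rewrite -exprMn; move: (_ * sigma x) => b.
    by have := sqr_ge0 (a + b); lra.
  have h3 : (bump (x + z) - bump x) ^+ 2 * sigma x ^+ 2 <= L ^+ 2 * e ^+ 2 * sigma x ^+ 2.
    by rewrite ler_wpM2r ?sqr_ge0.
  have c2 : 0 < c ^+ 2 by rewrite exprn_gt0.
  rewrite real_normK ?num_real// -mulrA -mulrDr /D -mulrA mulrCA ler_pdivlMl//.
  rewrite mulrDr; apply: (le_trans h1); apply: (le_trans h2); rewrite lerD2l ler_wpM2l//.
have mfD := measurable_sqdiff mf.
have msD := measurable_sqdiff ms.
have ms2 : measurable_fun [set: R] (fun x => (`|sigma x| ^+ 2)%:E).
  by apply/measurable_EFinP; apply: measurable_funX; apply: measurableT_comp.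
pose K := D * (L ^+ 2 * e ^+ 2).
have K0 : 0 <= K by apply: mulr_ge0 => //; apply: mulr_ge0; exact: sqr_ge0.
have Ke0 : 0 <= K * (2 * e) by apply: mulr_ge0 => //; rewrite mulr_ge0// ltW.
have inner x : 0 <= x <= 1 ->
  (\int[mu]_(z in `[(- e)%R, e]) ((sigma (x + z) - sigma x) ^+ 2)%:E <=
    D%:E * \int[mu]_(z in `[(- e)%R, e]) ((f (x + z) - f x) ^+ 2)%:E +
    (K * (2 * e))%:E * (`|sigma x| ^+ 2)%:E)%E.
  move=> x01.
  have mfx := measurable_pair1r mfD x.
  have -> : ((K * (2 * e))%:E * (`|sigma x| ^+ 2)%:E =
     \int[mu]_(z in `[(- e)%R, e]) (K * `|sigma x| ^+ 2)%:E)%E.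
    rewrite integral_itv_cst; last by lra.
    by rewrite -EFinM; congr EFin; ring.
  rewrite -ge0_intRZl ?lee_fin//; last by move=> z _; exact: (sqdiff_ge0 f (x, z)).
  rewrite -ge0_intRD//; first last.
  - by move=> z _; rewrite lee_fin mulr_ge0// exprn_ge0.
  - by move=> z _; rewrite mule_ge0 ?lee_fin//; exact: (sqdiff_ge0 f (x, z)).
  - exact: measurable_funeM.
  apply: ge0_le_intR => //.
  - exact: (measurable_pair1r msD x).
  - by apply: emeasurable_funD => //; exact: measurable_funeM.
  - by move=> z _; exact: (sqdiff_ge0 sigma (x, z)).
  by move=> z; rewrite /= in_itv/= => zE; rewrite -EFinM -EFinD lee_fin; exact: key.
have mfI := measurable_integral2_in (measurable_itv `[- e, e]) mfD (sqdiff_ge0 f).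
have fI0 x : (0 <= \int[mu]_(z in `[(- e)%R, e]) ((f (x + z) - f x) ^+ 2)%:E)%E.
  by apply: integral_ge0 => z _; exact: (sqdiff_ge0 f (x, z)).
apply: (@le_trans _ _ (D%:E * sqmodulus setT f e + (K * (2 * e))%:E * S)%E).
  apply: (@le_trans _ _ (D%:E * sqmodulus `[0%R, 1%R]%classic f e + (K * (2 * e))%:E * S)%E); last first.
    rewrite leeD2r// lee_wpmul2l ?lee_fin//; exact: ge0_subset_integral.
  rewrite /sqmodulus /S -!ge0_intRZl ?lee_fin//.
  rewrite -ge0_intRD//; first last.
  - by move=> x _; rewrite mule_ge0 ?lee_fin// exprn_ge0.
  - by move=> x _; rewrite mule_ge0 ?lee_fin.
  - exact: measurable_funeM.
  - exact: measurable_funeM.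
  apply: ge0_le_intR => //.
  - exact: (measurable_integral2_in (measurable_itv _) msD (sqdiff_ge0 sigma)).
  - by apply: emeasurable_funD; exact: measurable_funeM.
  - by move=> x _; apply: integral_ge0 => z _; exact: (sqdiff_ge0 sigma (x, z)).
apply: (@le_trans _ _ (D%:E * (C1 * (e * e `^ Num.min 1 s))%:E + (K * (2 * e))%:E * S)%E).
  by rewrite leeD2r// lee_wpmul2l ?lee_fin//; exact: HC1.
rewrite SE -!EFinM -EFinD lee_fin /=.
(* The Lipschitz error is of order e * e^2 after the z-integral; since e <= 1 and the exponent is
   capped at 1, it is absorbed by e * e^r. *)
have er : e ^+ 2 <= e `^ Num.min 1 s.
  rewrite -powR_mulrn ?(ltW e0)//; apply: ger_powR; first by rewrite e0.
  by rewrite ge_min; apply/orP; left; rewrite ler1n.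
have h : K * (2 * e) * fine S <= 2 * D * L ^+ 2 * fine S * (e * e `^ Num.min 1 s).
  rewrite (_ : K * (2 * e) * fine S = 2 * D * L ^+ 2 * fine S * (e * e ^+ 2)); last by rewrite /K; ring.
  apply: ler_wpM2l; last by apply: ler_wpM2l => //; exact: ltW.
  by apply: mulr_ge0; [apply: mulr_ge0; [exact: mulr_ge0|exact: sqr_ge0]|exact: fine_ge0].
by rewrite [leRHS]mulrDl -(mulrA D C1) lerD2l.
Qed.
End local_modulus.

(** * Primitives of locally integrable functions *)

Section local_integrability.
Context {R : realType}.
Notation mu := (@lebesgue_measure R).
Implicit Types (f : R -> R).

Lemma Lp_loc_integrable (p : nat) f (a b : R) : (0 < p)%N -> Lp_loc p f ->
  mu.-integrable `[a, b] (EFin \o f).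
Proof.
move=> p0 Lf; have [mf _] := Lf.
have ifin : (\int[mu]_(x in `[a, b]) (1 + `|f x| ^+ p)%:E < +oo)%E.
  rewrite [X in (X < _)%E](_ : _ = \int[mu]_(x in `[a, b]) (1%:E + (`|f x| ^+ p)%:E))%E; last first.
    by apply: eq_integral => x _; rewrite EFinD.
  rewrite ge0_intRD//; last first.
    by apply/measurable_EFinP; apply: measurable_funX; apply: measurableT_comp.
  apply: lte_add_pinfty; last exact: Lp_loc_itv.
  have [ab|ba] := leP a b; first by rewrite integral_itv_cst// ltry.
  by rewrite set_itv_ge ?integral_set0 ?ltry// bnd_simp -ltNge.
apply/integrableP; split; first by apply/measurable_EFinP; exact: measurable_funTS.
apply: (le_lt_trans _ ifin); apply: ge0_le_intR => //.
- by apply: measurableT_comp => //; exact/measurable_EFinP.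
- by apply/measurable_EFinP; apply: measurable_funD => //; apply: measurable_funX; apply: measurableT_comp.
move=> x _; rewrite lee_fin /=.
have [h|h] := leP (`|f x|) 1; first by rewrite (le_trans h)// lerDl exprn_ge0.
by rewrite -[leLHS]add0r lerD// ler_eXnr// ltW.
Qed.

Lemma integrable_indic_mul f (D : set R) : measurable D ->
  mu.-integrable D (EFin \o f) <-> mu.-integrable setT (EFin \o (fun x => f x * \1_D x)).
Proof.
move=> mD; have := @integrable_mkcond _ _ _ mu D (EFin \o f) mD.
suff -> : (EFin \o f) \_ D = EFin \o (fun x => f x * \1_D x) by [].
by apply/funext => x; rewrite patchE /= indicE; case: (x \in D); rewrite ?mulr1 ?mulr0.
Qed.

Lemma Rintegral_indic_mul f (D : set R) :
  \int[mu]_(x in D) f x = \int[mu]_x (f x * \1_D x).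
Proof.
rewrite Rintegral_mkcond; apply: eq_Rintegral => x _.
by rewrite patchE indicE; case: (x \in D); rewrite ?mulr1 ?mulr0.
Qed.

Lemma Rintegral_period f (x : R) : Lp_loc 1 f -> periodic f 1 ->
  \int[mu]_(y in `]x, (x + 1)]) f y = \int[mu]_(y in `[0, 1]) f y.
Proof.
move=> Lf pf; have [mf _] := Lf.
have mE : measurable_fun [set: R] (EFin \o f) by exact/measurable_EFinP.
have mp := measurable_funepos mE; have mn := measurable_funeneg mE.
have pp y : ((EFin \o f)^\+ (y + 1)%R = (EFin \o f)^\+ y)%E by rewrite !funeposE /= pf.
have pn y : ((EFin \o f)^\- (y + 1)%R = (EFin \o f)^\- y)%E by rewrite !funenegE /= pf.
rewrite /Rintegral; congr fine.
rewrite integral_itv_obnd_cbnd; last exact: measurable_funTS.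
rewrite -!integral_itv_bndo_bndc; [|exact: measurable_funTS|exact: measurable_funTS].
rewrite integralE [RHS]integralE.
have -> := ge0_integral_period pp mp (funepos_ge0 (EFin \o f)) x.
have -> := ge0_integral_period pn mn (funeneg_ge0 (EFin \o f)) x.
by [].
Qed.
End local_integrability.

Section primitive.
Context {R : realType}.
Notation mu := (@lebesgue_measure R).
Variable w : R -> R.
Hypothesis Lw : Lp_loc 1 w.

Let mw : measurable_fun [set: R] w. Proof. by case: Lw. Qed.

(* The signed indicator of the interval between 0 and x, for either sign of x. *)
Let ind (x y : R) : R := \1_`]-oo, x] y - \1_`]-oo, (0 : R)] y.

Let indE x y : ind x y = ((y <= x)%R)%:R - ((y <= 0)%R)%:R.
Proof. by rewrite /ind !indicE !mem_setE !in_itv. Qed.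

Lemma norm_ind x y : `|ind x y| <= 1.
Proof.
rewrite indE; case: (y <= x); case: (y <= 0); rewrite /= ?subrr ?subr0 ?sub0r ?normrN ?normr0 ?normr1//.
Qed.

Lemma ind_out K x y : `|x| <= K -> K < `|y| -> ind x y = 0.
Proof.
move=> xK yK; have K0 : 0 <= K by rewrite (le_trans _ xK).
move: xK; rewrite ler_norml => /andP[x1 x2].
rewrite indE; have [y0|y0] := ler0P y; move: yK.
  rewrite ler0_norm// => yK; rewrite (_ : y <= x) ?subrr//; lra.
by rewrite gtr0_norm// => yK; rewrite leNgt (_ : x < y) ?subrr//=; lra.
Qed.

(** An integral over the whole line against the bounded kernel [ind], the form in which
    measurability in x and the exchange of integrals are available. *)
Definition primitive (x : R) : R := \int[mu]_y (w y * ind x y).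

Lemma measurable_ind : measurable_fun [set: R * R] (fun p : R * R => ind p.1 p.2).
Proof.
have -> : (fun p : R * R => ind p.1 p.2) = (fun p : R * R => \1_`]-oo, (0 : R)] (p.2 - p.1) - \1_`]-oo, (0 : R)] p.2).
  by apply/funext => p; rewrite indE !indicE !mem_setE !in_itv/= subr_le0.
have mi : measurable_fun [set: R] (\1_`]-oo, (0 : R)] : R -> R) by exact: measurable_indic.
apply: measurable_funB; last exact: (measurable_comp_snd mi).
by apply: (measurableT_comp mi); exact: measurable_funB.
Qed.

Let integrable_w_ind x : mu.-integrable setT (EFin \o (fun y => w y * ind x y)).
Proof.
have /(@integrable_indic_mul _ w) : mu.-integrable `[- `|x|, `|x|] (EFin \o w).
  exact: Lp_loc_integrable Lw.
move=> /(_ (measurable_itv _)) iw.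
have := integrable_mul_bounded iw (measurable_pair1r measurable_ind x) (norm_ind x).
apply: eq_integrable => // y _; congr EFin; rewrite indicE mem_setE in_itv/= -ler_norml.
by have [yx|yx] := leP (`|y|) (`|x|); rewrite ?mulr1// (ind_out (lexx _) yx) !mulr0.
Qed.

Lemma measurable_primitive : measurable_fun [set: R] primitive.
Proof.
apply: (measurable_Rintegral2 (F := fun p => w p.2 * ind p.1 p.2)).
by apply: measurable_funM; [exact: measurable_comp_snd|exact: measurable_ind].
Qed.

Lemma primitiveB a b : a <= b -> primitive b - primitive a = \int[mu]_(y in `]a, b]) w y.
Proof.
move=> ab; rewrite /primitive -RintegralB//.
rewrite [RHS]Rintegral_indic_mul; apply: eq_Rintegral => y _.
rewrite -mulrBr !indE indicE mem_setE in_itv/=; congr (_ * _).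
have [ya|ya] := leP y a; first by rewrite (le_trans ya ab)/= subrr.
by case: (y <= b) => /=; ring.
Qed.

Lemma primitive0 : primitive 0 = 0.
Proof.
rewrite /primitive (_ : (fun y => w y * ind 0 y) = cst 0).
  by rewrite /Rintegral integral0.
by apply/funext => y; rewrite /ind subrr mulr0.
Qed.

Lemma periodic_primitive : periodic w 1 -> \int[mu]_(y in `[0, 1]) w y = 0 ->
  periodic primitive 1.
Proof.
move=> pw w0 x; apply/eqP; rewrite -subr_eq0 primitiveB ?lerDl//.
by rewrite Rintegral_period// w0.
Qed.

Lemma normr_primitiveB_le a b c d : c <= a -> c <= b -> a <= d -> b <= d ->
  (`|primitive b - primitive a|%:E <= \int[mu]_(y in `[c, d]) `|w y|%:E)%E.
Proof.
wlog ab : a b / a <= b.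
  move=> H ca cb ad bd; have [ab|/ltW ba] := leP a b; first exact: H.
  by rewrite distrC; exact: H.
move=> ca cb ad bd.
have iab : mu.-integrable `]a, b] (EFin \o w).
  apply: (integrableS _ _ _ (Lp_loc_integrable a b (ltn0Sn 0) Lw)) => //.
  by apply: subset_itv; rewrite bnd_simp.
rewrite primitiveB// EFin_normr_Rintegral//.
apply: (le_trans (le_abse_integral _ _ _)) => //.
  by apply/measurable_EFinP; exact: measurable_funTS.
apply: ge0_subset_integral => //.
  by apply: measurable_funTS; apply/measurable_EFinP; apply: measurableT_comp.
by apply: subset_itv; rewrite bnd_simp.
Qed.
End primitive.

(** * Test functions *)

Section test_functions.
Context {R : realType}.
Notation mu := (@lebesgue_measure R).
Implicit Types (f psi : R -> R) (x y : R).

Lemma test_function_derive psi : test_function psi -> test_function psi^`()%classic.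
Proof.
move=> [sm [K HK]]; split.
  move=> n x; have := sm n.+1 x.
  by rewrite /derive1n iterSr.
exists K => x Kx.
rewrite derive1E -[RHS](derive_cst (0 : R) x 1).
apply: near_eq_derive; near=> y; apply: HK.
by near: y; apply: (cvgr_gt (`|x|)) => //; exact: norm_continuous.
Unshelve. all: by end_near. Qed.

Lemma test_function_is_derive psi x : test_function psi -> is_derive x 1 psi (psi^`()%classic x).
Proof. by move=> [sm _]; rewrite derive1E; apply/derivableP; exact: (sm 0). Qed.

Lemma test_function_continuous psi : test_function psi -> continuous psi.
Proof.
move=> tp x; apply: differentiable_continuous; apply/derivable1_diffP.
by have [] := test_function_is_derive x tp.
Qed.

Lemma test_function_measurable psi : test_function psi -> measurable_fun [set: R] psi.
Proof. by move=> tp; apply: continuous_measurable_fun; exact: test_function_continuous. Qed.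

Lemma test_function_bounded psi : test_function psi -> exists M, forall x, `|psi x| <= M.
Proof.
move=> tp; have [_ [K HK]] := tp.
have cn : continuous (fun x => `|psi x|).
  by move=> x; apply: cvg_norm; exact: test_function_continuous.
have [|c _ Hc] := @EVT_max R (fun x => `|psi x|) (- `|K|) (`|K|) _ (continuous_subspaceT cn).
  by rewrite (@le_trans _ _ 0)// oppr_le0.
exists (`|psi c|) => x; have [xK|xK] := leP (`|x|) (`|K|).
  by apply: Hc; rewrite in_itv/= -ler_norml.
by rewrite HK ?normr0// (le_lt_trans (ler_norm _) xK).
Qed.

Lemma test_function_integrable (p : nat) f psi : (0 < p)%N -> Lp_loc p f -> test_function psi ->
  mu.-integrable setT (EFin \o (fun x => f x * psi x)).
Proof.
move=> p0 Lf tp; have [_ [K HK]] := tp.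
have [M HM] := test_function_bounded tp.
have /(integrable_indic_mul f (measurable_itv _)) ifK := Lp_loc_integrable (- K) K p0 Lf.
have := integrable_mul_bounded ifK (test_function_measurable tp) HM.
apply: eq_integrable => // x _; congr EFin; rewrite indicE mem_setE in_itv/= -ler_norml.
by have [xK|xK] := leP (`|x|) K; rewrite ?mulr1// HK// !mulr0.
Qed.

Lemma Lp_loc_cst (p : nat) (c : R) : Lp_loc p (cst c).
Proof.
split=> // A cA.
have mA : measurable A by exact: compact_measurable.
have [N [_ HN]] := compact_bounded cA.
apply: (@le_lt_trans _ _ (\int[mu]_(x in `[(- (N + 1))%R, (N + 1)%R]%classic) (`|c| ^+ p)%:E)%E).
  apply: ge0_subset_integral => //.
    exact: (measurable_cst (`|c| ^+ p)%:E).
  move=> x Ax; rewrite /= in_itv/= -ler_norml; apply: HN => //.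
  by rewrite ltrDl.
have [ab|ba] := leP (- (N + 1)) (N + 1); first by rewrite integral_itv_cst// ltry.
by rewrite set_itv_ge ?integral_set0 ?ltry// bnd_simp -ltNge.
Qed.

Lemma integrable_test_function psi : test_function psi -> mu.-integrable setT (EFin \o psi).
Proof.
move=> tpsi; have := test_function_integrable (ltn0Sn 0) (Lp_loc_cst 1 1) tpsi.
by apply: eq_integrable => // x _; rewrite /= mul1r.
Qed.

Lemma test_function_integral_ge psi y : test_function psi ->
  \int[mu]_x (psi^`()%classic x * ((y <= x)%R)%:R) = - psi y.
Proof.
move=> tp; have [_ [K HK]] := tp.
have td := test_function_derive tp; have [_ [K' HK']] := td.
pose b := Num.max (Num.max `|K| `|K'|) `|y| + 1.
have Kb : K < b by rewrite (le_lt_trans (ler_norm _))// /b ltr_pwDr// !le_max lexx.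
have K'b : K' < b by rewrite (le_lt_trans (ler_norm _))// /b ltr_pwDr// !le_max lexx orbT.
have yb : y < b by rewrite (le_lt_trans (ler_norm _))// /b ltr_pwDr// !le_max lexx !orbT.
have b0 : 0 < b by rewrite /b ltr_pwDr// !le_max normr_ge0.
transitivity (\int[mu]_(x in `[y, b]) psi^`()%classic x).
  rewrite [RHS]Rintegral_indic_mul; apply: eq_Rintegral => x _.
  rewrite indicE mem_setE in_itv/=; case: (y <= x) => //=.
  have [xb|xb] := leP x b; first by [].
  by rewrite HK' ?mul0r// gtr0_norm ?(lt_trans K'b)// (lt_trans b0).
rewrite /Rintegral (@continuous_FTC2 _ _ psi)//=.
- by rewrite HK ?gtr0_norm// sub0r.
- by apply: continuous_subspaceT; exact: test_function_continuous.
- split.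
  + by move=> x _; have [] := test_function_is_derive x tp.
  + by apply: cvg_at_right_filter; exact: test_function_continuous.
  + by apply: cvg_at_left_filter; exact: test_function_continuous.
Qed.
End test_functions.

(** * Modulus and distributional derivative of a primitive *)

Section primitive_distribution.
Context {R : realType}.
Notation mu := (@lebesgue_measure R).
Variable w : R -> R.
Hypothesis Lw : Lp_loc 1 w.

(** For |z| <= e the increment at x is at most V(x), the integral of |w| over [x - e, x + e]. As w
    is only integrable, one factor of V^2 is bounded by the full mass B on [- 1, 2]; the other
    integrates over [0, 1] to at most 2 e B by Tonelli, and the z-window contributes another 2 e. *)
Lemma primitive_modulus : exists2 C : R, 0 <= C & forall e, 0 < e <= 1 ->
  (sqmodulus `[0%R, 1%R]%classic (primitive w) e <= (C * (e * e))%:E)%E.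
Proof.
have [mw _] := Lw.
have mP := measurable_primitive Lw.
have maw : measurable_fun [set: R] (fun x => `|w x|%:E).
  by apply/measurable_EFinP; apply: measurableT_comp.
pose B := (\int[mu]_(y in `[(- 1)%R, 2%R]) `|w y|%:E)%E.
have B0 : (0 <= B)%E by apply: integral_ge0 => x _; rewrite lee_fin.
have BE : B = (fine B)%:E.
  rewrite fineK// ge0_fin_numE//.
  by have := Lp_loc_itv (- 1) 2 Lw; under eq_integral do rewrite expr1.
have b0 : 0 <= fine B by exact: fine_ge0.
exists (4 * fine B * fine B); first by rewrite !mulr_ge0.
move=> e /andP[e0 e1].
pose V x := (\int[mu]_(y in `[(- e)%R, e]) `|w (x + y)|%:E)%E.
have mw2 : measurable_fun [set: R * R] (fun p => `|w (p.1 + p.2)|%:E).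
  by apply/measurable_EFinP; apply: measurableT_comp => //; exact: measurable_shift2.
have mV : measurable_fun [set: R] V.
  by apply: (measurable_integral2_in (measurable_itv _) mw2) => p; rewrite lee_fin.
have V0 x : (0 <= V x)%E by apply: integral_ge0 => y _; rewrite lee_fin.
have VE x : V x = (\int[mu]_(y in `[(x - e)%R, (x + e)%R]) `|w y|%:E)%E.
  have := @ge0_integral_itv_shift _ x (- e) e true false (fun y => `|w y|%:E) maw.
  rewrite addrC [e + x]addrC => <-; last by move=> y; rewrite lee_fin.
  by apply: eq_integral => y _; rewrite addrC.
have VB x : 0 <= x <= 1 -> (V x <= B)%E.
  move=> /andP[x0 x1]; rewrite VE; apply: ge0_subset_integral => //.
    exact: measurable_funTS.
  by apply: subset_itv; rewrite bnd_simp; lra.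
have key x z : 0 <= x <= 1 -> - e <= z <= e ->
  (((primitive w (x + z) - primitive w x) ^+ 2)%:E <= B * V x)%E.
  move=> x01 /andP[z0 z1].
  have h : (`|primitive w (x + z) - primitive w x|%:E <= V x)%E.
    by rewrite VE; apply: normr_primitiveB_le => //; lra.
  rewrite -real_normK ?num_real// expr2 EFinM.
  by apply: lee_pmul; rewrite ?lee_fin//; apply: (le_trans h); exact: VB.
have mD := measurable_sqdiff mP.
rewrite /sqmodulus.
apply: (@le_trans _ _ (\int[mu]_(x in `[0%R, 1%R]) ((2 * e)%:E * (B * V x)))%E).
  apply: ge0_le_intR => //.
  - exact: (measurable_integral2_in (measurable_itv _) mD (sqdiff_ge0 _)).
  - by do 2 apply: measurable_funeM.
  - by move=> x _; apply: integral_ge0 => z _; exact: (sqdiff_ge0 (primitive w) (x, z)).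
  move=> x; rewrite /= in_itv/= => x01.
  have VF : (V x = (fine (V x))%:E)%E.
    by rewrite fineK// ge0_fin_numE// (le_lt_trans (VB _ x01))// BE ltry.
  have -> : ((2 * e)%:E * (B * V x) = \int[mu]_(z in `[(- e)%R, e]) (fine B * fine (V x))%:E)%E.
    rewrite integral_itv_cst; last by lra.
    by rewrite BE VF -!EFinM /=; congr EFin; ring.
  apply: ge0_le_intR => //.
  - exact: (measurable_pair1r mD x).
  - by move=> z _; exact: (sqdiff_ge0 (primitive w) (x, z)).
  by move=> z; rewrite /= in_itv/= => zE; rewrite [X in (_ <= X)%E]EFinM -BE -VF; exact: key.
rewrite ge0_intRZl//; last 3 first.
- exact: measurable_funeM.
- by move=> x _; rewrite mule_ge0.
- by rewrite lee_fin mulr_ge0// ltW.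
rewrite ge0_intRZl//.
have VI : (\int[mu]_(x in `[0%R, 1%R]) V x <= (2 * e)%:E * B)%E.
  rewrite /V (tonelli_in (measurable_itv _) (measurable_itv _) mw2)/=; last by move=> p; rewrite lee_fin.
  have -> : ((2 * e)%:E * B = \int[mu]_(y in `[(- e)%R, e]) (fine B)%:E)%E.
    rewrite integral_itv_cst; last by lra.
    by rewrite BE -EFinM /=; congr EFin; ring.
  apply: ge0_le_intR => //.
  - have mw2' : measurable_fun [set: R * R] (fun p => `|w (p.2 + p.1)|%:E).
      by under eq_fun do rewrite addrC.
    by apply: (measurable_integral2_in (measurable_itv _) mw2') => p; rewrite lee_fin.
  - by move=> y _; apply: integral_ge0 => x _; rewrite lee_fin.
  move=> y; rewrite /= in_itv/= => /andP[y0 y1]; rewrite -BE.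
  have := @ge0_integral_itv_shift _ y 0 1 true false (fun y => `|w y|%:E) maw.
  move=> ->; last by move=> z; rewrite lee_fin.
  apply: ge0_subset_integral => //; first exact: measurable_funTS.
  by apply: subset_itv; rewrite bnd_simp; lra.
apply: (@le_trans _ _ ((2 * e)%:E * (B * ((2 * e)%:E * B)))%E).
  by rewrite lee_wpmul2l ?lee_fin ?mulr_ge0 ?(ltW e0)// lee_wpmul2l.
rewrite BE -!EFinM lee_fin /= le_eqVlt; apply/orP; left; apply/eqP; ring.
Qed.

Lemma Lp_loc_primitive : Lp_loc 2 (primitive w).
Proof.
have mP := measurable_primitive Lw.
split=> // A cA.
have mA : measurable A by exact: compact_measurable.
have [N [_ HN]] := compact_bounded cA.
pose M := `|N| + 1.
pose B := (\int[mu]_(y in `[(- M)%R, M]) `|w y|%:E)%E.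
have B0 : (0 <= B)%E by apply: integral_ge0 => x _; rewrite lee_fin.
have BE : B = (fine B)%:E.
  rewrite fineK// ge0_fin_numE//.
  by have := Lp_loc_itv (- M) M Lw; under eq_integral do rewrite expr1.
have M0 : 0 <= M by rewrite addr_ge0.
apply: (@le_lt_trans _ _ (\int[mu]_(x in `[(- M)%R, M]) (fine B ^+ 2)%:E)%E); last first.
  by rewrite integral_itv_cst ?ltry//; lra.
have m2 : measurable_fun [set: R] (fun x => (`|primitive w x| ^+ 2)%:E).
  by apply/measurable_EFinP; apply: measurable_funX; apply: measurableT_comp.
apply: (@le_trans _ _ (\int[mu]_(x in `[(- M)%R, M]) (`|primitive w x| ^+ 2)%:E)%E).
  apply: ge0_subset_integral => //; first exact: measurable_funTS.
  move=> x Ax; rewrite /= in_itv/= -ler_norml; apply: HN => //.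
  by rewrite /M ltr_pwDr// ler_norm.
apply: ge0_le_intR => //.
move=> x; rewrite /= in_itv/= => /andP[x0 x1]; rewrite lee_fin lerXn2r ?nnegrE ?fine_ge0//.
rewrite -lee_fin -BE -[primitive w x]subr0 -(primitive0 w).
by apply: normr_primitiveB_le => //; lra.
Qed.

(** Fubini for psi'(x) w(y) [ind x y], with w first cut to an interval containing the supports so
    that it becomes integrable on the line. The inner integral of psi' against the kernel is -
    psi(y). *)
Lemma primitive_by_parts psi : test_function psi ->
  \int[mu]_x (primitive w x * psi^`()%classic x) = - \int[mu]_x (w x * psi x).
Proof.
move=> tp; have [_ [K HK]] := tp.
have td := test_function_derive tp; have [_ [K' HK']] := td.
pose b := Num.max `|K| `|K'|.
have Kb : K <= b by rewrite (le_trans (ler_norm _))// /b le_max lexx.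
have K'b : K' <= b by rewrite (le_trans (ler_norm _))// /b le_max lexx orbT.
pose E : set R := `[- b, b]%classic.
pose wE x := w x * \1_E x.
have indb y : \1_E y = ((`|y| <= b)%R)%:R by rewrite indicE mem_setE in_itv/= -ler_norml.
have iwE : mu.-integrable setT (EFin \o wE).
  by apply/(integrable_indic_mul w (measurable_itv _)); exact: Lp_loc_integrable Lw.
have itd := integrable_test_function td.
pose k (p : R * R) := (\1_`]-oo, p.1] p.2 - \1_`]-oo, (0 : R)] p.2 : R).
have mk : measurable_fun [set: R * R] k by exact: measurable_ind.
have bk p : `|k p| <= 1 by exact: norm_ind.
transitivity (\int[mu]_x (psi^`()%classic x * \int[mu]_y (wE y * k (x, y)))).
  apply: eq_Rintegral => x _; rewrite mulrC.
  have [xb|xb] := leP (`|x|) b; last by rewrite HK' ?mul0r// (le_lt_trans K'b).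
  congr (_ * _); apply: eq_Rintegral => y _; rewrite /wE indb.
  have [yb|yb] := leP (`|y|) b; first by rewrite mulr1.
  by rewrite mulr0 mul0r (_ : _ - _ = 0) ?mulr0//; exact: (ind_out xb yb).
rewrite (Rintegral_swap_bounded itd iwE mk bk).
rewrite -[RHS]mulN1r -RintegralZl//; last exact: (test_function_integrable (ltn0Sn 0) Lw tp).
apply: eq_Rintegral => y _.
have -> : \int[mu]_x (psi^`()%classic x * k (x, y)) = - psi y.
  (* The part of the kernel at 0 contributes the integral of psi' over the whole line; it is written
     over x >= - c, left of the support, where it equals - psi(- c) = 0. *)
  pose c := b + 1.
  have b0 : 0 <= b by rewrite (le_trans (normr_ge0 K))// le_max lexx.
  have psic : psi (- c) = 0.
    apply: HK.
    by rewrite normrN gtr0_norm /c; lra.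
  have i1 (z : R) : mu.-integrable setT (EFin \o (fun x => psi^`()%classic x * ((z <= x)%R)%:R)).
    apply: (integrable_mul_bounded (M := 1) itd).
      have := measurable_indic (measurable_itv `[z, +oo[) : measurable_fun [set: R] (\1_`[z, +oo[ : R -> R).
      by congr (measurable_fun _ _); apply/funext => x; rewrite indicE mem_setE in_itv/= andbT.
    by move=> x; case: (z <= x); rewrite ?normr1 ?normr0.
  transitivity (\int[mu]_x (psi^`()%classic x * ((y <= x)%R)%:R - ((y <= 0)%R)%:R * (psi^`()%classic x * ((- c <= x)%R)%:R))).
    apply: eq_Rintegral => x _; rewrite /k /= !indicE !mem_setE !in_itv/=.
    have [xc|xc] := leP (- c) x; first by rewrite mulr1; ring.
    rewrite HK' ?mul0r ?mulr0 ?subrr//; rewrite ltr0_norm; move: xc; rewrite /c; lra.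
  rewrite RintegralB//; last by have := integrableZl measurableT ((y <= 0)%R)%:R (i1 (- c)).
  by rewrite RintegralZl// !test_function_integral_ge// psic oppr0 mulr0 subr0.
rewrite /wE indb.
have [yb|yb] := leP (`|y|) b; first by rewrite mulr1 mulN1r mulrN.
by rewrite HK ?(le_lt_trans Kb)// mulr0 mul0r !mulr0.
Qed.
End primitive_distribution.

(** * Dilations of a periodic function *)

Section dilation.
Context {R : realType}.
Notation mu := (@lebesgue_measure R).
Implicit Types (f g : R -> R) (e x : R).

Lemma sqmodulusD (D : set R) f g e : measurable D ->
  measurable_fun [set: R] f -> measurable_fun [set: R] g ->
  (sqmodulus D (f \+ g)%R e <= 2%:E * sqmodulus D f e + 2%:E * sqmodulus D g e)%E.
Proof.
move=> mD mf mg.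
have mfg : measurable_fun [set: R] (f \+ g)%R by exact: measurable_funD.
have mf2 := measurable_sqdiff mf; have mg2 := measurable_sqdiff mg.
have mfg2 := measurable_sqdiff mfg.
have mE := measurable_itv `[- e, e].
have mI k (m2 : measurable_fun [set: R * R] (fun p => ((k (p.1 + p.2) - k p.1) ^+ 2)%:E)) :=
  measurable_integral2_in mE m2 (sqdiff_ge0 k).
have I0 k x : (0 <= \int[mu]_(z in `[(- e)%R, e]) ((k (x + z) - k x) ^+ 2)%:E)%E.
  by apply: integral_ge0 => z _; exact: (sqdiff_ge0 k (x, z)).
rewrite /sqmodulus -!ge0_intRZl//; try by [exact: mI].
rewrite -ge0_intRD//; first last.
- by move=> x _; rewrite mule_ge0.
- by move=> x _; rewrite mule_ge0.
- by apply: measurable_funeM; exact: mI.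
- by apply: measurable_funeM; exact: mI.
apply: ge0_le_intR => //.
- exact: mI.
- by apply: emeasurable_funD; apply: measurable_funeM; exact: mI.
move=> x _.
have mf1 := measurable_pair1r mf2 x; have mg1 := measurable_pair1r mg2 x.
rewrite -!ge0_intRZl//; last 2 first.
- by move=> z _; exact: (sqdiff_ge0 g (x, z)).
- by move=> z _; exact: (sqdiff_ge0 f (x, z)).
rewrite -ge0_intRD//; first last.
- by move=> z _; rewrite mule_ge0//; exact: (sqdiff_ge0 g (x, z)).
- by move=> z _; rewrite mule_ge0//; exact: (sqdiff_ge0 f (x, z)).
- exact: measurable_funeM.
- exact: measurable_funeM.
apply: ge0_le_intR => //.
- exact: (measurable_pair1r mfg2 x).
- by apply: emeasurable_funD; exact: measurable_funeM.
- by move=> z _; exact: (sqdiff_ge0 (f \+ g)%R (x, z)).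
move=> z _; rewrite -!EFinM -EFinD lee_fin /=.
move: (f (x + z)) (f x) (g (x + z)) (g x) => a b c d.
by have := sqr_ge0 ((a - b) - (c - d)); lra.
Qed.

Variable G : R -> R.
Hypothesis mG : measurable_fun [set: R] G.

Let Om (e x : R) : \bar R := (\int[mu]_(z in `[(- e)%R, e]) ((G (x + z) - G x) ^+ 2)%:E)%E.

Let Om0 e x : (0 <= Om e x)%E.
Proof. by apply: integral_ge0 => z _; exact: (sqdiff_ge0 G (x, z)). Qed.

Let mOm e : measurable_fun [set: R] (Om e).
Proof. exact: (measurable_integral2_in (measurable_itv _) (measurable_sqdiff mG) (sqdiff_ge0 G)). Qed.

(* Averaging over the intermediate points a + z with z in [0, e]. *)
Lemma sqdiff_le_modulus (a b e : R) : 0 < e -> `|a - b| <= e ->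
  (((G a - G b) ^+ 2)%:E <= (e^-1)%:E * (2%:E * Om (2 * e) a + 2%:E * Om (2 * e) b))%E.
Proof.
move=> e0; rewrite ler_norml => /andP[ab1 ab2].
rewrite -lee_pdivrMl; last by rewrite invr_gt0.
rewrite invrK.
have mF x : measurable_fun [set: R] (fun z => ((G (x + z) - G x) ^+ 2)%:E).
  exact: (measurable_pair1r (measurable_sqdiff mG) x).
have F0 x z : (0 <= ((G (x + z) - G x) ^+ 2)%:E)%E by exact: (sqdiff_ge0 G (x, z)).
(* The intermediate point a + z is also b + (z + (a - b)), and z + (a - b) lies in [- e, 2 e]; hence
   the window 2 e for both points. *)
apply: (@le_trans _ _ (\int[mu]_(z in `[0%R, e]) (2%:E * ((G (a + z) - G a) ^+ 2)%:E
    + 2%:E * ((G (b + (z + (a - b))%R) - G b) ^+ 2)%:E))%E).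
  have -> : (e%:E * ((G a - G b) ^+ 2)%:E = \int[mu]_(z in `[0%R, e]) ((G a - G b) ^+ 2)%:E)%E.
    by rewrite integral_itv_cst ?ltW// subr0 -EFinM mulrC.
  have mFs : measurable_fun [set: R] (fun z => ((G (b + (z + (a - b))%R) - G b) ^+ 2)%:E).
    apply: (measurableT_comp (mF b)); exact: measurable_funD.
  apply: ge0_le_intR => //.
  - by apply: emeasurable_funD; exact: measurable_funeM.
  - by move=> z _; rewrite lee_fin sqr_ge0.
  move=> z _; rewrite -!EFinM -EFinD lee_fin (_ : b + (z + (a - b)) = a + z); last by ring.
  move: (G (a + z)) (G a) (G b) => u v w.
  by have := sqr_ge0 ((u - v) + (u - w)); lra.
have mFs : measurable_fun [set: R] (fun z => ((G (b + (z + (a - b))%R) - G b) ^+ 2)%:E).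
  apply: (measurableT_comp (mF b)); exact: measurable_funD.
rewrite ge0_intRD//; first last.
- by move=> z _; rewrite mule_ge0.
- by move=> z _; rewrite mule_ge0.
- exact: measurable_funeM.
- exact: measurable_funeM.
rewrite !ge0_intRZl//.
apply: leeD; apply: lee_wpmul2l => //.
  apply: ge0_subset_integral => //; first by apply: measurable_funTS; exact: mF.
  by apply: subset_itv; rewrite bnd_simp; lra.
rewrite (@ge0_integral_itv_shift _ (a - b) 0 e true false (fun z => ((G (b + z) - G b) ^+ 2)%:E))//.
apply: ge0_subset_integral => //; first by apply: measurable_funTS; exact: mF.
by apply: subset_itv; rewrite bnd_simp; lra.
Qed.

Hypothesis pG : periodic G 1.

Let pOm e x : Om e (x + 1) = Om e x.
Proof. by apply: eq_integral => z _; rewrite addrAC !pG. Qed.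

(* The range of t |-> a t + th on [-T, 2T] is covered by 7T unit cells. *)
Lemma integral_modulus_affine_le (a th e : R) (T : nat) : 0 < a <= 2 -> 0 <= th < 1 -> (0 < T)%N ->
  (\int[mu]_(t in `[(- T%:R)%R, (2 * T%:R)%R]) Om e (a * t + th)%R <=
   (a^-1)%:E * ((7 * T)%:R%:E * sqmodulus `[0%R, 1%R]%classic G e))%E.
Proof.
move=> /andP[a0 a2] /andP[th0 th1] T0.
have T1 : (1 : R) <= T%:R by rewrite ler1n.
rewrite ge0_integral_itv_affine//.
apply: lee_wpmul2l; first by rewrite lee_fin invr_ge0 ltW.
(* Since 0 < a <= 2, 0 <= th < 1 and T >= 1, the arguments lie in [- 2 T, 4 T + 1], inside the cells
   from - 2 T to 5 T. *)
have H := ge0_integral_periodic_le (pOm e) (mOm e) (Om0 e) (- (2 * T)%N%:Z) (7 * T).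
apply: le_trans H.
apply: ge0_subset_integral => //; first by apply: measurable_funTS; exact: mOm.
rewrite mulrNz -pmulrn !natrM.
have aT : a * T%:R <= 2 * T%:R by rewrite ler_wpM2r.
have aT0 : 0 < a * T%:R by rewrite mulr_gt0// ltr0n.
by apply: subset_itv; rewrite bnd_simp; lra.
Qed.

(** The arguments differ by (a - b) t with |t| <= 2 T, so by at most e, and the pointwise bound at a
    and b can be integrated. Each of the two terms carries a factor 2 / e and runs over 7 T cells,
    whence 14. *)
Lemma integral_dilation_le (a b th e : R) (T : nat) : 0 < a <= 2 -> 0 < b <= 2 -> 0 <= th < 1 ->
  (0 < T)%N -> 0 < e -> `|a - b| * (2 * T%:R) <= e ->
  (\int[mu]_(t in `[(- T%:R)%R, (2 * T%:R)%R]) ((G (a * t + th) - G (b * t + th)) ^+ 2)%:E <=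
   (14 * T%:R / e * (a^-1 + b^-1))%:E * sqmodulus `[0%R, 1%R]%classic G (2 * e))%E.
Proof.
move=> ha hb hth T0 e0 abT.
have [/andP[a0 _] /andP[b0 _]] := (ha, hb).
have mOc c : measurable_fun [set: R] (fun t => Om (2 * e) (c * t + th)).
  exact: (measurableT_comp (mOm (2 * e)) (measurable_affine c th)).
have mGc c : measurable_fun [set: R] (fun t => G (c * t + th)).
  exact: (measurableT_comp mG (measurable_affine c th)).
have ei0 : 0 <= e^-1 by rewrite invr_ge0 ltW.
set S := sqmodulus _ _ _.
apply: (@le_trans _ _ (\int[mu]_(t in `[(- T%:R)%R, (2 * T%:R)%R])
   ((e^-1)%:E * (2%:E * Om (2 * e) (a * t + th)%R + 2%:E * Om (2 * e) (b * t + th)%R)))%E).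
  apply: ge0_le_intR => //.
  - by apply/measurable_EFinP; apply: measurable_funX; apply: measurable_funB.
  - by apply: measurable_funeM; apply: emeasurable_funD; exact: measurable_funeM.
  - by move=> t _; rewrite lee_fin sqr_ge0.
  move=> t; rewrite /= in_itv/= => /andP[t1 t2]; apply: sqdiff_le_modulus => //.
  rewrite (_ : _ - _ = (a - b) * t); last by ring.
  rewrite normrM (le_trans _ abT)// ler_wpM2l// ler_norml t2 andbT (le_trans _ t1)//.
  by rewrite lerN2 ler_peMl// ler1n.
rewrite ge0_intRZl//; first last.
- by move=> t _; rewrite adde_ge0// mule_ge0.
- by apply: emeasurable_funD; exact: measurable_funeM.
rewrite ge0_intRD//; first last.
- by move=> t _; rewrite mule_ge0.
- by move=> t _; rewrite mule_ge0.
- exact: measurable_funeM.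
- exact: measurable_funeM.
rewrite !ge0_intRZl//.
apply: (@le_trans _ _ ((e^-1)%:E * (2%:E * ((a^-1)%:E * ((7 * T)%:R%:E * S)) +
   2%:E * ((b^-1)%:E * ((7 * T)%:R%:E * S))))%E).
  apply: lee_wpmul2l => //; apply: leeD; apply: lee_wpmul2l => //;
  exact: integral_modulus_affine_le.
have S0 : (0 <= S)%E by apply: integral_ge0 => x _; exact: Om0.
rewrite !muleA -ge0_muleDl//; try by rewrite lee_fin !mulr_ge0// ?invr_ge0 ltW.
rewrite muleA -!EFinM natrM.
rewrite (_ : e^-1 * _ = 14 * T%:R / e * (a^-1 + b^-1))//.
by ring.
Qed.
End dilation.

(** * The classes of the statement *)

Section Lp_classes.
Context {R : realType}.
Notation mu := (@lebesgue_measure R).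
Implicit Types (f g h : R -> R) (p : nat).

Lemma measurable_normrXn p f : measurable_fun [set: R] f ->
  measurable_fun [set: R] (fun x => (`|f x| ^+ p)%:E).
Proof.
by move=> mf; apply/measurable_EFinP; apply: measurable_funX; apply: measurableT_comp.
Qed.

Lemma normrXn_ge0 p f x : (0 <= (`|f x| ^+ p)%:E)%E.
Proof. by rewrite lee_fin exprn_ge0. Qed.

Lemma normrDXn_le p (a b : R) : `|a + b| ^+ p <= 2 ^+ p * `|a| ^+ p + 2 ^+ p * `|b| ^+ p.
Proof.
wlog ab : a b / `|a| <= `|b|.
  by move=> H; have [/H//|/ltW/H] := leP (`|a|) (`|b|); rewrite addrC [leRHS]addrC.
rewrite -[leLHS]add0r; apply: lerD; first by rewrite mulr_ge0// exprn_ge0.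
rewrite -exprMn; apply: lerXn2r; rewrite ?nnegrE ?mulr_ge0//.
by apply: (le_trans (ler_normD _ _)); lra.
Qed.

Lemma integral_normrDXn_le p f g (D : set R) : measurable D ->
  measurable_fun [set: R] f -> measurable_fun [set: R] g ->
  (\int[mu]_(x in D) (`|f x + g x| ^+ p)%:E <=
   (2 ^+ p)%:E * \int[mu]_(x in D) (`|f x| ^+ p)%:E +
   (2 ^+ p)%:E * \int[mu]_(x in D) (`|g x| ^+ p)%:E)%E.
Proof.
move=> mD mf mg.
have mfp := measurable_normrXn p mf; have mgp := measurable_normrXn p mg.
have mfg : measurable_fun [set: R] (fun x => f x + g x) by exact: measurable_funD.
have p0 : (0 <= (2 ^+ p : R)%:E)%E by rewrite lee_fin exprn_ge0.
rewrite -!ge0_intRZl//; try by move=> x _; exact: normrXn_ge0.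
rewrite -ge0_intRD//; first last.
- exact: measurable_funeM.
- exact: measurable_funeM.
apply: ge0_le_intR => //.
- exact: measurable_normrXn.
- by apply: emeasurable_funD; exact: measurable_funeM.
by move=> x _; rewrite -!EFinM -EFinD lee_fin; exact: normrDXn_le.
Qed.

Lemma integral_normrZXn p f (c : R) (D : set R) : measurable D ->
  measurable_fun [set: R] f ->
  (\int[mu]_(x in D) (`|c * f x| ^+ p)%:E =
   (`|c| ^+ p)%:E * \int[mu]_(x in D) (`|f x| ^+ p)%:E)%E.
Proof.
move=> mD mf; rewrite -ge0_intRZl ?lee_fin ?exprn_ge0//.
- by apply: eq_integral => x _; rewrite normrM exprMn EFinM.
exact: measurable_normrXn.
Qed.

Lemma Lp_locD p f g : Lp_loc p f -> Lp_loc p g -> Lp_loc p (fun x => f x + g x).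
Proof.
move=> [mf Lf] [mg Lg]; split; first exact: measurable_funD.
move=> K cK; have mK : measurable K by exact: compact_measurable.
apply: (le_lt_trans (integral_normrDXn_le p mK mf mg)).
by apply: lte_add_pinfty; apply: lte_mul_pinfty => //; [exact: Lf|exact: Lg].
Qed.

Lemma Lp_unifP p f : Lp_unif p f <->
  measurable_fun [set: R] f /\
  exists2 M : R, 0 <= M & forall t, (\int[mu]_(s in `[t, (t + 1)%R]) (`|f s| ^+ p)%:E <= M%:E)%E.
Proof.
split=> -[mf H]; split=> //.
  set S := ereal_sup _ in H.
  have HS t : (\int[mu]_(s in `[t, (t + 1)%R]) (`|f s| ^+ p)%:E <= S)%E.
    by apply: ereal_sup_ubound; exists t.
  have S0 : (0 <= S)%E.
    by apply: le_trans (HS 0); apply: integral_ge0 => x _; exact: normrXn_ge0.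
  exists (fine S); first exact: fine_ge0.
  by move=> t; rewrite fineK ?ge0_fin_numE.
have [M _ HM] := H.
by apply: (@le_lt_trans _ _ M%:E); rewrite ?ltry//; apply: ge_ereal_sup => _ [t _ <-].
Qed.

Lemma Lp_unifD p f g : Lp_unif p f -> Lp_unif p g -> Lp_unif p (fun x => f x + g x).
Proof.
move=> /Lp_unifP[mf [M M0 HM]] /Lp_unifP[mg [N N0 HN]]; apply/Lp_unifP; split.
  exact: measurable_funD.
exists (2 ^+ p * M + 2 ^+ p * N); first by rewrite addr_ge0// mulr_ge0// exprn_ge0.
move=> t; apply: (le_trans (integral_normrDXn_le p (measurable_itv _) mf mg)).
rewrite EFinD !EFinM; apply: leeD; apply: lee_wpmul2l => //; by rewrite lee_fin exprn_ge0.
Qed.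

Lemma Lp_unifZ p f (c : R) : Lp_unif p f -> Lp_unif p (fun x => c * f x).
Proof.
move=> /Lp_unifP[mf [M M0 HM]]; apply/Lp_unifP; split; first exact: measurable_funM.
exists (`|c| ^+ p * M); first by rewrite mulr_ge0// exprn_ge0.
move=> t; by rewrite integral_normrZXn// EFinM; apply: lee_wpmul2l.
Qed.

Lemma Lp_unif_affine p h (a b : R) : Lp_loc p h -> periodic h 1 -> 0 < a ->
  Lp_unif p (fun t => h (a * t + b)).
Proof.
move=> Lh ph a0; have [mh _] := Lh; apply/Lp_unifP; split.
  exact: (measurableT_comp mh (measurable_affine a b)).
pose S := (\int[mu]_(x in `[0%R, 1%R]) (`|h x| ^+ p)%:E)%E.
have S0 : (0 <= S)%E by apply: integral_ge0 => x _; exact: normrXn_ge0.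
have SE : S = (fine S)%:E by rewrite fineK// ge0_fin_numE// Lp_loc_itv.
have s0 : 0 <= fine S by exact: fine_ge0.
have mhp := measurable_normrXn p mh.
(* The image window has length a and starts inside the cell at [k], so it ends before k + 1 + (trunc
   a + 1). *)
pose n := (Num.trunc a).+2.
exists (a^-1 * (n%:R * fine S)).
  by apply: mulr_ge0; [rewrite invr_ge0 ltW|exact: mulr_ge0].
move=> t; rewrite (ge0_integral_itv_affine b t (t + 1) a0 mhp); last exact: normrXn_ge0.
rewrite EFinM; apply: lee_wpmul2l; first by rewrite lee_fin invr_ge0 ltW.
pose k := Num.floor (a * t + b).
have hp1 x : (`|h (x + 1)| ^+ p)%:E = (`|h x| ^+ p)%:E by rewrite ph.
have := ge0_integral_periodic_le hp1 mhp (normrXn_ge0 p h) k n.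
rewrite -/S [in X in (_ <= X)%E -> _]SE -EFinM; apply: le_trans.
apply: ge0_subset_integral => //; first exact: measurable_funTS.
have /andP[k1 k2] := floor_itv (a * t + b).
have /andP[_ n1] := trunc_itv (ltW a0).
apply: subset_itv; rewrite bnd_simp//.
move: k2 n1; rewrite intrD -/k /n -natr1 => k2 n1; lra.
Qed.

Lemma Lp_norm_itv_ge0 p (a b : R) f : (0 <= Lp_norm_itv p a b f)%E.
Proof. exact: Lnorm_ge0. Qed.

Lemma Lp_norm_itv_le p (a b M : R) f : (0 < p)%N -> measurable_fun [set: R] f -> 0 <= M ->
  (\int[mu]_(x in `[a, b]) (`|f x| ^+ p)%:E <= (M ^+ p)%:E)%E ->
  (Lp_norm_itv p a b f <= M%:E)%E.
Proof.
move=> p0 mf M0 H.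
have p0' : (p%:R : R) != 0 by rewrite pnatr_eq0 -lt0n.
have E : ((Lp_norm_itv p a b f) `^ p%:R = \int[mu]_(x in `[a, b]) (`|f x| ^+ p)%:E)%E.
  rewrite /Lp_norm_itv poweR_Lnorm// [RHS]integral_mkcond; apply: eq_integral => x _.
  rewrite patchE; change ((EFin \o f \_ `[a, b]) x) with (((f \_ `[a, b]) x)%:E).
  rewrite patchE; case: ifP => _; first by rewrite poweR_EFin powR_mulrn.
  by rewrite abse0 poweR_EFin powR0.
have L0 := Lp_norm_itv_ge0 p a b f.
move: E L0 H => <-; case: (Lp_norm_itv p a b f) => [x| |]//.
  rewrite poweR_EFin !lee_fin => x0; rewrite powR_mulrn// ler_pXn2r//.
by rewrite poweRyr.
Qed.

End Lp_classes.

(** * The representation of the potential *)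

Section change_of_variables.
Context {R : realType}.
Notation mu := (@lebesgue_measure R).
Implicit Types (f phi : R -> R) (a b x : R).

Lemma Rintegral_affine a b f : 0 < a -> measurable_fun [set: R] f ->
  \int[mu]_x f (a * x + b) = a^-1 * \int[mu]_x f x.
Proof.
move=> a0 mf; rewrite /Rintegral.
have mE : measurable_fun [set: R] (EFin \o f) by exact/measurable_EFinP.
have -> := integral_affine b a0 mE.
case: (integral _ _ _) => [r| |] /=; first by [].
  by rewrite gt0_muley ?lte_fin ?invr_gt0//= mulr0.
by rewrite gt0_muleNy ?lte_fin ?invr_gt0//= mulr0.
Qed.

Lemma Lp_loc_affine (p : nat) f a b : 0 < a -> Lp_loc p f ->
  Lp_loc p (fun x => f (a * x + b)).
Proof.
move=> a0 Lf; have [mf _] := Lf.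
have mfa : measurable_fun [set: R] (fun x => f (a * x + b)).
  exact: (measurableT_comp mf (measurable_affine a b)).
split=> // A cA.
have mA : measurable A by exact: compact_measurable.
have [N [_ HN]] := compact_bounded cA.
apply: (@le_lt_trans _ _ (\int[mu]_(x in `[(- (N + 1))%R, (N + 1)%R]%classic) (`|f (a * x + b)%R| ^+ p)%:E)%E).
  apply: ge0_subset_integral => //.
    by apply: measurable_funTS; exact: measurable_normrXn.
  move=> x Ax; rewrite /= in_itv/= -ler_norml; apply: HN => //.
  by rewrite ltrDl.
rewrite (ge0_integral_itv_affine b _ _ a0 (measurable_normrXn p mf)); last exact: normrXn_ge0.
by apply: lte_mul_pinfty; rewrite ?lee_fin ?invr_ge0 ?(ltW a0)//; exact: Lp_loc_itv.
Qed.

Lemma is_derive_comp_affine f a b x df : is_derive (a * x + b) 1 f df ->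
  is_derive x 1 (fun y => f (a * y + b)) (a * df).
Proof.
move=> fx.
have h : is_derive x 1 (fun y : R => a * y + b) a.
  have := is_deriveD (is_derive_scale a x) (is_derive_cst b x 1).
  by move=> h; apply: is_derive_eq h _; rewrite addr0.
have h2 := @is_derive1_comp R f (fun y => a * y + b) x df a fx h.
by apply: (is_derive_eq h2); rewrite mulrC.
Qed.

Lemma derive1n_comp_affine f a b n : smooth f ->
  derive1n n (fun y => f (a * y + b)) = fun y => a ^+ n * derive1n n f (a * y + b).
Proof.
move=> sf; elim: n => [|n IH]; first by apply/funext => y; rewrite expr0 mul1r.
rewrite derive1nS IH; apply/funext => y; rewrite derive1E.
have h : is_derive (a * y + b) 1 (derive1n n f) (derive1n n.+1 f (a * y + b)).
  by rewrite derive1nS derive1E; apply/derivableP; exact: sf.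
have h2 := is_deriveZ (a ^+ n) (is_derive_comp_affine h).
rewrite (@derive_val _ _ _ _ _ _ _ h2) /GRing.scale/= exprSr mulrA.
by [].
Qed.

Lemma test_function_affine phi a b : 0 < a -> test_function phi ->
  test_function (fun x => phi ((x - b) / a)).
Proof.
move=> a0 [sphi [K HK]].
have E : (fun x => phi ((x - b) / a)) = fun x => phi (a^-1 * x + (- b / a)).
  by apply/funext => x; congr phi; ring.
split.
  rewrite E => n x; rewrite derive1n_comp_affine//.
  have h : is_derive (a^-1 * x + (- b / a)) 1 (derive1n n phi) (derive1n n.+1 phi (a^-1 * x + (- b / a))).
    by rewrite derive1nS derive1E; apply/derivableP; exact: sphi.
  by have [] := is_deriveZ (a^-1 ^+ n) (is_derive_comp_affine h).
exists (a * `|K| + `|b|) => x Kx; apply: HK.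
rewrite normrM normfV (gtr0_norm a0) ltr_pdivlMr//.
have h1 := ler_norm K; have h2 := ler_normD (x - b) b; rewrite subrK in h2.
apply: (@le_lt_trans _ _ (`|K| * a)); first by rewrite ler_wpM2r// ltW.
by rewrite mulrC; lra.
Qed.

Lemma derive1_comp_affineV phi a b : 0 < a -> test_function phi -> forall t,
  (fun x => phi ((x - b) / a))^`()%classic (a * t + b) = a^-1 * phi^`()%classic t.
Proof.
move=> a0 tphi t.
have E : (fun x => phi ((x - b) / a)) = fun x => phi (a^-1 * x + (- b / a)).
  by apply/funext => x; congr phi; ring.
have Et : a^-1 * (a * t + b) + - b / a = t by field; rewrite gt_eqF.
rewrite E derive1E.
have h := is_derive_comp_affine (test_function_is_derive (a^-1 * (a * t + b) + - b / a) tphi).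
by rewrite (@derive_val _ _ _ _ _ _ _ h) Et.
Qed.

End change_of_variables.

Section potential.
Context {R : realType}.
Notation mu := (@lebesgue_measure R).
Variables (sigma1 sigma2 tau1 tau2 : R -> R) (alpha theta c : R).
Hypotheses (hsigma1 : Lp_loc 2 sigma1) (hsigma2 : Lp_loc 2 sigma2).
Hypotheses (htau1 : Lp_loc 1 tau1) (htau2 : Lp_loc 1 tau2).
Hypothesis alpha_gt0 : 0 < alpha.

Variable P : R -> R.
Hypothesis LP : Lp_loc 2 P.
Hypothesis dP : forall psi, test_function psi ->
  \int[mu]_x (P x * psi^`()%classic x) = - \int[mu]_x ((tau2 x - c) * psi x).

(** Everything is carried to the variable x = alpha t + theta, where phi becomes [psi] and phi'
    becomes alpha psi'. As P' = tau2 - c, the chain rule makes (tau2 - c)(alpha t + theta) the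
    derivative of [alpha^-1] P(alpha t + theta). The same factor arises for sigma2, because its
    derivative is taken before the affine composition. *)
Lemma potential_eq : distr_eq
  (distr_add
    (distr_add (distr_derive (distr_of sigma1))
               (distr_affine alpha theta (distr_derive (distr_of sigma2))))
    (distr_add (distr_of tau1)
               (distr_of (fun t => tau2 (alpha * t + theta)))))
  (distr_add
    (distr_derive (distr_of (fun t => sigma1 t + alpha^-1 * (sigma2 (alpha * t + theta) + P (alpha * t + theta)))))
    (distr_of (fun t => tau1 t + c))).
Proof.
move=> phi tphi.
have [G GE] : exists G, forall x, G x = sigma2 x + P x by eexists.
rewrite (_ : (fun t => sigma1 t + _ * _) = fun t => sigma1 t + alpha^-1 * G (alpha * t + theta)); last first.
  by apply/funext => t; rewrite GE.
have LG : Lp_loc 2 G by rewrite (funext GE); exact: Lp_locD.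
have [mG _] := LG; have [mt2 _] := htau2.
have td := test_function_derive tphi.
pose psi x := phi ((x - theta) / alpha).
have tpsi : test_function psi by exact: test_function_affine.
have tdpsi := test_function_derive tpsi.
have psiE t : psi (alpha * t + theta) = phi t.
  by rewrite /psi; congr phi; field; rewrite gt_eqF.
have dpsiE t : psi^`()%classic (alpha * t + theta) = alpha^-1 * phi^`()%classic t.
  exact: derive1_comp_affineV.
have a0 : alpha != 0 by rewrite gt_eqF.
have mpsi := test_function_measurable tpsi.
have mdpsi := test_function_measurable tdpsi.
have E1 : \int[mu]_t ((sigma1 t + alpha^-1 * G (alpha * t + theta)) * phi^`()%classic t) =
    \int[mu]_t (sigma1 t * phi^`()%classic t) +
    alpha^-1 * \int[mu]_t (G (alpha * t + theta) * phi^`()%classic t).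
  have i1 := test_function_integrable (ltn0Sn 1) hsigma1 td.
  have i2 := test_function_integrable (ltn0Sn 1) (Lp_loc_affine theta alpha_gt0 LG) td.
  have i3 := integrableZl measurableT alpha^-1 i2.
  rewrite -(RintegralZl _ measurableT i2) -(RintegralD measurableT i1 i3).
  by apply: eq_Rintegral => t _; rewrite mulrDl -mulrA.
have E2 : \int[mu]_t (G (alpha * t + theta) * phi^`()%classic t) =
    \int[mu]_x (G x * psi^`()%classic x).
  have i2 := test_function_integrable (ltn0Sn 1) LG tdpsi.
  have -> : \int[mu]_x (G x * psi^`()%classic x) = alpha^-1 * \int[mu]_x (alpha * (G x * psi^`()%classic x)).
    by have := RintegralZl alpha measurableT i2; rewrite /= => ->; rewrite mulrA mulVf// mul1r.
  have mF : measurable_fun [set: R] (fun x => alpha * (G x * psi^`()%classic x)).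
    by apply: measurable_funM => //; exact: measurable_funM.
  rewrite -(Rintegral_affine theta alpha_gt0 mF).
  by apply: eq_Rintegral => t _; rewrite dpsiE; field.
have E3 : \int[mu]_x (G x * psi^`()%classic x) =
    \int[mu]_x (sigma2 x * psi^`()%classic x) - \int[mu]_x ((tau2 x - c) * psi x).
  have i1 := test_function_integrable (ltn0Sn 1) hsigma2 tdpsi.
  have i2 := test_function_integrable (ltn0Sn 1) LP tdpsi.
  rewrite -(dP tpsi) -(RintegralD measurableT i1 i2).
  by apply: eq_Rintegral => x _; rewrite GE mulrDl.
have E4 : \int[mu]_t (tau2 (alpha * t + theta) * phi t) = alpha^-1 * \int[mu]_x (tau2 x * psi x).
  have mF : measurable_fun [set: R] (fun x => tau2 x * psi x) by exact: measurable_funM.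
  rewrite -(Rintegral_affine theta alpha_gt0 mF).
  by apply: eq_Rintegral => t _; rewrite psiE.
have i1psi := integrable_test_function tpsi.
have i1phi := integrable_test_function tphi.
have E5 : \int[mu]_x ((tau2 x - c) * psi x) = \int[mu]_x (tau2 x * psi x) - c * \int[mu]_x psi x.
  have i1 := test_function_integrable (ltn0Sn 0) htau2 tpsi.
  have i2 := integrableZl measurableT c i1psi.
  rewrite -(RintegralZl _ measurableT i1psi) -(RintegralB measurableT i1 i2).
  by apply: eq_Rintegral => x _; rewrite mulrDl mulNr.
have E6 : \int[mu]_t phi t = alpha^-1 * \int[mu]_x psi x.
  by rewrite -(Rintegral_affine theta alpha_gt0 mpsi); apply: eq_Rintegral => t _; rewrite psiE.
have E7 : \int[mu]_t ((tau1 t + c) * phi t) = \int[mu]_t (tau1 t * phi t) + c * \int[mu]_t phi t.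
  have i1 := test_function_integrable (ltn0Sn 0) htau1 tphi.
  have i2 := integrableZl measurableT c i1phi.
  rewrite -(RintegralZl _ measurableT i1phi) -(RintegralD measurableT i1 i2).
  by apply: eq_Rintegral => x _; rewrite mulrDl.
rewrite /distr_add /distr_derive /distr_of /distr_affine -/psi.
have key (A B C D E a X1 X2 X3 X4 X5 X6 X7 : R) : X1 = A + a * X2 -> X2 = X3 ->
    X3 = B - X5 -> X4 = a * C -> X5 = C - c * D -> X6 = a * D -> X7 = E + c * X6 ->
    - A + a * - B + (E + X4) = - X1 + X7.
  by move=> -> -> -> -> -> -> ->; ring.
rewrite (gtr0_norm alpha_gt0).
exact: key E1 E2 E3 E4 E5 E6 E7.
Qed.

End potential.

(** * Liouville numbers *)

Section diophantine.
Context {R : realType}.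
Implicit Types (alpha D r K B u : R) (T : nat -> nat).

(** Multiplication by N! sends every k / n with n <= N to an integer but alpha to a non-integer; d
    is the distance of N! alpha to the integers, divided by N!. *)
Lemma irrational_dist alpha (N : nat) : irrational alpha ->
  exists2 d : R, 0 < d & forall (k : int) (n : nat), (0 < n <= N)%N ->
    d <= `|alpha - k%:~R / n%:R|.
Proof.
move=> irr.
have F0 : 0 < (N`!%:R : R) by rewrite ltr0n fact_gt0.
pose x := N`!%:R * alpha; pose j := Num.floor x.
have /andP[j1 j2] := floor_itv x; rewrite -/j intrD in j1 j2.
have xj : j%:~R < x.
  rewrite lt_neqAle j1 andbT; apply/eqP => jx; apply: irr; apply/rationalP.
  by exists j, N`!; rewrite jx /x mulrC mulKf// gt_eqF.
pose d := Num.min (x - j%:~R) (j%:~R + 1 - x).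
have d0 : 0 < d by rewrite lt_min !subr_gt0 xj.
exists (d / N`!%:R); first by rewrite divr_gt0.
move=> k n /andP[n0 nN].
have n0' : (n%:R : R) != 0 by rewrite pnatr_eq0 -lt0n.
have /dvdnP[q Hq] : (n %| N`!)%N by rewrite dvdn_fact// n0.
rewrite ler_pdivrMr// -[X in _ * X]gtr0_norm// -normrM.
rewrite (_ : _ * _ = x - (k * q%:Z)%:~R); last first.
  by rewrite mulrBl /x mulrC Hq natrM intrM; congr (_ - _); rewrite mulrCA !mulrA mulfVK// mulrC.
have [kj|jk] := leP (k * q%:Z)%R j.
  have := kj; rewrite -(ler_int R) => kj'.
  by rewrite ge_min ger0_norm; lra.
have : j + 1 <= (k * q%:Z)%R by rewrite lezD1.
rewrite -(ler_int R) intrD => kj'.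
rewrite ge_min ler0_norm ?opprB; lra.
Qed.

Lemma ler_nat_expR (n : nat) : n%:R <= expR 1 ^+ n :> R.
Proof.
rewrite -expRM_natl mulr1; apply: le_trans (expR_ge1Dx _).
by rewrite lerDr.
Qed.

Lemma near_div_natS_lt D (e : R) : 0 < D -> 0 < e -> \forall m \near \oo, D / m.+1%:R < e.
Proof.
move=> D0 e0; have eD : 0 < e / D by rewrite divr_gt0.
near=> m; rewrite mulrC -ltr_pdivlMr//.
by near: m; exact: (near_infty_natSinv_lt (PosNum eD)).
Unshelve. all: by end_near. Qed.

(** Indices are shifted by one, as the definition speaks of m >= 1 only. With c = max(C, 1) and T >=
    1, both 4 c <= (4 c)^T and T <= exp(1)^T hold, so D = 4 c exp(1) absorbs all factors into the
    base. Denominators at most N would keep the error above some d > 0, whereas it is eventually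
    below d; hence T tends to infinity. *)
Lemma liouville_approx alpha : liouville alpha ->
  exists (k : nat -> int) (T : nat -> nat) (D : R),
  [/\ 0 < D, forall m, (0 < T m)%N, forall N : nat, \forall m \near \oo, (N <= T m)%N &
   forall m, `|alpha - (k m)%:~R / (T m)%:R| * (4 * (T m)%:R) <= (D / m.+1%:R) ^+ T m].
Proof.
move=> [irr [k [T [C HC]]]].
pose c := Num.max C 1.
have c1 : 1 <= c by rewrite le_max lexx orbT.
have c0 : 0 < c by exact: lt_le_trans c1.
pose D := 4 * c * expR 1.
have D0 : 0 < D by rewrite !mulr_gt0// expR_gt0.
have T0 m : (0 < T m.+1)%N by have [] := HC m.+1 isT.
have key m : `|alpha - (k m.+1)%:~R / (T m.+1)%:R| * (4 * (T m.+1)%:R) <= (D / m.+1%:R) ^+ T m.+1.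
  have [_ h] := HC m.+1 isT.
  have {}h : `|alpha - (k m.+1)%:~R / (T m.+1)%:R| <= c * m.+1%:R ^- T m.+1.
    apply: (le_trans h); rewrite ler_wpM2r ?invr_ge0 ?exprn_ge0//.
    by rewrite le_max lexx.
  apply: (@le_trans _ _ (c * m.+1%:R ^- T m.+1 * (4 * (T m.+1)%:R))).
    by rewrite ler_wpM2r.
  rewrite /D expr_div_n exprMn.
  rewrite (_ : c * _ * _ = (4 * c) * (T m.+1)%:R / m.+1%:R ^+ T m.+1); last by ring.
  rewrite ler_wpM2r ?invr_ge0 ?exprn_ge0//.
  apply: ler_pM => //; [lra| |exact: ler_nat_expR].
  by apply: ler_eXnr => //; lra.
exists (fun m => k m.+1), (fun m => T m.+1), D; split => // N.
have [d d0 Hd] := irrational_dist N irr.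
near=> m; rewrite leqNgt; apply/negP => /ltnW TN.
have /Hd : (0 < T m.+1 <= N)%N by rewrite T0.
move=> /(_ (k m.+1)); apply/negP; rewrite -ltNge.
have Dm0 : 0 <= D / m.+1%:R by rewrite divr_ge0// ltW.
have Dm1 : D / m.+1%:R <= 1 by apply: ltW; near: m; exact: near_div_natS_lt.
have Dmd : D / m.+1%:R < d by near: m; exact: near_div_natS_lt.
apply: le_lt_trans Dmd.
apply: (@le_trans _ _ ((D / m.+1%:R) ^+ T m.+1)); last by apply: ler_iXnr.
apply: le_trans (key m); rewrite ler_peMr//.
have : 1 <= (T m.+1)%:R :> R by rewrite ler1n.
by lra.
Unshelve. all: by end_near. Qed.

(** Moved under the root, the exponential becomes exp(2 B)^n; together with K n <= (max(K, 1)
    exp(1))^n the whole is at most v^n, and v^n <= v since n >= 1 and v <= 1. *)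
Lemma expR_sqrt_le B K u (n : nat) : (0 < n)%N -> 0 <= u ->
  let v := expR (2 * B) * Num.max K 1 * expR 1 * u in v <= 1 ->
  expR (B * n%:R) * Num.sqrt (K * n%:R * u ^+ n) <= Num.sqrt v.
Proof.
move=> n0 u0 v v1.
have K1 : 1 <= Num.max K 1 by rewrite le_max lexx orbT.
have v0 : 0 <= v by rewrite !mulr_ge0 ?expR_ge0// (le_trans _ K1).
rewrite -[X in X * _]gtr0_norm ?expR_gt0// -sqrtr_sqr -sqrtrM ?sqr_ge0//.
apply: ler_wsqrtr; apply: (@le_trans _ _ (v ^+ n)); last by apply: ler_iXnr.
rewrite /v !exprMn -[expR (2 * B) ^+ n]expRM_natl -expRM_natl.
rewrite (_ : 2 * (B * n%:R) = n%:R * (2 * B)); last by ring.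
rewrite -!mulrA ler_wpM2l ?expR_ge0//.
rewrite !mulrA ler_wpM2r ?exprn_ge0//.
apply: (@le_trans _ _ (Num.max K 1 * n%:R)).
  by rewrite ler_wpM2r// le_max lexx.
apply: ler_pM => //; [by rewrite (le_trans _ K1)| |exact: ler_nat_expR].
exact: ler_eXnr.
Qed.

(** The smallness comes from the base: [L * u m] tends to 0 for every [B], and once it is below 1,
    [expR_sqrt_le] bounds the sequence by its square root. *)
Lemma liouville_decay D r B K T : 0 < D -> 0 < r -> (forall m, (0 < T m)%N) ->
  (fun m => expR (B * (T m)%:R) *
     Num.sqrt (K * (T m)%:R * ((D / m.+1%:R) `^ r) ^+ T m)) @ \oo --> (0 : R).
Proof.
move=> D0 r0 T0.
pose L := expR (2 * B) * Num.max K 1 * expR 1.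
have L0 : 0 < L by rewrite !mulr_gt0 ?expR_gt0// lt_max ltr01 orbT.
pose u m := (D / m.+1%:R) `^ r.
have u0 m : 0 <= u m by exact: powR_ge0.
have uL e : 0 < e -> \forall m \near \oo, L * u m <= e.
  move=> e0.
  near=> m.
  have hm2 : D / m.+1%:R <= (e / L) `^ r^-1.
    by apply: ltW; near: m; apply: near_div_natS_lt; rewrite // powR_gt0// divr_gt0.
  rewrite mulrC -ler_pdivlMr//.
  rewrite -[leRHS]powRr1; last by rewrite divr_ge0// ltW.
  rewrite -(mulVf (lt0r_neq0 r0)) powRrM.
  apply: ge0_ler_powR => //; rewrite ?nnegrE ?powR_ge0 ?(ltW r0)//.
  by rewrite divr_ge0// ltW.
apply/cvgr0Pnorm_le => e e0.
near=> m.
have h1 : L * u m <= 1 by near: m; exact: uL.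
have h2 : L * u m <= e ^+ 2 by near: m; apply: uL; rewrite exprn_gt0.
rewrite ger0_norm; last by rewrite mulr_ge0 ?expR_ge0 ?sqrtr_ge0.
apply: (le_trans (expR_sqrt_le (T0 m) (u0 m) h1)).
by rewrite -(ger0_norm (ltW e0)) -sqrtr_sqr; apply: ler_wsqrtr.
Unshelve. all: by end_near. Qed.

End diophantine.

(** * The approximations *)

Section gordon.
Context {R : realType}.
Notation mu := (@lebesgue_measure R).

Lemma Rintegral_sub_mean (f : R -> R) : Lp_loc 1 f ->
  \int[mu]_(x in `[0, 1]) (f x - \int[mu]_(y in `[0, 1]) f y) = 0.
Proof.
move=> Lf; set c := \int[mu]_(y in _) f y.
have i1 := Lp_loc_integrable 0 1 (ltn0Sn 0) Lf.
have i2 := Lp_loc_integrable 0 1 (ltn0Sn 0) (Lp_loc_cst 1 c).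
rewrite (@RintegralB _ _ _ mu `[0%R, 1%R]%classic f (cst c) _ i1 i2)//.
by rewrite /Rintegral integral_itv_cst// subr0 mulr1 subrr.
Qed.

Lemma sigma_primitive_modulus (sigma w : R -> R) (s : R) :
  Lp_loc 2 sigma -> W2_loc s sigma -> 0 < s -> Lp_loc 1 w ->
  exists2 C : R, 0 <= C & forall e, 0 < e <= 1 ->
    (sqmodulus `[0%R, 1%R]%classic (sigma \+ primitive w)%R e <=
      (C * (e * e `^ Num.min 1 s))%:E)%E.
Proof.
move=> Ls Ws s0 Lw.
have [C1 C10 H1] := W2_loc_modulus Ls Ws s0.
have [C2 C20 H2] := primitive_modulus Lw.
exists (2 * C1 + 2 * C2); first by rewrite addr_ge0// mulr_ge0.
move=> e e01; have /andP[e0 e1] := e01.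
have [ms _] := Ls; have mP := measurable_primitive Lw.
apply: (le_trans (sqmodulusD e (measurable_itv _) ms mP)).
have er : e * e <= e * e `^ Num.min 1 s.
  apply: ler_wpM2l; first exact: ltW.
  rewrite -{1}[e]powRr1; last exact: ltW.
  apply: ger_powR => //.
  by rewrite ge_min lexx.
set X := e * e `^ _ in er *.
have -> : ((2 * C1 + 2 * C2) * X)%:E = (2%:E * (C1 * X)%:E + 2%:E * (C2 * X)%:E)%E.
  by rewrite -!EFinM -EFinD; congr EFin; ring.
apply: leeD; apply: lee_wpmul2l => //.
  exact: H1.
apply: (le_trans (H2 e e01)); by rewrite lee_fin; apply: ler_wpM2l.
Qed.

(** The dilation estimate is used with e = d / 2, so that the modulus is taken at d; this explains 4
    T in the hypothesis on a - b. The constant is 14 * 2 * 3 = 84: the 2 from 1 / (d / 2), the 3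
    from 1 / a + 1 / b <= 3 / a, as b >= a / 2. *)
Lemma Lp_norm_dilation_le (G : R -> R) (C r a b th d : R) (T : nat) :
  measurable_fun [set: R] G -> periodic G 1 -> 0 <= C ->
  (forall e, 0 < e <= 1 ->
    (sqmodulus `[0%R, 1%R]%classic G e <= (C * (e * e `^ r))%:E)%E) ->
  0 < a <= 1 -> a / 2 <= b <= 2 -> 0 <= th < 1 -> (0 < T)%N ->
  0 < d <= 1 -> `|a - b| * (4 * T%:R) <= d ->
  (Lp_norm_itv 2 (- T%:R)%R (2 * T%:R)%R
     (fun t => a^-1 * (G (a * t + th) - G (b * t + th)))%R <=
   (Num.sqrt (84 * C / a ^+ 3 * T%:R * d `^ r))%:E)%E.
Proof.
move=> mG pG C0 HC /andP[a0 a1] /andP[b1 b2] hth T0 /andP[d0 d1] abd.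
have mGc c : measurable_fun [set: R] (fun t => G (c * t + th)).
  exact: (measurableT_comp mG (measurable_affine c th)).
have mD : measurable_fun [set: R] (fun t => G (a * t + th) - G (b * t + th)).
  exact: measurable_funB.
have X0 : 0 <= 84 * C / a ^+ 3 * T%:R * d `^ r.
  by rewrite !mulr_ge0 ?powR_ge0// invr_ge0 exprn_ge0// ltW.
apply: Lp_norm_itv_le => //; first exact: measurable_funM.
rewrite sqr_sqrtr// integral_normrZXn//.
have b0 : 0 < b by apply: lt_le_trans b1; rewrite divr_gt0.
have abd2 : `|a - b| * (2 * T%:R) <= d / 2 by lra.
have a2 : 0 < a <= 2 by rewrite a0/=; lra.
have b02 : 0 < b <= 2 by rewrite b0.
have d20 : 0 < d / 2 by rewrite divr_gt0.
have H := integral_dilation_le mG pG a2 b02 hth T0 d20 abd2.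
under eq_integral do rewrite real_normK ?num_real//.
have ai0 : 0 < a^-1 by rewrite invr_gt0.
apply: (@le_trans _ _ ((a^-1 ^+ 2)%:E * ((14 * T%:R / (d / 2) * (a^-1 + b^-1))%:E * (C * (d * d `^ r))%:E))%E).
  rewrite gtr0_norm//; apply: lee_wpmul2l; first by rewrite lee_fin sqr_ge0.
  apply: (le_trans H); apply: lee_wpmul2l.
    by rewrite lee_fin !mulr_ge0// ?addr_ge0 ?invr_ge0 ?ltW.
  rewrite (_ : 2 * (d / 2) = d); last by lra.
  by apply: HC; rewrite d0.
rewrite -!EFinM lee_fin.
have bi : b^-1 <= 2 * a^-1.
  have : b^-1 <= (a / 2)^-1 by rewrite lef_pV2 ?posrE// divr_gt0.
  by rewrite invfM invrK mulrC.
rewrite (_ : a^-1 ^+ 2 * _ = 28 * C * a^-1 ^+ 2 * T%:R * d `^ r * (a^-1 + b^-1)); last first.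
  by move: (d `^ r) => X; field; rewrite gt_eqF//= gt_eqF//= gt_eqF.
rewrite (_ : 84 * C / _ * _ * _ = 28 * C * a^-1 ^+ 2 * T%:R * d `^ r * (3 * a^-1)); last first.
  by move: (d `^ r) => X; field; rewrite gt_eqF.
apply: ler_wpM2l; last by lra.
apply: mulr_ge0; last exact: powR_ge0.
by apply: mulr_ge0 => //; apply: mulr_ge0; [exact: mulr_ge0|exact: sqr_ge0].
Qed.

End gordon.

Theorem theorem1p2 (R : realType) (sigma1 sigma2 tau1 tau2 : R -> R)
    (alpha theta : R)
    (hsigma1 : Lp_loc 2 sigma1) (hsigma2 : Lp_loc 2 sigma2)
    (htau1 : Lp_loc 1 tau1) (htau2 : Lp_loc 1 tau2)
    (psigma1 : periodic sigma1 1) (psigma2 : periodic sigma2 1)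
    (ptau1 : periodic tau1 1) (ptau2 : periodic tau2 1)
    (halpha : 0 <= alpha < 1) (htheta : 0 <= theta < 1)
    (alpha_liouville : liouville alpha)
    (s : R) (s_gt0 : 0 < s) (W2sigma2 : W2_loc s sigma2) :
  let q : (R -> R) -> R :=
    distr_add
      (distr_add (distr_derive (distr_of sigma1))
                 (distr_affine alpha theta (distr_derive (distr_of sigma2))))
      (distr_add (distr_of tau1)
                 (distr_of (fun t => tau2 (alpha * t + theta)))) in
  singular_Gordon q.
Proof.
move=> q.
have /andP[alpha_ge0 alpha_lt1] := halpha.
have alpha_gt0 : 0 < alpha.
  rewrite lt_neqAle alpha_ge0 andbT; apply/eqP => alpha0.
  case: alpha_liouville => irr _; apply: irr; apply/rationalP.
  by exists 0, 1%N; rewrite mul0r.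
pose c : R := \int[@lebesgue_measure R]_(x in `[0, 1]) tau2 x.
have [w wE] : exists w : R -> R, forall x, w x = tau2 x - c by eexists.
have Lw : Lp_loc 1 w.
  by rewrite (funext wE); apply: Lp_locD => //; exact: Lp_loc_cst.
have w0 : \int[@lebesgue_measure R]_(y in `[0, 1]) w y = 0.
  by under eq_Rintegral do rewrite wE; exact: Rintegral_sub_mean.
have pw : periodic w 1 by move=> x; rewrite !wE ptau2.
have pP : periodic (primitive w) 1 by exact: periodic_primitive.
have LP := Lp_loc_primitive Lw.
have [G GE] : exists G : R -> R, forall x, G x = sigma2 x + primitive w x by eexists.
have pG : periodic G 1 by move=> x; rewrite !GE psigma2 pP.
have LG : Lp_loc 2 G by rewrite (funext GE); exact: Lp_locD.
have [mG _] := LG.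
have [C C0 HC] := sigma_primitive_modulus hsigma2 W2sigma2 s_gt0 Lw.
have {}HC e : 0 < e <= 1 ->
    (sqmodulus `[0%R, 1%R]%classic G e <= (C * (e * e `^ Num.min 1 s))%:E)%E.
  by rewrite (funext GE); exact: HC.
set r := Num.min 1 s in HC.
have r0 : 0 < r by rewrite lt_min ltr01.
have [k [T [D [D0 T0 Tinf HT]]]] := liouville_approx alpha_liouville.
have unif1 (f : R -> R) p : Lp_loc p f -> periodic f 1 -> Lp_unif p f.
  move=> Lf pf; have := Lp_unif_affine 0 Lf pf ltr01.
  by congr Lp_unif; apply/funext => t; rewrite mul1r addr0.
pose beta m : R := (k m)%:~R / (T m)%:R.
(* Finitely many indices are discarded: beyond m0 the approximants lie in [alpha / 2, 2], as
   [Lp_norm_dilation_le] requires, and the base D / (m + 1) is at most 1, so that its powers are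
   admissible as d. *)
have [m0 Hm0] : exists m0, forall m, D / (m + m0).+1%:R <= 1 /\ alpha / 2 <= beta (m + m0)%N <= 2.
  have [m0 _ H] := near_div_natS_lt D0 (divr_gt0 alpha_gt0 (ltr0n R 2)).
  exists m0 => m; have {}H : D / (m + m0).+1%:R < alpha / 2 by apply: H; rewrite /= leq_addl.
  have D1 : D / (m + m0).+1%:R <= 1 by move: H; move: (D / _) => X; lra.
  split=> //.
  have h : `|alpha - beta (m + m0)%N| <= alpha / 2.
    apply: le_trans (ltW H); apply: (@le_trans _ _ ((D / (m + m0).+1%:R) ^+ T (m + m0)%N)).
      apply: le_trans (HT _); rewrite ler_peMr//.
      have : 1 <= (T (m + m0)%N)%:R :> R by rewrite ler1n.
      by lra.
    by apply: ler_iXnr => //; rewrite divr_ge0// ltW.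
  by move: h; rewrite ler_norml => /andP[h1 h2]; apply/andP; split; lra.
pose Tm m : R := (T (m + m0)%N)%:R.
exists (fun t => sigma1 t + alpha^-1 * G (alpha * t + theta)), (fun t => tau1 t + c).
split.
- by apply: Lp_unifD; [exact: unif1|apply: Lp_unifZ; exact: Lp_unif_affine].
- apply: unif1; first by apply: Lp_locD => //; exact: Lp_loc_cst.
  by move=> x; rewrite ptau1.
- rewrite (_ : (fun t => sigma1 t + _ * _) = fun t => sigma1 t + alpha^-1 * (sigma2 (alpha * t + theta) + primitive w (alpha * t + theta))); last first.
    by apply/funext => t; rewrite GE.
  apply: potential_eq => // psi tpsi.
  by rewrite (primitive_by_parts Lw tpsi); congr (- _); apply: eq_Rintegral => x _; rewrite wE.
exists Tm, (fun m t => sigma1 t + alpha^-1 * G (beta (m + m0)%N * t + theta)),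
  (fun _ t => tau1 t + c).
split.
- by move=> m; rewrite ltr0n.
- apply/cvgryPge => A; near=> m; apply: (le_trans (ltW (truncnS_gt A))).
  rewrite ler_nat; near: m.
  have [N _ HN] := Tinf (Num.truncn A).+1.
  by exists N => // m Nm; apply: HN; rewrite /= (leq_trans Nm)// leq_addr.
- move=> m; have [_ /andP[b1 b2]] := Hm0 m.
  have b0 : 0 < beta (m + m0)%N by apply: lt_le_trans b1; rewrite divr_gt0.
  split.
    by apply: Lp_unifD; [exact: unif1|apply: Lp_unifZ; exact: Lp_unif_affine].
  move=> t; rewrite (periodicn psigma1); congr (_ + _ * _).
  (* The product of [beta] with its denominator is the integer [k], so translating t by the period
     moves the argument of G by an integer. *)
  rewrite mulrDr /beta mulfVK ?pnatr_eq0 -?lt0n// addrAC.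
  by rewrite (periodicz pG).
- move=> m; split.
    apply: unif1; first by apply: Lp_locD => //; exact: Lp_loc_cst.
    by move=> x; rewrite ptau1.
  by move=> t; rewrite (periodicn ptau1).
move=> B.
(* The norm bound at d = (D / (m + 1))^T, with d^r rewritten as the T-th power of (D / (m + 1))^r,
   the shape treated by [liouville_decay]. *)
pose E m := expR (B * (T m)%:R) *
   Num.sqrt (84 * C / alpha ^+ 3 * (T m)%:R * ((D / m.+1%:R) `^ r) ^+ T m).
have E0 : (fun m => E (m + m0)%N) @ \oo --> (0 : R).
  rewrite (cvg_shiftn m0 E); exact: liouville_decay.
apply: (@squeeze_cvge _ _ _ _ (cst 0%E) _ (fun m => (E (m + m0)%N)%:E)); first last.
- by apply/fine_cvgP; split; [exact: nearW|exact: E0].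
- exact: cvg_cst.
apply: nearW => m; apply/andP; split.
  by rewrite mule_ge0 ?lee_fin ?expR_ge0// adde_ge0// Lp_norm_itv_ge0.
rewrite EFinM; apply: lee_wpmul2l; first by rewrite lee_fin expR_ge0.
have -> : ((fun t => tau1 t + c) \- (fun t => tau1 t + c))%R = cst 0.
  by apply/funext => t; rewrite /= subrr.
have tau0 : (Lp_norm_itv 1 (- Tm m) (2 * Tm m)%R (cst 0%R) <= 0)%E.
  apply: Lp_norm_itv_le => //.
  by rewrite expr1 integral0_eq// => x _; rewrite normr0 expr1.
rewrite -[leRHS]adde0; apply: leeD => //.
have -> : ((fun t => sigma1 t + alpha^-1 * G (alpha * t + theta)%R) \-
    (fun t => sigma1 t + alpha^-1 * G (beta (m + m0)%N * t + theta)))%R =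
  fun t => alpha^-1 * (G (alpha * t + theta) - G (beta (m + m0)%N * t + theta)).
  by apply/funext => t /=; ring.
have [D1 hb] := Hm0 m.
have Dm0 : 0 < D / (m + m0).+1%:R by rewrite divr_gt0.
rewrite -[(D / _) `^ r ^+ _]powR_mulrn ?powR_ge0// powRAC powR_mulrn; last exact: ltW.
apply: (Lp_norm_dilation_le mG pG C0 HC) => //.
- by rewrite alpha_gt0 ltW.
- by rewrite exprn_gt0//= exprn_ile1// ltW.
- exact: HT.
Unshelve. all: by end_near. Qed.
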